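(* For each $n$, let $M_n$ be an $n\times n$ random Hermitian matrix whose entries on and above the diagonal are independent random variables with mean $0$ and variance $1$. Assume furthermore that for each $1\le i\le n$ the vector $X_i\in\mathbb{C}^{n-1}$, obtained by deleting the $i$-th entry of the $i$-th row vector of $M_n$, is $K$-concentrated (with constants $C_0,C_0'$ not depending on $n$ or $i$), where $K=K(n)$ may depend on $n$. Then the threshold scale for the local semi-circle law (LSCL) is bounded from above by $K^2\log n/n$; that is, the LSCL holds for $W_n=\frac1{\sqrt n}M_n$ at the scale $f(n)=K^2\log n/n$.
   Context: Let $\rho_{sc}(x)=\frac{1}{2\pi}\sqrt{4-x^2}$ for $|x|\le2$ and $\rho_{sc}(x)=0$ for $|x|>2$. For an interval $I$, $N_I$ denotes the number of eigenvalues of $W_n=\frac1{\sqrt n}M_n$ in $I$, and $|I|$ is its length. The LSCL holds at scale $f(n)$ if with probability $1-o(1)$ as $n\to\infty$, $$\left|N_I-n\int_I\rho_{sc}(x)\,dx\right|\le\delta n|I|$$ for any interval $I$ in the bulk of length $\omega(f(n))$ and any fixed $\delta>0$. Explicitly: for all fixed $\epsilon,\delta>0$ and every function $g(n)\to\infty$, with probability $1-o(1)$ the inequality holds simultaneously for all intervals $I\subset(-2+\epsilon,2-\epsilon)$ with $|I|\ge g(n)f(n)$. A function $f(n)$ is a threshold scale if the LSCL holds at scale $f(n)$ but does not hold at scale $g(n)$ for any function $g(n)=o(f(n))$. A random vector $X$ in $\mathbb{C}^m$ is $K$-concentrated, with constants $C_0,C_0'>0$, if for every convex function $F:\mathbb{C}^m\to\mathbb{R}$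 that is $1$-Lipschitz with respect to the Euclidean norm and every $t>0$, $\mathbf{P}(|F(X)-M(F(X))|\ge t)\le C_0\exp(-C_0't^2/K^2)$, where $M(Y)$ denotes a median of $Y$ (chosen arbitrarily if there are several). The variance of a complex random variable $\xi$ is $\mathbf{E}|\xi-\mathbf{E}\xi|^2$. *)

(* Defs.v *)
From mathcomp Require Export all_boot all_order all_algebra.
From mathcomp Require Export complex.
From mathcomp Require Export all_classical all_reals all_analysis.

Set Implicit Arguments.
Unset Strict Implicit.
Unset Printing Implicit Defensive.

Import Order.TTheory GRing.Theory Num.Theory.
Import numFieldNormedType.Exports.

Local Open Scope classical_set_scope.
Local Open Scope ring_scope.

(* R[i] carries no measurable structure in the libraries, so a complex random
   variable is handled through the measurable space R * R of the pairs
   (real part, imaginary part). *)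
Definition cpair (R : realType) (z : R[i]) : R * R :=
  (complex.Re z, complex.Im z).

Definition complex_rv (d : measure_display) (T : measurableType d)
    (R : realType) (X : T -> R[i]) : Prop :=
  measurable_fun [set: T] (fun w => cpair (X w)).

Definition complex_integrable (d : measure_display) (T : measurableType d)
    (R : realType) (P : probability T R) (X : T -> R[i]) : Prop :=
  P.-integrable [set: T] (fun w => (complex.Re (X w))%:E) /\
  P.-integrable [set: T] (fun w => (complex.Im (X w))%:E).

Definition complex_expectation (d : measure_display) (T : measurableType d)
    (R : realType) (P : probability T R) (X : T -> R[i]) : R[i] :=
  Complex (fine 'E_P[fun w => complex.Re (X w)])
          (fine 'E_P[fun w => complex.Im (X w)]).

Definition complex_variance (d : measure_display) (T : measurableType d)
    (R : realType) (P : probability T R) (X : T -> R[i]) : \bar R :=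
  'E_P[fun w => ComplexField.Normc.normc (X w - complex_expectation P X) ^+ 2].

Definition mutually_independent (d : measure_display) (T : measurableType d)
    (R : realType) (P : probability T R) (I : finType) (D : {set I})
    (X : I -> T -> R[i]) : Prop :=
  forall (J : {set I}) (B : I -> set (R * R)),
    J \subset D -> (forall i, measurable (B i)) ->
    P (\bigcap_(i in [set` J]) [set w | B i (cpair (X i w))]) =
    (\prod_(i in J) P [set w | B i (cpair (X i w))])%E.

Definition enorm (R : realType) (m : nat) (v : 'rV[R[i]]_m) : R :=
  Num.sqrt (\sum_(j < m) ComplexField.Normc.normc (v ord0 j) ^+ 2).

(* Convexity for the underlying real vector space of C^m. *)
Definition real_convex (R : realType) (m : nat) (F : 'rV[R[i]]_m -> R) : Prop :=
  forall (x y : 'rV[R[i]]_m) (t : R), 0 <= t <= 1 ->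
    F (real_complex R t *: x + real_complex R (1 - t) *: y)
      <= t * F x + (1 - t) * F y.

Definition lipschitz1 (R : realType) (m : nat) (F : 'rV[R[i]]_m -> R) : Prop :=
  forall x y : 'rV[R[i]]_m, `|F x - F y| <= enorm (x - y).

Definition is_median (d : measure_display) (T : measurableType d)
    (R : realType) (P : probability T R) (Y : T -> R) (med : R) : Prop :=
  ((2^-1)%:E <= P [set w | (Y w <= med)%R])%E /\
  ((2^-1)%:E <= P [set w | (med <= Y w)%R])%E.

(* The median is any one chosen median of F(X), fixed before t. *)
Definition concentrated (d : measure_display) (T : measurableType d)
    (R : realType) (P : probability T R) (C0 C0' K : R) (m : nat)
    (X : T -> 'rV[R[i]]_m) : Prop :=
  forall F : 'rV[R[i]]_m -> R, real_convex F -> lipschitz1 F ->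
    exists2 med : R, is_median P (fun w => F (X w)) med &
      forall t : R, 0 < t ->
        (P [set w | (t <= `|F (X w) - med|)%R]
           <= (C0 * expR (- (C0' * t ^+ 2 / K ^+ 2)))%R%:E)%E.

Definition rho_sc (R : realType) (x : R) : R :=
  if `|x| <= 2 then (2 * pi)^-1 * Num.sqrt (4 - x ^+ 2) else 0.

Definition normalized (R : realType) (n : nat) (A : 'M[R[i]]_n) : 'M[R[i]]_n :=
  real_complex R (Num.sqrt n%:R)^-1 *: A.

(* For Hermitian A, spectral_diag A lists the eigenvalues with multiplicity,
   and they are real. *)
Definition eig_count (R : realType) (n : nat) (A : 'M[R[i]]_n)
    (I : interval R) : nat :=
  #|[set i : 'I_n | complex.Re (spectral_diag A ord0 i) \in I]|.

Definition itv_length (R : realType) (I : interval R) : R :=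
  fine (lebesgue_measure [set` I]).

(* The events E n need not be known to be measurable: the probability of
   measurable events contained in them is asked to tend to 1. *)
Definition with_high_probability (R : realType) (d : nat -> measure_display)
    (T : forall n, measurableType (d n)) (P : forall n, probability (T n) R)
    (E : forall n, set (T n)) : Prop :=
  exists A : forall n, set (T n),
    [/\ forall n, measurable (A n),
        forall n, A n `<=` E n &
        (fun n => P n (A n)) @ \oo --> (1%:E : \bar R)].

Definition LSCL_at_scale (R : realType) (d : nat -> measure_display)
    (T : forall n, measurableType (d n)) (P : forall n, probability (T n) R)
    (M : forall n, T n -> 'M[R[i]]_n) (f : nat -> R) : Prop :=
  forall (eps delta : R) (g : nat -> R), 0 < eps -> 0 < delta ->
    g n @[n --> \oo] --> +oo ->
    with_high_probability P (fun n => [set w | forall I : interval R,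
      [set` I] `<=` `](-2 + eps), (2 - eps)[%classic ->
      g n * f n <= itv_length I ->
      `|(eig_count (normalized (M n w)) I)%:R
          - n%:R * Rintegral lebesgue_measure [set` I] (@rho_sc R)|
        <= delta * n%:R * itv_length I]).

(* Main.v *)
Require Import Defs.
From mathcomp Require Import ring lra zify measurable_realfun.

Set Implicit Arguments.
Unset Strict Implicit.
Unset Printing Implicit Defensive.

Import Order.TTheory GRing.Theory Num.Theory.
Import numFieldNormedType.Exports.

Local Open Scope classical_set_scope.
Local Open Scope ring_scope.

(** Why the law holds down to the scale K^2 log n / n.

Write W for the normalized matrix, G(z) for its resolvent at z = x + iy and
s(z) for the normalized trace of G(z).  The imaginary part of s is the average
over the eigenvalues of a Poisson kernel of width y, so that eigenvalue counts
in intervals longer than y can be read off from it.  By the Schur complement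
([resolvent_schur]) the i-th diagonal entry of G is 1 / (W_ii - z - Y_i), where
Y_i is the value at the i-th row of the quadratic form of the resolvent of the
i-th minor.  If every Y_i is close to s, then averaging over i gives s close to
- 1 / (z + s).  This equation is stable in the bulk ([quadratic_close]), and its
solution has imaginary part sqrt (1 - x^2 / 4), which is pi times the semicircle
density ([local_law]).

Concentration controls Y_i as follows.  For a Hermitian B and a weight phi with
values in [0, 1], the square root of the quadratic form of phi(B) is a seminorm
bounded by the Euclidean norm, hence convex and 1-Lipschitz.  The row is
isotropic, so its second moment is the trace of phi(B).  The tail bound around
the median then yields a tail bound around the square root of that trace
([quad_conc]), and the row is independent of the minor, which may therefore be
frozen ([conditioning], [row_bad_prob]).  The imaginary part of Y_i has the
nonnegative weight that this requires, its real part has not; but the real part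
telescopes over the scales y, 4 y, 16 y and so on, and each increment is a
combination of two weights between 0 and the Poisson weight of that scale
([wgt2_bound], [re_err_step]), with errors that form a geometric series.

Two a priori bounds make the argument run.  If Im s exceeded 4, then every Im Y_i
would be at least 1, every diagonal entry of G at most 1, and Im s at most 1
([stieltjes_im_le4]).  And z + s stays away from 0: this is clear at the largest
scale, and it descends because dividing y by 4 divides Im s by at most 4
([shifted_lower]).  Diagonal entries of W have only a second moment; a Markov
bound shows that few of them are large, and each of those rows costs at most
1 / y in the trace ([card_large_diag], [self_consistent]).

Counting uses a grid whose spacing is a small multiple of the width eta.  Sums of
Poisson kernels over the grid telescope to differences of arctangents
([poisson_sum]).  An eigenvalue well inside the grid receives nearly the full
mass pi, which bounds the count from above ([count_upper]); eigenvalues outside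
contribute only a tail, which the bound on Im s at a larger scale makes small
([count_lower]).

For the scale, let r be the fourth root of g and eta = r^2 K^2 log n / n.
Deviations of order K sqrt(log n), which have probability of order n^-4, are then
of order 1 / r relative to sqrt (n eta), and there are only of the order of n^3
events: rows, grid points, scales ([scale_choice], [lscl_step]).  Unit variance
prevents K from being small ([concentration_lower]), so n eta tends to infinity. *)

Local Open Scope sesquilinear_scope.
Local Notation normc := ComplexField.Normc.normc.
Local Notation ReC := complex.Re.
Local Notation ImC := complex.Im.

(** * Real and imaginary parts, modulus *)

Section ComplexNumbers.
Variable R : realType.
Implicit Types (z w : R[i]) (a x y : R).

Lemma ReD z w : ReC (z + w) = ReC z + ReC w. Proof. by case: z; case: w. Qed.
Lemma ImD z w : ImC (z + w) = ImC z + ImC w. Proof. by case: z; case: w. Qed.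
Lemma ReN z : ReC (- z) = - ReC z. Proof. by case: z. Qed.
Lemma ImN z : ImC (- z) = - ImC z. Proof. by case: z. Qed.
Lemma ReC_M z w : ReC (z * w) = ReC z * ReC w - ImC z * ImC w.
Proof. by case: z; case: w. Qed.
Lemma ImC_M z w : ImC (z * w) = ReC z * ImC w + ImC z * ReC w.
Proof. by case: z; case: w. Qed.
Lemma ReC_conj z : ReC (Num.conj z) = ReC z. Proof. by case: z. Qed.
Lemma ImC_conj z : ImC (Num.conj z) = - ImC z. Proof. by case: z. Qed.

Lemma Re_sum (I : Type) (r : seq I) (P : pred I) (F : I -> R[i]) :
  ReC (\sum_(i <- r | P i) F i) = \sum_(i <- r | P i) ReC (F i).
Proof. exact: (big_morph _ ReD (erefl _)). Qed.

Lemma Im_sum (I : Type) (r : seq I) (P : pred I) (F : I -> R[i]) :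
  ImC (\sum_(i <- r | P i) F i) = \sum_(i <- r | P i) ImC (F i).
Proof. exact: (big_morph _ ImD (erefl _)). Qed.

Lemma complex_ext z w : ReC z = ReC w -> ImC z = ImC w -> z = w.
Proof. by case: z => a b; case: w => c d /= -> ->. Qed.

Lemma normc_sqr z : normc z ^+ 2 = ReC z ^+ 2 + ImC z ^+ 2.
Proof. by case: z => a b /=; rewrite sqr_sqrtr// addr_ge0// sqr_ge0. Qed.

Lemma normc_ge0 z : 0 <= normc z.
Proof. by case: z => a b /=; exact: sqrtr_ge0. Qed.

Lemma normc_eq0 z : (normc z == 0) = (z == 0).
Proof.
apply/eqP/eqP => [|->]; first exact: ComplexField.Normc.eq0_normc.
exact: ComplexField.Normc.normc0.
Qed.

Lemma normc_real a : normc (real_complex R a) = `|a|.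
Proof. by rewrite /= expr0n /= addr0 sqrtr_sqr. Qed.

Lemma normc_conj z : normc (Num.conj z) = normc z.
Proof. by case: z => a b /=; rewrite sqrrN. Qed.

Lemma Re_le_normc z : `|ReC z| <= normc z.
Proof. by case: z => a b /=; rewrite -sqrtr_sqr ler_wsqrtr// lerDl sqr_ge0. Qed.

Lemma Im_le_normc z : `|ImC z| <= normc z.
Proof. by case: z => a b /=; rewrite -sqrtr_sqr ler_wsqrtr// lerDr sqr_ge0. Qed.

Lemma normc_le_ReIm z : normc z <= `|ReC z| + `|ImC z|.
Proof.
rewrite -(ler_pXn2r (n := 2)) ?nnegrE ?addr_ge0 ?normc_ge0//.
rewrite normc_sqr -(real_normK (num_real (ReC z))) -(real_normK (num_real (ImC z))).
by have := normr_ge0 (ReC z); have := normr_ge0 (ImC z); nra.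
Qed.

Lemma normc_sum (I : Type) (r : seq I) (P : pred I) (F : I -> R[i]) :
  normc (\sum_(i <- r | P i) F i) <= \sum_(i <- r | P i) normc (F i).
Proof.
elim/big_rec2: _ => [|i a z _ h]; first by rewrite ComplexField.Normc.normc0.
by apply: (le_trans (le_normcD _ _)); rewrite lerD2l.
Qed.

Lemma normcB z w : normc (z - w) = normc (w - z).
Proof. by rewrite -normcN opprB. Qed.

Lemma conjCM_normc z : z * Num.conj z = real_complex R (normc z ^+ 2).
Proof.
apply: complex_ext; rewrite ?ReC_M ?ImC_M ReC_conj ImC_conj normc_sqr /= ; ring.
Qed.

Lemma Re_realM a z : ReC (real_complex R a * z) = a * ReC z.
Proof. by rewrite ReC_M /= mul0r subr0. Qed.
Lemma Im_realM a z : ImC (real_complex R a * z) = a * ImC z.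
Proof. by rewrite ImC_M /= mul0r addr0. Qed.

Lemma Re_inv z : ReC z^-1 = ReC z / normc z ^+ 2.
Proof. by rewrite normc_sqr; case: z. Qed.
Lemma Im_inv z : ImC z^-1 = - ImC z / normc z ^+ 2.
Proof. by rewrite normc_sqr mulNr; case: z. Qed.

End ComplexNumbers.

(** * Schur complement and spectral calculus *)

Lemma invmx_uniq (F : fieldType) n (A B : 'M[F]_n) :
  A *m B = 1%:M -> A \in unitmx /\ invmx A = B.
Proof.
move=> AB; have [UA _] := mulmx1_unit AB; split=> //.
by rewrite -[LHS]mulmx1 -AB mulmxA mulVmx// mul1mx.
Qed.

Lemma mulmx_conjB (F : fieldType) n (U D E V : 'M[F]_n) :
  U *m D *m V - U *m E *m V = U *m (D - E) *m V.
Proof. by rewrite -mulmxBl -mulmxBr. Qed.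

Lemma mulmx_conjM (F : fieldType) n (U D E V : 'M[F]_n) : V *m U = 1%:M ->
  U *m D *m V *m (U *m E *m V) = U *m (D *m E) *m V.
Proof. by move=> VU; rewrite !mulmxA -(mulmxA (U *m D)) VU mulmx1. Qed.

(** The Schur complement formulas for the corner entry and the trace of the
inverse: the inverse is written down in block form and identified by uniqueness. *)
Lemma schur_block (F : fieldType) (m : nat) (a : F) (r : 'rV[F]_m) (c : 'cV[F]_m)
    (B : 'M[F]_m) :
  let A := block_mx a%:M r c B : 'M[F]_(1 + m) in
  let del := a - (r *m invmx B *m c) ord0 ord0 in
  B \in unitmx -> del != 0 ->
  (invmx A) ord0 ord0 = del^-1 /\
  \tr (invmx A) = del^-1 + \tr (invmx B)
     + (r *m (invmx B *m invmx B) *m c) ord0 ord0 / del.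
Proof.
move=> A del UB del0; pose B' := invmx B.
pose X : 'M[F]_(1 + m) := block_mx (del^-1)%:M (- del^-1 *: (r *m B'))
  (- del^-1 *: (B' *m c)) (B' + del^-1 *: (B' *m c *m (r *m B'))).
have rBc : r *m (B' *m c) = (a - del)%:M.
  by rewrite mulmxA [LHS]mx11_scalar /del opprB addrC subrK.
have BB c' (M : 'M[F]_(m,c')) : B *m (B' *m M) = M by rewrite mulmxA mulmxV// mul1mx.
have AX : A *m X = 1%:M.
  rewrite /A /X mulmx_block (@scalar_mx_block F 1 m 1); congr block_mx.
  - rewrite -scalemxAr rBc mul_scalar_mx scale_scalar_mx.
    rewrite scale_scalar_mx -raddfD /=; congr (_%:M).
    by field.
  - rewrite mul_scalar_mx mulmxDr -scalemxAr -!mulmxA [r *m (B' *m (c *m _))]mulmxA.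
    rewrite [_ *m (c *m _)]mulmxA.
    rewrite -(mulmxA r B' c) rBc mul_scalar_mx !scalerA addrCA -{1}[r *m B']scale1r -!scalerDl.
    rewrite (_ : _ + _ = 0) ?scale0r//; by field.
  - by rewrite -scalemxAr BB mul_mx_scalar -scalerDl subrr scale0r.
  - rewrite mulmxDr mulmxV// -!scalemxAr -!mulmxA BB scaleNr addrCA addNr addr0//.
have [_ XE] := invmx_uniq AX; split.
  transitivity (X (lshift m ord0) (lshift m ord0)).
    by rewrite XE; congr (X _ _); exact/val_inj.
  rewrite /X.
  by rewrite block_mxEul mxE eqxx mulr1n.
rewrite XE /X mxtrace_block mxtraceD mxtraceZ mxtrace_scalar mulr1n addrA.
congr (_ + _ + _); rewrite mulrC; congr (_ * _).
by rewrite mxtrace_mulC !mulmxA [LHS]/mxtrace big_ord1.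
Qed.

Section SpectralCalculus.
Variable R : realType.
Local Notation C := R[i].
Local Notation RtoC := (real_complex R).

(** Real part of the eigenvalue; it is the eigenvalue itself when [A] is Hermitian. *)
Definition eigv n (A : 'M[C]_n) (j : 'I_n) : R := ReC (spectral_diag A ord0 j).

Definition spectral_fun n (A : 'M[C]_n) (d : 'I_n -> C) : 'M[C]_n :=
  (spectralmx A)^t* *m diag_mx (\row_j d j) *m spectralmx A.

(** Mass that the spectral measure of [A] at the row vector [v] gives to the j-th eigenvector. *)
Definition sweight n (A : 'M[C]_n) (v : 'rV[C]_n) (j : 'I_n) : R :=
  normc ((v *m (spectralmx A)^t*) ord0 j) ^+ 2.

(** The quadratic form of phi(A) at [v], by functional calculus. *)
Definition specform n (A : 'M[C]_n) (phi : R -> R) (v : 'rV[C]_n) : R :=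
  \sum_j phi (eigv A j) * sweight A v j.

Definition spectr n (A : 'M[C]_n) (phi : R -> R) : R := \sum_j phi (eigv A j).

Definition resolvent n (A : 'M[C]_n) (z : C) : 'M[C]_n := invmx (A - z%:M).

Definition qform n (Q : 'M[C]_n) (v : 'rV[C]_n) : C := (v *m Q *m v^t*) ord0 ord0.

Lemma sweight_ge0 n (A : 'M[C]_n) v j : 0 <= sweight A v j.
Proof. exact: sqr_ge0. Qed.

Lemma spectralmxK n (A : 'M[C]_n) : spectralmx A *m (spectralmx A)^t* = 1%:M.
Proof. exact/unitarymxP/spectral_unitarymx. Qed.

Lemma spectralmxKV n (A : 'M[C]_n) : (spectralmx A)^t* *m spectralmx A = 1%:M.
Proof. exact/mulmx1C/spectralmxK. Qed.

Lemma spectral_funM n (A : 'M[C]_n) d e :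
  spectral_fun A d *m spectral_fun A e = spectral_fun A (fun j => d j * e j).
Proof.
rewrite /spectral_fun (mulmx_conjM _ _ (spectralmxK A)) mulmx_diag.
rewrite (_ : (\row_i _) = \row_j (d j * e j))//.
by apply/rowP => j; rewrite !mxE.
Qed.

Lemma spectral_fun1 n (A : 'M[C]_n) : spectral_fun A (fun=> 1) = 1%:M.
Proof.
rewrite /spectral_fun (_ : diag_mx _ = 1%:M) ?mulmx1 ?spectralmxKV//.
by apply/matrixP => i j; rewrite !mxE.
Qed.

Lemma eq_spectral_fun n (A : 'M[C]_n) d e :
  d =1 e -> spectral_fun A d = spectral_fun A e.
Proof. by move=> /funext ->. Qed.

Lemma hermsymmxP n (A : 'M[C]_n) : A \is hermsymmx -> A^t* = A.
Proof. by move/is_hermitianmxP => {2}->; rewrite expr0 scale1r. Qed.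

Lemma spectral_fun_id n (A : 'M[C]_n) : A \is hermsymmx ->
  A = spectral_fun A (fun j => RtoC (eigv A j)).
Proof.
move=> hA; have /orthomx_spectralP E := hermitian_normalmx hA.
have D : diag_mx (spectral_diag A) = diag_mx (\row_j RtoC (eigv A j)).
  congr diag_mx; apply/rowP => j; rewrite mxE /eigv.
  have /mxOverP/(_ ord0 j) := hermitian_spectral_diag_real hA.
  by move/complex.RRe_real => ->.
rewrite /spectral_fun -D -(invmx_unitary (spectral_unitarymx A)).
exact: E.
Qed.

Lemma qform_spectral n (A : 'M[C]_n) d v :
  qform (spectral_fun A d) v = \sum_j d j * RtoC (sweight A v j).
Proof.
rewrite /qform /spectral_fun !mulmxA -!mulmxA mulmxA.
set u := v *m _; have -> : spectralmx A *m v^t* = u^t*.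
  by rewrite /u trmx_mul map_mxM /= trmxCK.
rewrite mulmxA mxE; apply: eq_bigr => j _.
rewrite mul_mx_diag !(mxE matrix_key) /sweight -/u mulrAC mulrC; congr (_ * _).
by rewrite !mxE conjCM_normc.
Qed.

Lemma trace_spectral n (A : 'M[C]_n) d :
  \tr (spectral_fun A d) = \sum_j d j.
Proof.
rewrite /spectral_fun mxtrace_mulC mulmxA spectralmxK mul1mx mxtrace_diag.
by apply: eq_bigr => j _; rewrite !mxE.
Qed.

Lemma shift_neq0 (a : R) (z : C) : ImC z != 0 -> RtoC a - z != 0.
Proof.
by move=> hz; apply: contra_neq hz => /(congr1 (@ImC R)); rewrite ImD ImN/= sub0r => /eqP;
  rewrite oppr_eq0 => /eqP.
Qed.

Lemma resolventP n (A : 'M[C]_n) z : A \is hermsymmx -> ImC z != 0 ->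
  A - z%:M \in unitmx /\
  resolvent A z = spectral_fun A (fun j => (RtoC (eigv A j) - z)^-1).
Proof.
move=> hA hz.
have E : A - z%:M = spectral_fun A (fun j => RtoC (eigv A j) - z).
  rewrite {1}(spectral_fun_id hA).
  have -> : z%:M = (spectralmx A)^t* *m z%:M *m spectralmx A.
    by rewrite mul_mx_scalar -scalemxAl spectralmxKV scalemx1.
  rewrite /spectral_fun mulmx_conjB.
  rewrite (_ : _ - z%:M = diag_mx (\row_j (RtoC (eigv A j) - z)))//.
  apply/matrixP => i j; rewrite !mxE.
  by case: eqP => _; rewrite ?mulr1n ?mulr0n ?subr0.
have VK : (A - z%:M) *m spectral_fun A (fun j => (RtoC (eigv A j) - z)^-1) = 1%:M.
  rewrite E spectral_funM -(spectral_fun1 A); apply: eq_spectral_fun => j.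
  by rewrite divff// shift_neq0.
exact: (invmx_uniq VK).
Qed.

Lemma sum_sweight n (A : 'M[C]_n) v :
  \sum_j sweight A v j = enorm v ^+ 2.
Proof.
rewrite /enorm sqr_sqrtr ?sumr_ge0// => [|j _]; last exact: sqr_ge0.
have := qform_spectral A (fun=> 1) v.
rewrite spectral_fun1 /qform mulmx1 => /(congr1 (@ReC R)).
rewrite Re_sum mxE Re_sum => E.
transitivity (\sum_i ReC (1 * RtoC (sweight A v i))).
  by apply: eq_bigr => i _; rewrite mul1r.
rewrite -E; apply: eq_bigr => j _.
by rewrite !mxE conjCM_normc.
Qed.

(** Imaginary part of 1 / (l - z) with z = x + iy: pi times the Poisson kernel of
width [y]. *)
Definition pk (x y l : R) : R := y / ((l - x) ^+ 2 + y ^+ 2).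
(** Real part of 1 / (l - z): the conjugate Poisson kernel. *)
Definition hk (x y l : R) : R := (l - x) / ((l - x) ^+ 2 + y ^+ 2).

Lemma Re_kernel (x y l : R) : ReC (RtoC l - Complex x y)^-1 = hk x y l.
Proof. by rewrite Re_inv normc_sqr !ReD !ImD ReN ImN /= sub0r sqrrN. Qed.

Lemma Im_kernel (x y l : R) : ImC (RtoC l - Complex x y)^-1 = pk x y l.
Proof. by rewrite Im_inv normc_sqr !ReD !ImD ReN ImN /= sub0r sqrrN opprK. Qed.

Section Resolvent.
Variables (n : nat) (A : 'M[C]_n) (hA : A \is hermsymmx) (x y : R) (hy : 0 < y).

Let hz : ImC (Complex x y) != 0. Proof. by rewrite /= gt_eqF. Qed.

Lemma resolvent_unit : A - (Complex x y)%:M \in unitmx.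
Proof. by have [] := resolventP hA hz. Qed.

Lemma resolventE : resolvent A (Complex x y) =
  spectral_fun A (fun j => (RtoC (eigv A j) - Complex x y)^-1).
Proof. by have [] := resolventP hA hz. Qed.

Lemma Re_qform_resolvent v :
  ReC (qform (resolvent A (Complex x y)) v) = specform A (hk x y) v.
Proof.
rewrite resolventE qform_spectral Re_sum; apply: eq_bigr => j _.
by rewrite mulrC Re_realM Re_kernel mulrC.
Qed.

Lemma Im_qform_resolvent v :
  ImC (qform (resolvent A (Complex x y)) v) = specform A (pk x y) v.
Proof.
rewrite resolventE qform_spectral Im_sum; apply: eq_bigr => j _.
by rewrite mulrC Im_realM Im_kernel mulrC.
Qed.

Lemma Re_trace_resolvent :
  ReC (\tr (resolvent A (Complex x y))) = spectr A (hk x y).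
Proof.
rewrite resolventE trace_spectral Re_sum; apply: eq_bigr => j _.
by rewrite Re_kernel.
Qed.

Lemma Im_trace_resolvent :
  ImC (\tr (resolvent A (Complex x y))) = spectr A (pk x y).
Proof.
rewrite resolventE trace_spectral Im_sum; apply: eq_bigr => j _.
by rewrite Im_kernel.
Qed.

(** The modulus of 1 / (l - z)^2 is pk / y; the square of the resolvent is thus
dominated by its imaginary part. *)
Lemma qform_resolvent_sqr v :
  normc (qform (resolvent A (Complex x y) *m resolvent A (Complex x y)) v)
    <= specform A (pk x y) v / y.
Proof.
rewrite resolventE spectral_funM qform_spectral.
apply: (le_trans (normc_sum _ _ _)); rewrite mulr_suml.
apply: ler_sum => j _; rewrite !ComplexField.Normc.normcM normc_real.
rewrite (ger0_norm (sweight_ge0 _ _ _)) [leRHS]mulrAC.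
apply: ler_wpM2r; first exact: sweight_ge0.
rewrite -expr2 ComplexField.Normc.normcV exprVn normc_sqr /pk.
rewrite !ReD !ImD ReN ImN /= sub0r sqrrN mulrAC divff ?gt_eqF// mul1r.
exact: lexx.
Qed.

End Resolvent.

End SpectralCalculus.

(** * Minors of a Hermitian matrix *)

Section Minor.
Variables (F : fieldType) (m : nat) (i : 'I_m.+1).

(** Bijection that moves the index [i] to the front, so that the minor becomes the
lower right block. *)
Definition pivot_ord (k : 'I_(1 + m)) : 'I_m.+1 :=
  match fintype.split k with inl _ => i | inr j => lift i j end.

Lemma pivot_ord_bij : bijective pivot_ord.
Proof.
exists (fun k => if unlift i k is Some j then rshift 1 j else lshift m ord0).
- move=> k; rewrite /pivot_ord; case: split_ordP => j ->; last by rewrite liftK.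
  by rewrite unlift_none (ord1 j).
- move=> k; case: unliftP => [j|] ->; rewrite /pivot_ord.
  + by case: split_ordP => j' /eqP; rewrite ?eq_rlshift// eq_rshift => /eqP ->.
  + by case: split_ordP => j' /eqP; rewrite ?eq_lrshift.
Qed.

Lemma mxsub_pivot (A : 'M[F]_m.+1) :
  mxsub pivot_ord pivot_ord A =
  block_mx (A i i)%:M (col' i (row i A)) (row' i (col i A)) (row' i (col' i A)).
Proof.
apply/matrixP => k l; rewrite mxE /pivot_ord.
have [k' ->|k' ->] := @split_ordP _ _ k; have [l' ->|l' ->] := @split_ordP _ _ l.
- by rewrite block_mxEul mxE !ord1.
- by rewrite block_mxEur !mxE.
- by rewrite block_mxEdl !mxE.
- by rewrite block_mxEdr !mxE.
Qed.

Lemma mxsub_pivotM (A B : 'M[F]_m.+1) :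
  mxsub pivot_ord pivot_ord (A *m B) =
  mxsub pivot_ord pivot_ord A *m mxsub pivot_ord pivot_ord B.
Proof.
apply/matrixP => k l; rewrite !mxE (reindex pivot_ord) /=; last first.
  exact/onW_bij/pivot_ord_bij.
by apply: eq_bigr => j _; rewrite !mxE.
Qed.

Lemma mxsub_pivot1 : mxsub pivot_ord pivot_ord (1%:M : 'M[F]_m.+1) = 1%:M.
Proof.
by apply/matrixP => k l; rewrite !mxE (inj_eq (bij_inj pivot_ord_bij)).
Qed.

Lemma schur_minor (A : 'M[F]_m.+1) :
  let B := row' i (col' i A) in
  let r := col' i (row i A) in
  let c := row' i (col i A) in
  let del := A i i - (r *m invmx B *m c) ord0 ord0 in
  A \in unitmx -> B \in unitmx -> del != 0 ->
  invmx A i i = del^-1 /\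
  \tr (invmx A) = del^-1 + \tr (invmx B)
     + (r *m (invmx B *m invmx B) *m c) ord0 ord0 / del.
Proof.
move=> B r c del UA UB del0.
have [] := schur_block UB del0.
have VK : mxsub pivot_ord pivot_ord A *m mxsub pivot_ord pivot_ord (invmx A) = 1%:M.
  by rewrite -mxsub_pivotM mulmxV// mxsub_pivot1.
have [_] := invmx_uniq VK; rewrite mxsub_pivot -/B -/r -/c => ->.
move=> G00 trG; split.
  rewrite -G00 mxE /pivot_ord; by case: split_ordP => //= j' /(congr1 val).
rewrite -trG /mxtrace (reindex pivot_ord) /=; last exact/onW_bij/pivot_ord_bij.
by apply: eq_bigr => j _; rewrite mxE.
Qed.

End Minor.

Section HermitianMinor.
Variables (R : realType) (m : nat).
Local Notation C := R[i].
Implicit Types (W : 'M[C]_m.+1) (i : 'I_m.+1).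

Definition minor W i : 'M[C]_m := row' i (col' i W).
Definition minor_row W i : 'rV[C]_m := col' i (row i W).

Lemma minor_herm W i : W \is hermsymmx -> minor W i \is hermsymmx.
Proof.
move=> /hermsymmxP hW; apply/is_hermitianmxP; rewrite expr0 scale1r.
by apply/matrixP => j k; rewrite !mxE -{1}hW !mxE.
Qed.

Lemma minor_col W i : W \is hermsymmx -> row' i (col i W) = (minor_row W i)^t*.
Proof.
by move=> /hermsymmxP hW; apply/matrixP => j k; rewrite !mxE -{1}hW !mxE.
Qed.

Lemma herm_diag_real W i : W \is hermsymmx -> ImC (W i i) = 0.
Proof.
move=> /hermsymmxP hW; have : ImC ((W^t*) i i) = ImC (W i i) by rewrite hW.
rewrite !mxE ImC_conj; lra.
Qed.

Variables (W : 'M[C]_m.+1) (hW : W \is hermsymmx) (x y : R) (hy : 0 < y).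
Local Notation z := (Complex x y).

(** Inverse of the i-th diagonal entry of the resolvent. *)
Definition schur_denom i : C :=
  W i i - z - qform (resolvent (minor W i) z) (minor_row W i).

Lemma Im_schur_denom i :
  ImC (schur_denom i) = - (y + specform (minor W i) (pk x y) (minor_row W i)).
Proof.
rewrite /schur_denom !ImD !ImN herm_diag_real//.
by rewrite (Im_qform_resolvent (minor_herm i hW) x hy) /=; ring.
Qed.

Lemma pk_ge0 l : 0 <= pk x y l.
Proof. by rewrite /pk divr_ge0// ?(ltW hy)// addr_ge0// sqr_ge0. Qed.

Lemma specform_pk_ge0 n (A : 'M[C]_n) v : 0 <= specform A (pk x y) v.
Proof. by apply: sumr_ge0 => j _; rewrite mulr_ge0 ?pk_ge0 ?sweight_ge0. Qed.

Lemma schur_denom_ge i :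
  y + specform (minor W i) (pk x y) (minor_row W i) <= normc (schur_denom i).
Proof.
apply: le_trans (Im_le_normc _); rewrite Im_schur_denom normrN.
exact: ler_norm.
Qed.

Lemma schur_denom_neq0 i : schur_denom i != 0.
Proof.
rewrite -normc_eq0 gt_eqF//; apply: lt_le_trans (schur_denom_ge i).
by rewrite ltr_pwDl// specform_pk_ge0.
Qed.

Lemma minor_shift i : row' i (col' i (W - z%:M)) = minor W i - z%:M.
Proof.
by apply/matrixP => j k; rewrite !mxE (inj_eq lift_inj).
Qed.

Lemma minor_row_shift i : col' i (row i (W - z%:M)) = minor_row W i.
Proof.
by apply/matrixP => j k; rewrite !mxE (negPf (neq_lift _ _)) subr0.
Qed.

Lemma minor_col_shift i : row' i (col i (W - z%:M)) = row' i (col i W).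
Proof.
by apply/matrixP => j k; rewrite !mxE eq_sym (negPf (neq_lift _ _)) subr0.
Qed.

Lemma resolvent_schur i :
  resolvent W z i i = (schur_denom i)^-1 /\
  \tr (resolvent W z) - \tr (resolvent (minor W i) z) =
  (1 + qform (resolvent (minor W i) z *m resolvent (minor W i) z) (minor_row W i))
    / schur_denom i.
Proof.
have := @schur_minor _ m i (W - z%:M).
rewrite minor_shift minor_row_shift minor_col_shift minor_col// !mxE eqxx mulr1n.
rewrite -/(resolvent W z) -/(resolvent (minor W i) z).
move=> /(_ (resolvent_unit hW x hy) (resolvent_unit (minor_herm i hW) x hy)
  (schur_denom_neq0 i)) [-> ->]; split=> //.
by rewrite mulrDl mul1r addrAC addrK.
Qed.

Lemma normc_resolvent_diag i : normc (resolvent W z i i) <=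
  (y + specform (minor W i) (pk x y) (minor_row W i))^-1.
Proof.
have [-> _] := resolvent_schur i; rewrite ComplexField.Normc.normcV.
rewrite lef_pV2 ?posrE ?schur_denom_ge//; last first.
  by rewrite ltr_pwDl// specform_pk_ge0.
by rewrite lt_neqAle eq_sym normc_eq0 schur_denom_neq0 normc_ge0.
Qed.

(** Rank-one perturbation bound: the numerator of the Schur formula is at most 1
plus Im Y / y, and the denominator at least y + Im Y. *)
Lemma trace_minor i :
  normc (\tr (resolvent W z) - \tr (resolvent (minor W i) z)) <= y^-1.
Proof.
have [_ ->] := resolvent_schur i.
rewrite ComplexField.Normc.normcM ComplexField.Normc.normcV.
rewrite ler_pdivrMr; last first.
  by rewrite lt_neqAle eq_sym normc_eq0 schur_denom_neq0 normc_ge0.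
apply: (@le_trans _ _ (y^-1 * (y + specform (minor W i) (pk x y) (minor_row W i)))).
  apply: (le_trans (le_normcD _ _)); rewrite mulrDr mulVf ?gt_eqF//.
  rewrite ComplexField.Normc.normc1 lerD2l [leRHS]mulrC.
  exact: (qform_resolvent_sqr (minor_herm i hW) x hy (minor_row W i)).
by rewrite ler_pM2l ?invr_gt0// schur_denom_ge.
Qed.

End HermitianMinor.

(** * Positive weights for both parts of the resolvent *)

Section Weights.
Variable R : realType.
Implicit Types (x y l : R).
Local Notation pk := (@pk R).
Local Notation hk := (@hk R).

(** The Poisson kernel, scaled to take values in [0, 1]. *)
Definition wgt1 x y l : R := y * pk x y l.
(** The change of the conjugate kernel from scale [y] to scale [4 * y] has no sign;
adding twice [wgt1] makes it nonnegative, at a cost that concentration of [wgt1]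
controls. *)
Definition wgt2 x y l : R :=
  (2 * wgt1 x y l + y * (hk x y l - hk x (4 * y) l)) / 4.

Lemma kernel_denom_gt0 x y l : 0 < y -> 0 < (l - x) ^+ 2 + y ^+ 2.
Proof. by move=> y0; rewrite ltr_wpDl ?sqr_ge0// exprn_gt0. Qed.

Lemma wgt1_ge0 x y l : 0 < y -> 0 <= wgt1 x y l.
Proof. by move=> y0; rewrite /wgt1 mulr_ge0 ?(ltW y0)// pk_ge0. Qed.

Lemma wgt1_le1 x y l : 0 < y -> wgt1 x y l <= 1.
Proof.
move=> y0; rewrite /wgt1 /pk mulrA ler_pdivrMr ?kernel_denom_gt0// mul1r.
by rewrite -expr2 lerDr sqr_ge0.
Qed.

Lemma hk_diff x y l : 0 < y ->
  y * (hk x y l - hk x (4 * y) l) =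
  wgt1 x y l * (15 * y * (l - x) / ((l - x) ^+ 2 + (4 * y) ^+ 2)).
Proof.
move=> y0; rewrite /wgt1 /pk /hk.
have := kernel_denom_gt0 x l y0.
have := @kernel_denom_gt0 x (4 * y) l; rewrite pmulr_rgt0// => /(_ y0).
set u := l - x => h1 h2.
by field; rewrite !gt_eqF.
Qed.

(** The increment is [wgt1] times a factor of modulus at most 15 / 8, by the
inequality between the arithmetic and geometric means of (l - x)^2 and 16 y^2. *)
Lemma wgt2_bound x y l : 0 < y -> 0 <= wgt2 x y l <= wgt1 x y l.
Proof.
move=> y0; rewrite /wgt2 hk_diff//.
have w0 := wgt1_ge0 x l y0.
have d0 := @kernel_denom_gt0 x (4 * y) l; rewrite pmulr_rgt0// in d0.
have /andP[h1 h2] : -2 <= 15 * y * (l - x) / ((l - x) ^+ 2 + (4 * y) ^+ 2) <= 2.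
  have {}d0 := d0 y0; rewrite ler_pdivlMr// ler_pdivrMr//.
  have := sqr_ge0 (l - x - 4 * y); have := sqr_ge0 (l - x + 4 * y).
  have := sqr_ge0 (l - x); have := sqr_ge0 y.
  by set u := l - x => a b c d; apply/andP; split; nra.
by apply/andP; split; nra.
Qed.

Lemma hk_le x y l : 0 < y -> `|hk x y l| <= (2 * y)^-1.
Proof.
move=> y0; have d0 := kernel_denom_gt0 x l y0.
rewrite /hk normrM (gtr0_norm (x := _^-1)) ?invr_gt0//.
rewrite ler_pdivrMr// mulrC ler_pdivlMr ?mulr_gt0//.
rewrite -[X in X + y ^+ 2]real_normK ?num_real//.
by have := sqr_ge0 (`|l - x| - y); nra.
Qed.

(** The Poisson average can shrink at most by the factor 4 when the scale does; this
carries lower bounds from large scales to small ones. *)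
Lemma pk_quarter x y l : 0 < y -> pk x y l / 4 <= pk x (y / 4) l.
Proof.
move=> y0; rewrite /pk.
have y4 : 0 < y / 4 by rewrite divr_gt0.
have d1 := kernel_denom_gt0 x l y0; have d2 := kernel_denom_gt0 x l y4.
rewrite mulrAC ler_wpM2l ?(ltW y4)// lef_pV2 ?posrE// lerD2l.
by rewrite expr_div_n; have := sqr_ge0 y; lra.
Qed.

Lemma spectr_ge0 n (A : 'M[R[i]]_n) (phi : R -> R) :
  (forall l, 0 <= phi l) -> 0 <= spectr A phi.
Proof. by move=> h; exact: sumr_ge0. Qed.

Lemma specform_ge0 n (A : 'M[R[i]]_n) (phi : R -> R) v :
  (forall l, 0 <= phi l) -> 0 <= specform A phi v.
Proof. by move=> h; apply: sumr_ge0 => j _; rewrite mulr_ge0 ?sweight_ge0. Qed.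

Lemma ler_spectr n (A : 'M[R[i]]_n) (phi psi : R -> R) :
  (forall l, phi l <= psi l) -> spectr A phi <= spectr A psi.
Proof. by move=> h; exact: ler_sum. Qed.

Lemma specformZ n (A : 'M[R[i]]_n) (a : R) (phi : R -> R) v :
  specform A (fun l => a * phi l) v = a * specform A phi v.
Proof. by rewrite /specform mulr_sumr; apply: eq_bigr => j _; rewrite mulrA. Qed.

Lemma spectrZ n (A : 'M[R[i]]_n) (a : R) (phi : R -> R) :
  spectr A (fun l => a * phi l) = a * spectr A phi.
Proof. by rewrite /spectr mulr_sumr. Qed.

Lemma specform_scale n (A : 'M[R[i]]_n) (phi : R -> R) (v : 'rV[R[i]]_n) (a : R) :
  specform A phi (real_complex R a *: v) = a ^+ 2 * specform A phi v.
Proof.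
rewrite /specform mulr_sumr; apply: eq_bigr => j _; rewrite [RHS]mulrCA; congr (_ * _).
rewrite /sweight -scalemxAl mxE ComplexField.Normc.normcM exprMn; congr (_ * _).
by rewrite normc_real real_normK ?num_real.
Qed.

Lemma specform_hk_diff n (A : 'M[R[i]]_n) x y v :
  y * (specform A (hk x y) v - specform A (hk x (4 * y)) v) =
  4 * specform A (wgt2 x y) v - 2 * specform A (wgt1 x y) v.
Proof.
rewrite /specform mulrBr !mulr_sumr -!sumrB; apply: eq_bigr => j _.
by rewrite /wgt2; field.
Qed.

Lemma spectr_hk_diff n (A : 'M[R[i]]_n) x y :
  y * (spectr A (hk x y) - spectr A (hk x (4 * y))) =
  4 * spectr A (wgt2 x y) - 2 * spectr A (wgt1 x y).
Proof.
rewrite /spectr mulrBr !mulr_sumr -!sumrB; apply: eq_bigr => j _.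
by rewrite /wgt2; field.
Qed.

Lemma specform_hk_le n (A : 'M[R[i]]_n) x y v : 0 < y ->
  `|specform A (hk x y) v| <= (2 * y)^-1 * specform A (fun=> 1) v.
Proof.
move=> y0; apply: (le_trans (ler_norm_sum _ _ _)).
rewrite /specform mulr_sumr; apply: ler_sum => j _.
rewrite normrM (ger0_norm (sweight_ge0 _ _ _)) mul1r.
by rewrite ler_wpM2r ?sweight_ge0// hk_le.
Qed.

Lemma spectr_hk_le n (A : 'M[R[i]]_n) x y : 0 < y ->
  `|spectr A (hk x y)| <= (2 * y)^-1 * n%:R.
Proof.
move=> y0; apply: (le_trans (ler_norm_sum _ _ _)).
have -> : n%:R = \sum_(j < n) (1 : R) by rewrite sumr_const card_ord.
rewrite mulr_sumr; apply: ler_sum => j _.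
by rewrite mulr1 hk_le.
Qed.

(** Concentration is stated for square roots; if the trace is of order at most r^2,
an error e there is an error of order e r for the forms themselves. *)
Lemma sqrt_close (q t e r : R) : 0 <= q -> 0 <= t -> 0 < r -> t <= 5 * r ^+ 2 ->
  e <= r / 100 -> `|Num.sqrt q - Num.sqrt t| <= e -> `|q - t| <= 5 * (e * r).
Proof.
move=> q0 t0 r0 tr er h.
rewrite -(sqr_sqrtr q0) -(sqr_sqrtr t0).
have st : Num.sqrt t <= 9 / 4 * r.
  rewrite -(ler_pXn2r (n := 2)) ?nnegrE ?sqrtr_ge0//; last by nra.
  by rewrite sqr_sqrtr//; nra.
have := sqrtr_ge0 t; have := sqrtr_ge0 q.
move: h st; set a := Num.sqrt q; set b := Num.sqrt t.
rewrite !ler_norml => /andP[h1 h2] h3 a0 b0.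
have e0 : 0 <= e by lra.
by apply/andP; split; nra.
Qed.

End Weights.

(** * Quadratic forms against traces over the scales *)

Section SelfConsistent.
Variables (R : realType) (m : nat) (W : 'M[R[i]]_m.+1) (hW : W \is hermsymmx).
Local Notation N := (m.+1%:R : R).
Implicit Types (x y e : R) (i : 'I_m.+1).

Definition stieltjes_im x y : R := N^-1 * spectr W (pk x y).
Definition stieltjes_re x y : R := N^-1 * spectr W (hk x y).

(** The deterministic form of the concentration of the i-th row: the trace carries
1 / n because the entries of the normalized row have variance 1 / n. *)
Definition row_conc i (phi : R -> R) e : Prop :=
  `|Num.sqrt (specform (minor W i) phi (minor_row W i))
    - Num.sqrt (N^-1 * spectr (minor W i) phi)| <= e.

Let N0 : 0 < N. Proof. by rewrite ltr0n. Qed.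

Lemma trace_minor_pk i x y : 0 < y ->
  `|spectr W (pk x y) - spectr (minor W i) (pk x y)| <= y^-1.
Proof.
move=> y0; apply: le_trans (trace_minor hW x y0 i).
apply: le_trans (Im_le_normc _); rewrite ImD ImN !Im_trace_resolvent//.
exact: minor_herm.
Qed.

Lemma trace_minor_hk i x y : 0 < y ->
  `|spectr W (hk x y) - spectr (minor W i) (hk x y)| <= y^-1.
Proof.
move=> y0; apply: le_trans (trace_minor hW x y0 i).
apply: le_trans (Re_le_normc _); rewrite ReD ReN !Re_trace_resolvent//.
exact: minor_herm.
Qed.

Lemma stieltjes_im_ge0 x y : 0 < y -> 0 <= stieltjes_im x y.
Proof.
move=> y0; rewrite /stieltjes_im mulr_ge0 ?invr_ge0 ?(ltW N0)//.
by apply: spectr_ge0 => l; exact: pk_ge0.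
Qed.

(** Suppose Im s > 4.  Removing a row changes the trace little, so every minor has
a large trace and, by concentration, every form Im Y_i is at least 1.  The Schur
formula then bounds all diagonal entries of the resolvent by 1, and Im s by 1. *)
Lemma stieltjes_im_le4 x y kap : 0 < y -> kap <= 1 / 100 ->
  (N * y)^-1 <= kap ^+ 2 -> 0 <= kap ->
  (forall i, row_conc i (wgt1 x y) (kap * Num.sqrt y)) ->
  stieltjes_im x y <= 4.
Proof.
move=> y0 k1 k2 k0 H; rewrite leNgt; apply/negP => s4.
set r := Num.sqrt y; have r0 : 0 < r by rewrite sqrtr_gt0.
have yr : y = r ^+ 2 by rewrite sqr_sqrtr// ltW.
have form_ge1 i : 1 <= specform (minor W i) (pk x y) (minor_row W i).
  have := H i; rewrite /row_conc /wgt1 specformZ spectrZ -/r.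
  set q := specform _ _ _; set t := spectr _ _ => h.
  have t3 : 3 * y <= N^-1 * (y * t).
    have := trace_minor_pk i x y0; rewrite -/t ler_norml => /andP[_].
    move: s4; rewrite /stieltjes_im; set S := spectr W _ => s4 St.
    have : N^-1 * (S - t) <= kap ^+ 2.
      apply: le_trans k2; rewrite invfM ler_pM2l ?invr_gt0//.
    have : kap ^+ 2 <= 1 by nra.
    move: s4; rewrite mulrBr [3 * y]mulrC [N^-1 * (y * t)]mulrCA ler_pM2l//.
    by move: (N^-1 * S) (N^-1 * t) => a b; lra.
  have q0 : 0 <= q by exact: specform_pk_ge0.
  move: h t3; move: (N^-1 * (y * t)) => T h t3.
  have T0 : 0 <= T by lra.
  have : 17 / 10 * r <= Num.sqrt T.
    rewrite -(ler_pXn2r (n := 2)) ?nnegrE ?sqrtr_ge0//; last by nra.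
    by rewrite sqr_sqrtr//; nra.
  move: h; rewrite ler_norml => /andP[h _] h'.
  have h2 : r <= Num.sqrt (y * q) by nra.
  have : y <= y * q.
    rewrite -[y * q]sqr_sqrtr ?mulr_ge0 ?(ltW y0)// {1}yr.
    by rewrite ler_pXn2r ?nnegrE ?sqrtr_ge0// ltW.
  by rewrite -{1}[y]mulr1 ler_pM2l.
have : spectr W (pk x y) <= N.
  rewrite -Im_trace_resolvent//; apply: le_trans (ler_norm _) _.
  apply: le_trans (Im_le_normc _) _; rewrite /mxtrace.
  apply: le_trans (normc_sum _ _ _) _.
  have -> : N = \sum_(j < m.+1) (1 : R) by rewrite sumr_const card_ord.
  apply: ler_sum => i _; apply: le_trans (normc_resolvent_diag hW x y0 i) _.
  rewrite invf_le1; first by have := form_ge1 i; lra.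
  by have := form_ge1 i; lra.
move: s4; rewrite /stieltjes_im => s4 h.
have : N^-1 * spectr W (pk x y) <= 1 by rewrite ler_pdivrMl// mulr1.
by move: (N^-1 * _) s4 => a; lra.
Qed.

Section Scales.
Variables (x eta kap : R) (L : nat).
Hypotheses (eta0 : 0 < eta) (eta1 : eta <= 1) (kap0 : 0 < kap) (kap1 : kap <= 1 / 100).
Hypothesis hNy : (N * eta)^-1 <= kap ^+ 2.
Hypothesis hL : (eta * 4 ^+ L)^-1 <= kap.
Local Notation sc k := (eta * 4 ^+ k).
Local Notation e := (kap * Num.sqrt eta).
Hypothesis conc1 : forall i k, (k <= L)%N -> row_conc i (wgt1 x (sc k)) e.
Hypothesis conc2 : forall i k, (k <= L)%N -> row_conc i (wgt2 x (sc k)) e.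
Hypothesis conc0 : forall i, row_conc i (fun=> 1) e.

Let sc0 k : 0 < sc k. Proof. by rewrite mulr_gt0// exprn_gt0. Qed.

Let sc_ge k : eta <= sc k.
Proof. by rewrite ler_peMr ?(ltW eta0)// exprn_ege1// ler1n. Qed.

Let hNsc k : (N * sc k)^-1 <= kap ^+ 2.
Proof.
apply: le_trans hNy; rewrite lef_pV2 ?posrE ?mulr_gt0 ?sc0//.
by rewrite ler_pM2l// sc_ge.
Qed.

Let sqrt_sc k : Num.sqrt (sc k) = Num.sqrt eta * 2 ^+ k.
Proof.
rewrite sqrtrM ?(ltW eta0)//; congr (_ * _).
have -> : (4 : R) = 2 ^+ 2 by rewrite expr2; lra.
by rewrite exprAC sqrtr_sqr ger0_norm// exprn_ge0.
Qed.

Let kap2 : kap ^+ 2 <= 1.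
Proof. have k1 : kap <= 1 by apply: (le_trans kap1); lra.
by rewrite expr_le1 ?(ltW kap0). Qed.

Let se0 : 0 < Num.sqrt eta. Proof. by rewrite sqrtr_gt0. Qed.

Lemma stieltjes_scale_le4 k : (k <= L)%N -> stieltjes_im x (sc k) <= 4.
Proof.
move=> kL; apply: (stieltjes_im_le4 (sc0 k) kap1 (hNsc k) (ltW kap0)) => i.
apply: le_trans (conc1 i kL) _; rewrite sqrt_sc ler_pM2l// ler_peMr ?(ltW se0)//.
by rewrite exprn_ege1// ler1n.
Qed.

Lemma minor_trace_le5 i k : (k <= L)%N ->
  N^-1 * spectr (minor W i) (wgt1 x (sc k)) <= 5 * sc k.
Proof.
move=> kL; have := stieltjes_scale_le4 kL.
have := trace_minor_pk i x (sc0 k); rewrite ler_norml => /andP[h _].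
rewrite spectrZ mulrCA [5 * _]mulrC ler_pM2l// /stieltjes_im => h4.
have : N^-1 * (spectr (minor W i) (pk x (sc k)) - spectr W (pk x (sc k))) <= kap ^+ 2.
  apply: le_trans (hNsc k); rewrite invfM ler_pM2l ?invr_gt0//; lra.
rewrite mulrBr; have := kap2.
move: h4; move: (N^-1 * spectr W _) (N^-1 * spectr (minor W i) _) => a b; lra.
Qed.

(** The error of the square roots is the same at all scales while the traces grow like
the scale y_k = eta 4^k; hence the factor 2^k, which becomes 2^-k after division by y_k. *)
Lemma form_trace_close (phi : R -> R) i k : (k <= L)%N ->
  (forall l, 0 <= phi l <= wgt1 x (sc k) l) -> row_conc i phi e ->
  `|specform (minor W i) phi (minor_row W i) - N^-1 * spectr (minor W i) phi|
    <= 5 * kap * eta * 2 ^+ k.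
Proof.
move=> kL hphi h.
have phi0 l : 0 <= phi l by have /andP[] := hphi l.
have k21 : 1 <= (2 : R) ^+ k by rewrite exprn_ege1// ler1n.
have -> : 5 * kap * eta * 2 ^+ k = 5 * (e * Num.sqrt (sc k)).
  by rewrite sqrt_sc -{1}(sqr_sqrtr (ltW eta0)); ring.
apply: sqrt_close h; first exact: specform_ge0.
- by rewrite mulr_ge0 ?invr_ge0 ?(ltW N0)// spectr_ge0.
- by rewrite sqrtr_gt0.
- rewrite sqr_sqrtr ?(ltW (sc0 k))//; apply: le_trans (minor_trace_le5 i kL).
  rewrite ler_pM2l ?invr_gt0//; apply: ler_spectr => l.
  by have /andP[] := hphi l.
- rewrite sqrt_sc; apply: (@le_trans _ _ (1 / 100 * Num.sqrt eta)).
    by rewrite ler_pM2r.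
  have : Num.sqrt eta * 1 <= Num.sqrt eta * 2 ^+ k by rewrite ler_pM2l.
  by move: (Num.sqrt eta) (2 ^+ k) => s b; lra.
Qed.

(** Fluctuation of the imaginary part of Y_i around the trace of the minor, at the
k-th scale; [re_err] is its counterpart for the real part. *)
Definition im_err i k := specform (minor W i) (pk x (sc k)) (minor_row W i)
  - N^-1 * spectr (minor W i) (pk x (sc k)).
Definition re_err i k := specform (minor W i) (hk x (sc k)) (minor_row W i)
  - N^-1 * spectr (minor W i) (hk x (sc k)).

Let pow24 k : (4 : R) ^+ k = 2 ^+ k * 2 ^+ k.
Proof. by rewrite -exprMn; congr (_ ^+ _); lra. Qed.

Lemma im_err_le i k : (k <= L)%N -> `|im_err i k| <= 5 * kap.
Proof.
move=> kL; rewrite /im_err.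
have hw l : 0 <= wgt1 x (sc k) l <= wgt1 x (sc k) l by rewrite wgt1_ge0/=.
have := form_trace_close kL hw (conc1 i kL).
rewrite specformZ spectrZ mulrCA -mulrBr normrM (gtr0_norm (sc0 k)) => h.
have k21 : 1 <= (2 : R) ^+ k by rewrite exprn_ege1// ler1n.
rewrite -(ler_pM2l (sc0 k)); apply: (le_trans h); rewrite pow24.
set t := 2 ^+ k in k21 *.
have -> : eta * (t * t) * (5 * kap) = 5 * kap * eta * t * t by ring.
by rewrite ler_peMr// !mulr_ge0 ?(ltW eta0) ?(ltW kap0) ?(le_trans ler01 k21).
Qed.

(** One increment between consecutive scales, written with the two nonnegative
weights; the geometric decay in [k] makes the sum over all scales small. *)
Lemma re_err_step i k : (k < L)%N ->
  `|re_err i k - re_err i k.+1| <= 30 * kap * 2^-1 ^+ k.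
Proof.
move=> kL.
have h1 := form_trace_close (ltnW kL) (fun l => _) (conc1 i (ltnW kL)).
have {}h1 := h1 _; have {h1} h1 : `|specform (minor W i) (wgt1 x (sc k)) (minor_row W i)
   - N^-1 * spectr (minor W i) (wgt1 x (sc k))| <= 5 * kap * eta * 2 ^+ k.
  by apply: h1 => l; rewrite wgt1_ge0/=.
have h2 := form_trace_close (ltnW kL) (fun l => wgt2_bound x l (sc0 k))
   (conc2 i (ltnW kL)).
have d1 := specform_hk_diff (minor W i) x (sc k) (minor_row W i).
have d2 := spectr_hk_diff (minor W i) x (sc k).
have E : sc k * (re_err i k - re_err i k.+1) =
  4 * (specform (minor W i) (wgt2 x (sc k)) (minor_row W i)
   - N^-1 * spectr (minor W i) (wgt2 x (sc k)))
  - 2 * (specform (minor W i) (wgt1 x (sc k)) (minor_row W i)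
   - N^-1 * spectr (minor W i) (wgt1 x (sc k))).
  rewrite /re_err exprS (_ : eta * (4 * 4 ^+ k) = 4 * sc k); last by ring.
  by rewrite [LHS](_ : _ = sc k * (specform (minor W i) (hk x (sc k)) (minor_row W i) -
    specform (minor W i) (hk x (4 * sc k)) (minor_row W i)) - N^-1 * (sc k *
    (spectr (minor W i) (hk x (sc k)) - spectr (minor W i) (hk x (4 * sc k)))));
    [rewrite d1 d2; ring | ring].
rewrite -(ler_pM2l (sc0 k)) -{1}(gtr0_norm (sc0 k)) -normrM E.
have -> : sc k * (30 * kap * 2^-1 ^+ k) = 30 * kap * eta * 2 ^+ k.
  by rewrite pow24 exprVn; field; rewrite expf_neq0.
apply: (le_trans (ler_normB _ _)); rewrite !normrM.
by rewrite !(@ger0_norm _ (_%:R)); lra.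
Qed.

(** At the largest scale the real part is negligible by itself, as the kernel is at
most 1 / (2 y) and the norm of the row is bounded. *)
Lemma re_err_top i : `|re_err i L| <= 3 * kap.
Proof.
have y0 := sc0 L.
have h1 := specform_hk_le (minor W i) x (minor_row W i) y0.
have h2 := spectr_hk_le (minor W i) x y0.
have q4 : specform (minor W i) (fun=> 1) (minor_row W i) <= 4.
  have := conc0 i; rewrite /row_conc ler_norml => /andP[_].
  have -> : spectr (minor W i) (fun=> 1) = m%:R by rewrite /spectr sumr_const card_ord.
  have t1 : N^-1 * m%:R <= 1 by rewrite ler_pdivrMl// mulr1 ler_nat.
  have st1 : Num.sqrt (N^-1 * m%:R) <= 1 by rewrite -[leRHS]sqrtr1 ler_wsqrtr.
  have se1 : Num.sqrt eta <= 1 by rewrite -[leRHS]sqrtr1 ler_wsqrtr.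
  move=> h; rewrite -[X in X <= _]sqr_sqrtr; last by apply: specform_ge0.
  have e1 : e <= 1 / 100 by apply: le_trans kap1; rewrite ger_pMr.
  move: h st1 (sqrtr_ge0 (specform (minor W i) (fun=> 1) (minor_row W i))).
  move: (Num.sqrt (specform _ _ _)) (Num.sqrt (N^-1 * _)) => a b h b1 a0.
  have a2 : a <= 2 by lra.
  by apply: (@le_trans _ _ (2 * 2)); [rewrite expr2 ler_pM | lra].
have h3 : `|N^-1 * spectr (minor W i) (hk x (sc L))| <= (2 * sc L)^-1.
  rewrite normrM gtr0_norm ?invr_gt0// ler_pdivrMl//; apply: (le_trans h2).
  by rewrite mulrC ler_pM2r ?invr_gt0 ?mulr_gt0// ler_nat.
apply: (le_trans (ler_normB _ _)).
move: h1 h3 hL; rewrite !invfM; set u := (eta^-1 * _) => h1 h3 h.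
have u0 : 0 <= u by rewrite /u mulr_ge0 ?invr_ge0 ?exprn_ge0 ?(ltW eta0).
apply: (le_trans (lerD h1 h3)).
by have := specform_ge0 (minor W i) (minor_row W i) (phi := fun=> 1) (fun=> ler01); nra.
Qed.

(** The real part at scale k is its value at the top scale plus a telescoping geometric sum. *)
Lemma re_err_le i k : (k <= L)%N -> `|re_err i k| <= 63 * kap.
Proof.
move=> kL.
have : `|re_err i k| <= 3 * kap + 60 * kap * (2^-1 ^+ k - 2^-1 ^+ L).
  rewrite -(subKn kL); elim: (L - k)%N (leq_subr k L) => [|j IH] jL.
    by rewrite subn0 subrr mulr0 addr0 re_err_top.
  have jL' := ltnW jL.
  have -> : re_err i (L - j.+1) =
    (re_err i (L - j.+1) - re_err i (L - j.+1).+1) + re_err i (L - j.+1).+1.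
    by rewrite subrK.
  apply: (le_trans (ler_normD _ _)).
  have E : (L - j.+1).+1 = (L - j)%N by exact: subnSK.
  have s : (L - j.+1 < L)%N by rewrite ltn_subrL /= (leq_ltn_trans _ jL).
  have := re_err_step i s; rewrite E; have := IH jL'.
  have -> : (2^-1 : R) ^+ (L - j.+1) = 2 * 2^-1 ^+ (L - j) by rewrite -E exprS; field.
  lra.
move=> h; apply: (le_trans h).
have a : 0 <= (2^-1 : R) ^+ L by rewrite exprn_ge0.
have b : (2^-1 : R) ^+ k <= 1 by rewrite exprn_ile1//; lra.
have {a b} d1 : (2^-1 : R) ^+ k - 2^-1 ^+ L <= 1 by lra.
have : 60 * kap * ((2^-1 : R) ^+ k - 2^-1 ^+ L) <= 60 * kap.
  by rewrite ler_piMr// mulr_ge0// ltW.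
by move: (60 * kap * _) => u; lra.
Qed.

End Scales.
End SelfConsistent.

(** * Stability of the quadratic equation *)

Section Stability.
Variable R : realType.

Lemma inv_perturb (w u : R[i]) (c : R) : 0 < c -> c <= normc w -> normc u <= c / 2 ->
  normc (w^-1 - (w + u)^-1) <= 2 * normc u / c ^+ 2.
Proof.
move=> c0 cw hu.
have w1 : 0 < normc w by exact: lt_le_trans cw.
have wu : c / 2 <= normc (w + u).
  have : normc w <= normc (w + u) + normc u.
    by rewrite -{1}(addrK u w) -(normcN u); exact: le_normcD.
  lra.
have wu0 : 0 < normc (w + u) by apply: lt_le_trans wu; lra.
have w_n0 : w != 0 by rewrite -normc_eq0 gt_eqF.
have wu_n0 : w + u != 0 by rewrite -normc_eq0 gt_eqF.
have -> : w^-1 - (w + u)^-1 = u * (w^-1 * (w + u)^-1) by field; rewrite w_n0 wu_n0.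
rewrite !ComplexField.Normc.normcM !ComplexField.Normc.normcV.
have -> : 2 * normc u / c ^+ 2 = normc u * (c^-1 * (c / 2)^-1) by field; rewrite gt_eqF.
apply: ler_wpM2l; first exact: normc_ge0.
by apply: ler_pM; rewrite ?invr_ge0 ?normc_ge0// lef_pV2 ?posrE// divr_gt0.
Qed.

(** The hypothesis is the real part of s (z + s) = -1 up to [om], for the complex
number s of real part [a] and imaginary part [s].  Completing the square, a (x + a) is at least - x^2 / 4, so s (y + s) cannot be small. *)
Lemma quadratic_lower (x y a s c0 om : R) : c0 <= 1 - x ^+ 2 / 4 -> om <= c0 / 2 ->
  y <= 4 -> 0 <= s -> s <= 4 ->
  `|a * (x + a) - s * (y + s) + 1| <= om -> c0 / 16 <= s.
Proof.
move=> h1 h2 y4 s0 s4; rewrite ler_norml => /andP[h3 h4].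
have := sqr_ge0 (a + x / 2).
have : s * (y + s) <= 8 * s by rewrite mulrC ler_wpM2r//; lra.
by move: h1; rewrite !expr2; lra.
Qed.

(** With p = a + x / 2 and b = s + y / 2 the two parts of the equation say that p b
is small and that b^2 - p^2 is close to 1 - x^2 / 4.  The lower bound on s, hence
on b, makes p small and the square root Lipschitz. *)
Lemma quadratic_close (x y a s c0 om : R) : 0 < c0 -> c0 <= 1 -> c0 <= 1 - x ^+ 2 / 4 ->
  `|x| <= 2 -> 0 < y -> y <= om -> om <= 1 -> c0 / 16 <= s ->
  `|a * (x + a) - s * (y + s) + 1| <= om ->
  `|a * (y + s) + s * (x + a)| <= om ->
  `|s - Num.sqrt (1 - x ^+ 2 / 4)| <= 6000 / c0 ^+ 3 * om.
Proof.
move=> c00 c01 h1 hx y0 yom om1 sc H1 H2.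
set r := Num.sqrt _; have r2 : r ^+ 2 = 1 - x ^+ 2 / 4 by rewrite sqr_sqrtr//; lra.
have r0 : 0 <= r by exact: sqrtr_ge0.
have om0 : 0 < om by exact: lt_le_trans yom.
pose p := a + x / 2; pose b := s + y / 2.
have b0 : c0 / 16 <= b by rewrite /b; lra.
have bp : 0 < b by apply: lt_le_trans b0; lra.
have E1 : a * (x + a) - s * (y + s) + 1 = p ^+ 2 + r ^+ 2 - b ^+ 2 + y ^+ 2 / 4.
  by rewrite r2 /p /b; field.
have E2 : a * (y + s) + s * (x + a) = 2 * p * b - x * y / 2 by rewrite /p /b; field.
rewrite E1 in H1; rewrite E2 in H2.
have pb : `|p| * b <= om.
  have : `|2 * p * b| <= 2 * om.
    rewrite -(subrK (x * y / 2) (2 * p * b)); apply: (le_trans (ler_normD _ _)).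
    have : `|x * y / 2| <= om.
      rewrite !normrM (gtr0_norm y0) (gtr0_norm (x := 2^-1))//.
      have : `|x| * y <= 2 * y by rewrite ler_wpM2r// ltW.
      by move: (`|x| * y) => xy; lra.
    lra.
  rewrite !normrM (gtr0_norm bp) ger0_norm//; lra.
have cb : 1 <= c0^-1 * (16 * b) by rewrite ler_pdivlMl//; lra.
have p1 : `|p| <= 16 / c0 * om.
  rewrite -(ler_pM2r bp); apply: (le_trans pb).
  have -> : 16 / c0 * om * b = om * (c0^-1 * (16 * b)) by ring.
  by rewrite ler_peMr ?(ltW om0).
have c0V : 1 <= c0^-1 by rewrite invf_ge1.
have p2 : p ^+ 2 <= 256 / c0 ^+ 2 * om.
  rewrite -real_normK ?num_real//.
  apply: (@le_trans _ _ ((16 / c0 * om) ^+ 2)).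
    by rewrite ler_pXn2r ?nnegrE// mulr_ge0 ?(ltW om0)// divr_ge0 ?(ltW c00).
  have -> : (16 / c0 * om) ^+ 2 = 256 / c0 ^+ 2 * (om * om) by field; rewrite gt_eqF.
  apply: ler_wpM2l; first by apply: mulr_ge0; rewrite ?ler0n ?invr_ge0 ?sqr_ge0.
  by rewrite ler_piMr ?(ltW om0).
have d2 : `|b ^+ 2 - r ^+ 2| <= 258 / c0 ^+ 2 * om.
  have y2 : y ^+ 2 <= om.
    by rewrite expr2; apply: le_trans (yom); rewrite ler_piMr ?(ltW y0)// (le_trans yom).
  have c2V : 1 <= (c0 ^+ 2)^-1 by rewrite invf_ge1 ?exprn_gt0// expr_le1 ?(ltW c00).
  have omc : om <= (c0 ^+ 2)^-1 * om by rewrite ler_peMl ?(ltW om0).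
  have := sqr_ge0 y; have := sqr_ge0 p; move: p2 H1.
  rewrite -!(mulrA _ (c0 ^+ 2)^-1) !ler_norml.
  move: ((c0 ^+ 2)^-1 * om) omc => q omc p2 /andP[h3 h4] hp hy.
  by clear -h3 h4 hp hy p2 y2 omc; apply/andP; split; lra.
have : `|b - r| <= 258 / c0 ^+ 2 * om * (16 / c0).
  rewrite -(ler_pM2r bp).
  have : `|b - r| * b <= `|b ^+ 2 - r ^+ 2|.
    rewrite subr_sqr normrM ler_wpM2l// ger0_norm ?lerDl//.
    by rewrite addr_ge0// ltW.
  move=> h; apply: (le_trans h); apply: (le_trans d2).
  have -> : 258 / c0 ^+ 2 * om * (16 / c0) * b =
    258 / c0 ^+ 2 * om * (c0^-1 * (16 * b)) by ring.
  apply: ler_peMr cb.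
  by apply: mulr_ge0 (ltW om0); apply: mulr_ge0; rewrite ?ler0n ?invr_ge0 ?sqr_ge0.
have -> : 258 / c0 ^+ 2 * om * (16 / c0) = 4128 * ((c0 ^+ 3)^-1 * om).
  by field; rewrite gt_eqF.
have omc : om <= (c0 ^+ 3)^-1 * om.
  by rewrite ler_peMl ?(ltW om0)// invf_ge1 ?exprn_gt0// expr_le1 ?(ltW c00).
rewrite -(mulrA 6000) /b; move: ((c0 ^+ 3)^-1 * om) omc => q omc.
by rewrite !ler_norml => /andP[h3 h4]; clear -h3 h4 omc yom y0 om0; apply/andP; split; lra.
Qed.

End Stability.

(** * The local law at one point *)

Section LocalLaw.
Variables (R : realType) (m : nat) (W : 'M[R[i]]_m.+1) (hW : W \is hermsymmx).
Local Notation N := (m.+1%:R : R).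
Local Notation C := R[i].
Variables (x eta kap : R) (L : nat).
Hypotheses (eta0 : 0 < eta) (eta1 : eta <= 1) (kap0 : 0 < kap) (kap1 : kap <= 1 / 100).
Hypothesis hNy : (N * eta)^-1 <= kap ^+ 2.
Hypothesis hL : (eta * 4 ^+ L)^-1 <= kap.
Local Notation sc k := (eta * 4 ^+ k).
Local Notation e := (kap * Num.sqrt eta).
Hypothesis conc1 : forall i k, (k <= L)%N -> row_conc W i (wgt1 x (sc k)) e.
Hypothesis conc2 : forall i k, (k <= L)%N -> row_conc W i (wgt2 x (sc k)) e.
Hypothesis conc0 : forall i, row_conc W i (fun=> 1) e.
Hypothesis hdiag : #|[pred i | kap < normc (W i i)]|%:R <= kap * (N * eta).

Let N0 : 0 < N. Proof. by rewrite ltr0n. Qed.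
Let sc0 k : 0 < sc k. Proof. by rewrite mulr_gt0// exprn_gt0. Qed.
Let sc_ge k : eta <= sc k.
Proof. by rewrite ler_peMr ?(ltW eta0)// exprn_ege1// ler1n. Qed.

Definition stieltjes k : C := Complex (stieltjes_re W x (sc k)) (stieltjes_im W x (sc k)).
Definition shifted k : C := Complex x (sc k) + stieltjes k.

Lemma stieltjesE k :
  stieltjes k = real_complex R N^-1 * \tr (resolvent W (Complex x (sc k))).
Proof.
by apply: complex_ext; rewrite ?Re_realM ?Im_realM ?Re_trace_resolvent ?Im_trace_resolvent.
Qed.

(** Y_i is close to the trace of its minor by concentration, and the trace of the
minor to that of the matrix by the rank-one bound. *)
Lemma form_stieltjes_close i k : (k <= L)%N ->
  normc (qform (resolvent (minor W i) (Complex x (sc k))) (minor_row W i) - stieltjes k)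
    <= 70 * kap.
Proof.
move=> kL; apply: (le_trans (normc_le_ReIm _)).
have hm := minor_herm i hW.
rewrite ReD ReN ImD ImN (Re_qform_resolvent hm x (sc0 k)) (Im_qform_resolvent hm x (sc0 k)) /=.
have h1 := re_err_le hW eta0 eta1 kap0 kap1 hNy hL conc1 conc2 conc0 i kL.
have h2 := im_err_le hW eta0 kap0 kap1 hNy conc1 i kL.
have N1 (u : R) : `|u| <= (sc k)^-1 -> `|N^-1 * u| <= kap.
  move=> hu; rewrite normrM gtr0_norm ?invr_gt0//.
  apply: (@le_trans _ _ (kap ^+ 2)).
    apply: le_trans hNy; rewrite invfM ler_pM2l ?invr_gt0//.
    by apply: (le_trans hu); rewrite lef_pV2 ?posrE.
  rewrite expr2 ger_pMr//; apply: (le_trans kap1); lra.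
have h3 := N1 _ (trace_minor_hk hW i x (sc0 k)).
have h4 := N1 _ (trace_minor_pk hW i x (sc0 k)).
rewrite /stieltjes_re /stieltjes_im.
have -> : specform (minor W i) (hk x (sc k)) (minor_row W i) - N^-1 * spectr W (hk x (sc k))
  = re_err W x eta i k - N^-1 * (spectr W (hk x (sc k)) - spectr (minor W i) (hk x (sc k))).
  by rewrite /re_err; ring.
have -> : specform (minor W i) (pk x (sc k)) (minor_row W i) - N^-1 * spectr W (pk x (sc k))
  = im_err W x eta i k - N^-1 * (spectr W (pk x (sc k)) - spectr (minor W i) (pk x (sc k))).
  by rewrite /im_err; ring.
apply: (le_trans (lerD (ler_normB _ _) (ler_normB _ _))).
move: h1 h2 h3 h4; move: `|_| `|_| `|_| `|_| => r1 r2 r3 r4; lra.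
Qed.

Lemma resolvent_diag_perturb i k (u : C) :
  u = qform (resolvent (minor W i) (Complex x (sc k))) (minor_row W i)
      - stieltjes k - W i i ->
  resolvent W (Complex x (sc k)) i i = - (shifted k + u)^-1.
Proof.
move=> ->; have [-> _] := resolvent_schur hW x (sc0 k) i.
rewrite -invrN /shifted /schur_denom; congr (_^-1); ring.
Qed.

(** Average the Schur formula over the rows.  A row with a small diagonal entry is a
perturbation of - 1 / (z + s); the other rows contribute at most 1 / y + 1 / c each,
and they are few. *)
Lemma self_consistent k (c : R) : (k <= L)%N -> 0 < c -> c <= 1 -> 142 * kap <= c ->
  c <= normc (shifted k) ->
  normc (stieltjes k + (shifted k)^-1) <= 150 * kap / c ^+ 2.
Proof.
move=> kL c0 c1 hc cw; have y0 := sc0 k.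
set w := shifted k in cw *; set G := resolvent W (Complex x (sc k)).
have w0 : 0 < normc w by exact: lt_le_trans cw.
have term i : normc (G i i + w^-1) <= 142 * kap / c ^+ 2
    + (if kap < normc (W i i) then (sc k)^-1 + c^-1 else 0).
  have hY := form_stieltjes_close i kL.
  (* Rows with a large diagonal entry get the trivial bound on the resolvent entry. *)
  case: ltP => hd.
    apply: (@le_trans _ _ ((sc k)^-1 + c^-1)).
      apply: (le_trans (le_normcD _ _)); apply: lerD.
        apply: (le_trans (normc_resolvent_diag hW x y0 i)).
        have f0 := specform_pk_ge0 x y0 (minor W i) (minor_row W i).
        by rewrite lef_pV2 ?posrE ?lerDl// ltr_wpDr.
      by rewrite ComplexField.Normc.normcV lef_pV2 ?posrE.
    by rewrite lerDr divr_ge0 ?sqr_ge0// mulr_ge0 ?ler0n ?(ltW kap0).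
  rewrite addr0 /G (resolvent_diag_perturb erefl) addrC.
  set u := _ - W i i.
  have hu : normc u <= 71 * kap.
    apply: (le_trans (le_normcD _ _)); rewrite normcN.
    by move: hY hd; move: (normc _) (normc _) => a b; lra.
  apply: le_trans (inv_perturb c0 cw _) _; first by lra.
  rewrite ler_pM2r ?invr_gt0 ?exprn_gt0//; lra.
have -> : stieltjes k + w^-1 = real_complex R N^-1 * \sum_i (G i i + w^-1).
  rewrite big_split /= sumr_const card_ord mulrDr -/(\tr G) -stieltjesE; congr (_ + _).
  rewrite -[w^-1 *+ _]mulr_natr [RHS]mulrCA -[LHS]mulr1; congr (_ * _).
  by rewrite -(rmorph_nat (real_complex R)) -rmorphM /= mulVf ?rmorph1// gt_eqF.
rewrite ComplexField.Normc.normcM normc_real gtr0_norm ?invr_gt0//.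
rewrite ler_pdivrMl//; apply: (le_trans (normc_sum _ _ _)).
apply: (le_trans (ler_sum _ (fun i _ => term i))).
rewrite big_split /= sumr_const card_ord -big_mkcond /= sumr_const.
rewrite -(mulr_natl (142 * kap / c ^+ 2)) -(mulr_natl (_ + c^-1)).
have cV : 1 <= c^-1 by rewrite invf_ge1.
have c2V : c^-1 <= (c ^+ 2)^-1.
  by rewrite lef_pV2 ?posrE ?exprn_gt0// expr2 ger_pMr.
have hb : #|[pred i | kap < normc (W i i)]|%:R * ((sc k)^-1 + c^-1)
    <= N * (kap * (1 + c^-1)).
  apply: (@le_trans _ _ (kap * (N * eta) * ((sc k)^-1 + c^-1))).
    rewrite ler_pM2r; last by rewrite addr_gt0 ?invr_gt0.
    exact: hdiag.
  have -> : kap * (N * eta) * ((sc k)^-1 + c^-1) =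
     N * (kap * (eta * (sc k)^-1 + eta * c^-1)) by ring.
  rewrite !ler_pM2l// lerD// ?ler_pdivrMr ?mul1r//.
  by rewrite mulVf ?gt_eqF.
apply: (le_trans (lerD (lexx _) hb)); rewrite -mulrDr ler_pM2l//.
rewrite -!(mulrA _ kap).
have := ler_wpM2l (ltW kap0) (le_trans cV c2V); have := ler_wpM2l (ltW kap0) c2V.
rewrite mulrDr !mulr1; move: (kap / c ^+ 2) (kap / c) => a b h1 h2.
by move: kap0 h1 h2 => h0 h1 h2; lra.
Qed.

(** Clearing the denominator of the fixed point equation; z + s is bounded because
s is close to - 1 / (z + s), which is at most 1 / c. *)
Lemma self_consistent_quadratic k (c om : R) : (k <= L)%N -> 0 < c -> c <= 1 ->
  `|x| <= 2 -> sc k <= 4 -> om <= 1 -> 1350 * kap <= c ^+ 3 * om ->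
  c <= normc (shifted k) ->
  normc (stieltjes k * shifted k + 1) <= om.
Proof.
move=> kL c0 c1 hx hy om1 hk cw.
have w0 : 0 < normc (shifted k) by exact: lt_le_trans cw.
have c2 : c ^+ 2 <= 1 by rewrite expr_le1 ?(ltW c0).
have c3 : 0 < c ^+ 3 by rewrite exprn_gt0.
have c3c : c ^+ 3 <= c by rewrite exprS ger_pMr.
have c3o : c ^+ 3 * om <= c by apply: le_trans c3c; rewrite ger_pMr.
have h142 : 142 * kap <= c by lra.
have h := self_consistent kL c0 c1 h142 cw.
have cV : 1 <= c^-1 by rewrite invf_ge1.
have t1 : 150 * kap / c ^+ 2 <= c * om / 9.
  rewrite ler_pdivrMr ?exprn_gt0//; move: hk; rewrite exprS.
  by move: (c ^+ 2) => d; lra.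
have om0 : 0 < om.
  rewrite -(pmulr_rgt0 om c3); apply: lt_le_trans hk.
  by apply: mulr_gt0 kap0; rewrite ltr0n.
have t2 : c * om / 9 <= 1.
  have : c * om <= 1 by rewrite mulr_ile1 ?(ltW c0) ?(ltW om0).
  lra.
have -> : stieltjes k * shifted k + 1 = (stieltjes k + (shifted k)^-1) * shifted k.
  rewrite mulrDl mulVf// -normc_eq0 gt_eqF//.
rewrite ComplexField.Normc.normcM.
have hs : normc (stieltjes k) <= 1 + c^-1.
  have : normc (stieltjes k) <= normc (stieltjes k + (shifted k)^-1) + normc (shifted k)^-1.
    rewrite -{1}(addrK (shifted k)^-1 (stieltjes k)) -(normcN (shifted k)^-1).
    exact: le_normcD.
  rewrite ComplexField.Normc.normcV.
  have : (normc (shifted k))^-1 <= c^-1 by rewrite lef_pV2 ?posrE.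
  by move: h; move: (normc _) (normc _) ((normc _)^-1) => a b d; lra.
have hw : normc (shifted k) <= 9 / c.
  apply: (le_trans (le_normcD _ _)).
  have : normc (Complex x (sc k)) <= 6.
    apply: (le_trans (normc_le_ReIm _)) => /=; rewrite (gtr0_norm (sc0 k)); lra.
  by move: hs; move: (normc _) (normc _) => a b; lra.
apply: (@le_trans _ _ (c * om / 9 * (9 / c))).
  by apply: ler_pM; rewrite ?normc_ge0// (le_trans h).
by rewrite le_eqVlt; apply/orP; left; apply/eqP; field; rewrite gt_eqF.
Qed.

Lemma quadraticE k (om : R) : normc (stieltjes k * shifted k + 1) <= om ->
  let a := stieltjes_re W x (sc k) in let s := stieltjes_im W x (sc k) in
  `|a * (x + a) - s * (sc k + s) + 1| <= om /\ `|a * (sc k + s) + s * (x + a)| <= om.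
Proof.
move=> h a s; split.
  apply: le_trans h; apply: le_trans (Re_le_normc _); rewrite le_eqVlt; apply/orP; left.
  by apply/eqP; congr (`|_|); rewrite ReD ReC_M /shifted ReD ImD.
apply: le_trans h; apply: le_trans (Im_le_normc _); rewrite le_eqVlt; apply/orP; left.
by apply/eqP; congr (`|_|); rewrite ImD ImC_M /shifted ReD ImD /= addr0.
Qed.

(** Descending induction on the scales.  If the bound holds at scale 4 y, the quadratic
equation holds there and forces Im s to be of order c; at scale y it is still at
least a quarter of this. *)
Lemma shifted_lower k (c : R) : (k <= L)%N -> 0 < c -> c <= 1 ->
  c <= 1 - x ^+ 2 / 4 -> `|x| <= 2 ->
  1350 * kap <= (c / 64) ^+ 3 * (c / 2) ->
  c / 64 <= normc (shifted k).
Proof.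
move=> kL c0 c1 hc hx hk.
suff : c / 64 <= sc k + stieltjes_im W x (sc k).
  move=> h; apply: (le_trans h); apply: le_trans (Im_le_normc _).
  by rewrite /shifted ImD /=; exact: ler_norm.
have im0 j := stieltjes_im_ge0 W x (sc0 j).
have L100 : 100 <= sc L.
  have : (sc L)^-1 <= 100^-1 by apply: (le_trans hL); rewrite -[_^-1]mul1r.
  by rewrite lef_pV2 ?posrE.
rewrite -(subKn kL); elim: (L - k)%N (leq_subr k L) => [|j IH] jL.
  by rewrite subn0; have := im0 L; lra.
have E : (L - j)%N = (L - j.+1).+1 by rewrite subnSK.
have := IH (ltnW jL); rewrite E; set l := (L - j.+1)%N.
have lL : (l.+1 <= L)%N by rewrite -E leq_subr.
have s4 : sc l.+1 = 4 * sc l by rewrite exprS; ring.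
move=> h; case: (leP (c / 64) (sc l)) => hl; first by have := im0 l; lra.
have cw : c / 64 <= normc (shifted l.+1).
  apply: (le_trans h); apply: le_trans (Im_le_normc _).
  by rewrite /shifted ImD /=; exact: ler_norm.
have y4 : sc l.+1 <= 4 by lra.
have c64 : 0 < c / 64 by rewrite divr_gt0.
have c641 : c / 64 <= 1 by lra.
have c21 : c / 2 <= 1 by lra.
have [h1 _] := quadraticE (self_consistent_quadratic lL c64 c641 hx y4 c21 hk cw).
have h4 := stieltjes_scale_le4 hW eta0 kap0 kap1 hNy conc1 lL.
have := quadratic_lower hc (lexx _) y4 (im0 _) h4 h1.
have : stieltjes_im W x (sc l.+1) <= 4 * stieltjes_im W x (sc l).
  rewrite /stieltjes_im mulrCA ler_pM2l ?invr_gt0// /spectr mulr_sumr.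
  apply: ler_sum => i _; rewrite [leRHS]mulrC -ler_pdivrMr//.
  have := pk_quarter x (eigv W i) (sc0 l.+1).
  by rewrite (_ : sc l.+1 / 4 = sc l)//; rewrite s4; field.
have := sc0 l; lra.
Qed.

(** At the smallest scale the quadratic equation is available and its stability
identifies the imaginary part. *)
Lemma local_law (c om : R) : 0 < c -> c <= 1 -> c <= 1 - x ^+ 2 / 4 -> `|x| <= 2 ->
  0 < om -> om <= c / 2 -> eta <= om ->
  1350 * kap <= (c / 64) ^+ 3 * om ->
  `|stieltjes_im W x eta - Num.sqrt (1 - x ^+ 2 / 4)| <= 6000 / c ^+ 3 * om.
Proof.
move=> c0 c1 hc hx om0 omc etao hk.
have k0 : (0 <= L)%N by [].
have c64 : 0 < c / 64 by rewrite divr_gt0.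
have c641 : c / 64 <= 1 by lra.
have hk' : 1350 * kap <= (c / 64) ^+ 3 * (c / 2).
  by apply: (le_trans hk); rewrite ler_pM2l ?exprn_gt0.
have cw := shifted_lower k0 c0 c1 hc hx hk'.
have om1 : om <= 1 by lra.
have E : sc 0%N = eta by rewrite expr0 mulr1.
have y4 : sc 0%N <= 4 by rewrite E; lra.
have [] := quadraticE (self_consistent_quadratic k0 c64 c641 hx y4 om1 hk cw).
rewrite /stieltjes_im E -/(stieltjes_im W x eta) => h1 h2.
apply: (quadratic_close c0 c1 hc hx eta0 etao om1 _ h1 h2).
apply: (quadratic_lower hc omc _ _ _ h1); first by lra.
  exact: stieltjes_im_ge0.
by have := stieltjes_scale_le4 hW eta0 kap0 kap1 hNy conc1 k0; rewrite E.
Qed.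

End LocalLaw.

(** * Riemann sums of the Poisson kernel *)

Section PoissonRiemannSum.
Variable R : realType.
Implicit Types (x t l : R).

Lemma poisson_cell_aux (al v u : R) : 0 < al -> al <= 1 -> `|u - v| <= al ->
  1 + v ^+ 2 <= (1 + 2 * al) * (1 + u ^+ 2).
Proof.
move=> a0 a1; rewrite ler_norml => /andP[h1 h2].
have al2 : al * al <= al by rewrite ger_pMr.
have : (u - v) ^+ 2 <= al * al.
  have : 0 <= (al - (u - v)) * (al + (u - v)) by rewrite mulr_ge0//; lra.
  by rewrite !expr2; lra.
have : - 2 * u * (u - v) <= al * (1 + u ^+ 2).
  have k : forall w : R, 2 * w <= 1 + w ^+ 2.
    by move=> w; have := sqr_ge0 (w - 1); rewrite !expr2; lra.
  have [u0|u0] := leP 0 u.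
    have := ler_wpM2l (ltW a0) (k u).
    have : - 2 * u * (u - v) <= 2 * u * al.
      have : 0 <= 2 * u * (al + (u - v)) by rewrite mulr_ge0//; lra.
      lra.
    lra.
  have := ler_wpM2l (ltW a0) (k (- u)); rewrite sqrrN.
  have : - 2 * u * (u - v) <= - 2 * u * al.
    have : 0 <= - 2 * u * (al - (u - v)) by rewrite mulr_ge0//; lra.
    lra.
  lra.
have : 0 <= al * u ^+ 2 by rewrite mulr_ge0 ?sqr_ge0 ?ltW.
rewrite !expr2; lra.
Qed.

(** Signed angle that the segment from [l] to [x] subtends at height [y] above [l]; a primitive of [pk] in [x]. *)
Definition poisson_angle (y x l : R) : R := atan ((x - l) / y).

(** By the mean value theorem the increment of the angle is the kernel at some point
of the cell, and on a cell of length al y the kernel varies by the factor 1 + 2 al. *)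
Lemma poisson_cell (y al x l : R) : 0 < y -> 0 < al -> al <= 1 ->
  let h := al * y in
  let d := poisson_angle y (x + h) l - poisson_angle y x l in
  h * pk x y l <= (1 + 2 * al) * d /\ d <= (1 + 2 * al) * (h * pk x y l).
Proof.
move=> y0 a0 a1 h d; pose v := (x - l) / y.
have vE : (x + h - l) / y = v + al by rewrite /v /h; field; rewrite gt_eqF.
have cont : {within `[v, v + al], continuous (@atan R)}.
  by apply: continuous_subspaceT => t; exact: continuous_atan.
have [u] := @MVT R atan (fun t => (1 + t ^+ 2)^-1) v (v + al) (ltr_pwDr a0 (lexx _))
  (fun t _ => is_derive1_atan t) cont.
rewrite in_itv /= => /andP[u1 u2]; rewrite addrAC subrr add0r.
rewrite -vE -/(poisson_angle y (x + h) l) -/(poisson_angle y x l) -/d => dE.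
have pkE : h * pk x y l = al * (1 + v ^+ 2)^-1.
  rewrite /pk /h /v; have -> : (l - x) ^+ 2 = (x - l) ^+ 2 by rewrite -sqrrN opprB.
  have := sqr_ge0 (x - l); set s := x - l => s0; field.
  by rewrite !gt_eqF// ?ltr_pwDl ?exprn_gt0 ?sqr_ge0// addrC ltr_pwDl ?exprn_gt0.
have v0 : 0 < 1 + v ^+ 2 by rewrite ltr_pwDl ?sqr_ge0.
have u0 : 0 < 1 + u ^+ 2 by rewrite ltr_pwDl ?sqr_ge0.
have c0 : 0 < 1 + 2 * al by lra.
have uv : `|u - v| <= al by rewrite ler_norml; apply/andP; split; lra.
have key w w' : 0 < 1 + w ^+ 2 -> 0 < 1 + w' ^+ 2 -> `|w' - w| <= al ->
    al * (1 + w ^+ 2)^-1 <= (1 + 2 * al) * (al * (1 + w' ^+ 2)^-1).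
  move=> w0 w'0 ww; rewrite [leRHS]mulrCA ler_pM2l// ler_pdivlMr// ler_pdivrMl//.
  by rewrite mulrC; apply: poisson_cell_aux; rewrite // distrC.
by rewrite pkE dE (mulrC (1 + u ^+ 2)^-1); split; apply: key; rewrite // distrC.
Qed.

Definition gridpt (h : R) (k : nat) : R := -2 + h * k%:R.

Lemma gridptS h k : gridpt h k.+1 = gridpt h k + h.
Proof. by rewrite /gridpt -[k.+1%:R]natr1 mulrDr mulr1 addrA. Qed.

Lemma poisson_sum (y al l : R) (p q : nat) : 0 < y -> 0 < al -> al <= 1 ->
  (p <= q)%N ->
  let h := al * y in
  let S := \sum_(p <= k < q) h * pk (gridpt h k) y l in
  let d := poisson_angle y (gridpt h q) l - poisson_angle y (gridpt h p) l in
  S <= (1 + 2 * al) * d /\ d <= (1 + 2 * al) * S.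
Proof.
move=> y0 a0 a1 pq h S d.
have dE : d = \sum_(p <= k < q)
    (poisson_angle y (gridpt h k.+1) l - poisson_angle y (gridpt h k) l).
  by rewrite telescope_sumr.
rewrite dE /S !mulr_sumr; split; apply: ler_sum => k _; rewrite gridptS.
  by have [] := poisson_cell (gridpt h k) l y0 a0 a1.
by have [] := poisson_cell (gridpt h k) l y0 a0 a1.
Qed.

Lemma angle_diff_le (y x x' l : R) :
  poisson_angle y x' l - poisson_angle y x l <= pi.
Proof.
have := atan_ltpi2 ((x' - l) / y); have := atan_gtNpi2 ((x - l) / y).
rewrite /poisson_angle; lra.
Qed.

(** An eigenvalue at distance L y from both ends of the grid receives nearly the full
mass pi. *)
Lemma angle_diff_ge (y x x' l L : R) : 0 < y -> x <= l - L * y -> l + L * y <= x' ->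
  2 * atan L <= poisson_angle y x' l - poisson_angle y x l.
Proof.
move=> y0 h1 h2; rewrite /poisson_angle.
have : atan L <= atan ((x' - l) / y) by apply: le_atan; rewrite ler_pdivlMr//; lra.
have : atan ((x - l) / y) <= - atan L.
  by rewrite -atanN; apply: le_atan; rewrite ler_pdivrMr//; lra.
lra.
Qed.

(** Far from [x] both kernels are comparable to their width over the squared distance;
so tails at width y are bounded by the wider kernel of width L y. *)
Lemma pk_far (y x l L : R) : 0 < y -> 1 <= L -> L * y <= `|l - x| ->
  pk x y l <= 2 / L * pk x (L * y) l.
Proof.
move=> y0 L1 hd; have L0 : 0 < L by lra.
have Ly0 : 0 < L * y by rewrite mulr_gt0.
rewrite /pk; have d1 := kernel_denom_gt0 x l y0; have d2 := kernel_denom_gt0 x l Ly0.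
have -> : 2 / L * (L * y / ((l - x) ^+ 2 + (L * y) ^+ 2)) =
  y * (2 / ((l - x) ^+ 2 + (L * y) ^+ 2)) by field; rewrite ?gt_eqF// L0.
rewrite ler_pM2l// ler_pdivlMr// mulrC ler_pdivrMr//.
have : (L * y) ^+ 2 <= (l - x) ^+ 2.
  rewrite -[leRHS]real_normK ?num_real// ler_pXn2r// ?nnegrE ?(ltW Ly0)//.
have := sqr_ge0 y; lra.
Qed.

End PoissonRiemannSum.

(** * The semicircle distribution function *)

Section SemicircleIntegral.
Variable R : realType.
Implicit Types (x a b : R).

Lemma rho_scE : @rho_sc R = fun x => (2 * pi)^-1 * Num.sqrt (4 - x ^+ 2).
Proof.
apply/funext => x; rewrite /rho_sc; case: ifPn => //; rewrite -ltNge => x2.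
rewrite ler0_sqrtr ?mulr0// subr_le0 -real_normK ?num_real//.
have -> : (4 : R) = 2 ^+ 2 by rewrite expr2; lra.
by rewrite ler_pXn2r ?nnegrE// ltW.
Qed.

Lemma rho_sc_continuous : continuous (@rho_sc R).
Proof.
rewrite rho_scE => x; apply: cvgM; first exact: cvg_cst.
apply: continuous_comp; last exact: sqrt_continuous.
by apply: cvgB; [exact: cvg_cst | exact: exprn_continuous].
Qed.

Lemma measurable_rho_sc (D : set R) : measurable_fun D (fun t => (rho_sc t)%:E).
Proof.
apply/measurable_EFinP; apply: measurable_funTS; apply: continuous_measurable_fun.
exact: rho_sc_continuous.
Qed.

Lemma pi_rho_sc x : pi * rho_sc x = Num.sqrt (1 - x ^+ 2 / 4).
Proof.
rewrite rho_scE; have -> : 4 - x ^+ 2 = 2 ^+ 2 * (1 - x ^+ 2 / 4) by rewrite expr2; field.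
rewrite sqrtrM ?sqr_ge0// sqrtr_sqr ger0_norm//.
have p0 : (pi : R) != 0 by rewrite gt_eqF// pi_gt0.
move: (pi : R) p0 => p p0.
by field.
Qed.

(** The distribution function of the semicircle law.  The base point lies to the left of
the support, so that the fundamental theorem applies at the spectral edge too. *)
Definition sc_primitive x : R :=
  (\int[lebesgue_measure]_(t in `[(-4 : R), x]) rho_sc t)%R.

Lemma sc_primitive_derive x : -4 < x -> is_derive x 1 sc_primitive (rho_sc x).
Proof.
move=> x4.
have ig : lebesgue_measure.-integrable `[-4, x + 1] (EFin \o @rho_sc R).
  apply: continuous_compact_integrable; first exact: segment_compact.
  exact/continuous_subspaceT/rho_sc_continuous.
have xx1 : x < x + 1 by rewrite ltrDl.
have cx : {for x, continuous (@rho_sc R)} by exact: rho_sc_continuous.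
have [d E] := continuous_FTC1_closed xx1 ig x4 cx.
apply: DeriveDef; first exact: d.
by rewrite -derive1E.
Qed.

Lemma sc_primitive_continuous x : -4 < x -> {for x, continuous sc_primitive}.
Proof.
move=> x4; apply: differentiable_continuous; apply/derivable1_diffP.
by have [] := sc_primitive_derive x4.
Qed.

Lemma integral_rho_sc_cc a b : -4 < a -> a < b ->
  (\int[lebesgue_measure]_(t in `[a, b]) rho_sc t)%R = sc_primitive b - sc_primitive a.
Proof.
move=> a4 ab; rewrite /Rintegral.
have b4 : -4 < b by exact: lt_trans ab.
rewrite (@continuous_FTC2 R _ sc_primitive _ _ ab) ?fineB//.
- exact/continuous_subspaceT/rho_sc_continuous.
- split.
  + move=> x; rewrite in_itv /= => /andP[ax _].
    by have [] := sc_primitive_derive (lt_trans a4 ax).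
  + exact/cvg_at_right_filter/sc_primitive_continuous.
  + exact/cvg_at_left_filter/sc_primitive_continuous.
- move=> x; rewrite in_itv /= => /andP[ax _].
  by rewrite derive1E; have [_ ->] := sc_primitive_derive (lt_trans a4 ax).
Qed.

(** Unbounded and degenerate intervals have [itv_length] zero, so a positive length
leaves two real end points; whether these belong to the interval affects neither
its length nor the integral. *)
Lemma interval_endpoints (I : interval R) (c : R) : 0 < itv_length I ->
  [set` I] `<=` `](- c), c[%classic -> exists a b : R,
  [/\ a < b /\ itv_length I = b - a, - c <= a /\ b <= c,
      forall x, x \in I -> a <= x <= b,
      forall x, x \notin I -> x <= a \/ b <= x &
      -4 < a -> (\int[lebesgue_measure]_(t in [set` I]) rho_sc t)%R =
                sc_primitive b - sc_primitive a].
Proof.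
rewrite /itv_length lebesgue_measure_itv; case: ifPn => [|_ /= h]; last by exfalso; lra.
case: I => [[b1 a|b1] [b2 b|b2]]; last first.
- by case: b1; case: b2 => /= _ h; exfalso; lra.
- by case: b1 => /= _ h; exfalso; lra.
- by case: b2 => /= _ h; exfalso; lra.
rewrite /= lte_fin.
move=> ab _ sub; exists a, b.
have inI x : a < x -> x < b -> x \in Interval (BSide b1 a) (BSide b2 b).
  by move=> ax xb; rewrite in_itv /= !lteifS.
split=> //.
- pose mid := (a + b) / 2.
  have am : a < mid by rewrite /mid; lra.
  have mb : mid < b by rewrite /mid; lra.
  split; rewrite leNgt; apply/negP => h.
  + have := sub (Num.min (- c) mid) (inI _ _ _).
    rewrite lt_min h am gt_min mb orbT /= => /(_ isT isT).
    by rewrite in_itv /= lt_min ltxx.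
  + have := sub (Num.max c mid) (inI _ _ _).
    rewrite gt_max h mb lt_max am orbT /= => /(_ isT isT).
    by rewrite in_itv /= gt_max ltxx /= andbF.
- by move=> x; rewrite in_itv /= => /andP[/lteifW -> /lteifW ->].
- move=> x xI; have [ax|] := leP x a; first by left.
  have [xb|xb ax] := leP b x; first by right.
  by rewrite (inI _ ax xb) in xI.
- move=> a4; rewrite -(integral_rho_sc_cc a4 ab) /Rintegral; congr fine.
  rewrite integral_itv_bndoo; last first.
    exact: measurable_rho_sc.
  rewrite [in RHS]integral_itv_bndoo//.
  exact: measurable_rho_sc.
Qed.

Lemma sc_primitive_incr a b : -4 < a -> a < b -> `|a| <= 2 -> `|b| <= 2 ->
  exists2 t, a < t < b & pi * (sc_primitive b - sc_primitive a) =
    (b - a) * Num.sqrt (1 - t ^+ 2 / 4).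
Proof.
move=> a4 ab a2 b2.
have [||t] := @MVT R sc_primitive (@rho_sc R) a b ab.
- move=> x; rewrite in_itv /= => /andP[ax _].
  exact: sc_primitive_derive (lt_trans a4 ax).
- apply: continuous_in_subspaceT => x; rewrite inE /= in_itv /= => /andP[ax _].
  exact: sc_primitive_continuous (lt_le_trans a4 ax).
rewrite in_itv /= => tI ->; exists t => //.
by rewrite -pi_rho_sc; ring.
Qed.

(** The square root is Hoelder continuous with exponent 1 / 2, which holds uniformly up
to the edge. *)
Lemma semicircle_modulus (s t : R) : `|s| <= 2 -> `|t| <= 2 ->
  `|Num.sqrt (1 - s ^+ 2 / 4) - Num.sqrt (1 - t ^+ 2 / 4)| ^+ 2 <= `|s - t|.
Proof.
move=> s2 t2.
have pos (u : R) : `|u| <= 2 -> 0 <= 1 - u ^+ 2 / 4.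
  move=> u2; have := ler_pM (normr_ge0 u) (normr_ge0 u) u2 u2.
  by rewrite -expr2 real_normK ?num_real//; lra.
set A := Num.sqrt _; set B := Num.sqrt _.
have A0 : 0 <= A by exact: sqrtr_ge0.
have B0 : 0 <= B by exact: sqrtr_ge0.
apply: (@le_trans _ _ `|A ^+ 2 - B ^+ 2|).
  rewrite subr_sqr normrM expr2 ler_wpM2l// (ger0_norm (addr_ge0 A0 B0)).
  by rewrite ler_norml; apply/andP; split; lra.
rewrite !sqr_sqrtr ?pos//.
have -> : 1 - s ^+ 2 / 4 - (1 - t ^+ 2 / 4) = - (s - t) * ((s + t) / 4) by field.
rewrite normrM normrN ler_piMr// ler_norml.
move: s2 t2; rewrite !ler_norml => /andP[? ?] /andP[? ?]; apply/andP; split; lra.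
Qed.

Lemma sc_primitive_le a b : -2 <= a -> a <= b -> b <= 2 ->
  0 <= pi * (sc_primitive b - sc_primitive a) <= b - a.
Proof.
move=> a2 ab b2; have [->|ne] := eqVneq a b; first by rewrite !subrr mulr0 lexx.
have ltab : a < b by rewrite lt_neqAle ne.
have [|||t tI ->] := @sc_primitive_incr a b _ ltab.
- lra.
- by rewrite ler_norml; apply/andP; split; lra.
- by rewrite ler_norml; apply/andP; split; lra.
have ba : 0 < b - a by rewrite subr_gt0.
rewrite mulr_ge0 ?sqrtr_ge0 ?(ltW ba)//= ler_piMr ?(ltW ba)//.
by rewrite -[leRHS]sqrtr1 ler_wsqrtr// gerBl divr_ge0// sqr_ge0.
Qed.

End SemicircleIntegral.

(** * From Poisson averages to eigenvalue counts *)

Section Counting.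
Variables (R : realType) (n : nat) (lam : 'I_n -> R).
Hypothesis n0 : (0 < n)%N.
Local Notation N := (n%:R : R).

Definition avg_pk (x y : R) : R := N^-1 * \sum_j pk x y (lam j).

Variables (eta al L ep dl : R).
Hypotheses (eta0 : 0 < eta) (al0 : 0 < al) (al1 : al <= 1) (L1 : 1 <= L).
Hypotheses (ep0 : 0 < ep) (dl0 : 0 < dl) (dl1 : dl <= 1).
Local Notation h := (al * eta).
Local Notation Y := (L * eta).
Hypothesis hdl : h <= dl ^+ 2.
Hypothesis hep : Y + h <= ep.
Hypothesis grid_close : forall k, `|gridpt h k| <= 2 - ep ->
  `|avg_pk (gridpt h k) eta - Num.sqrt (1 - gridpt h k ^+ 2 / 4)| <= dl.
Hypothesis grid_le4 : forall k, `|gridpt h k| <= 2 - ep ->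
  avg_pk (gridpt h k) Y <= 4.

Let h0 : 0 < h. Proof. by rewrite mulr_gt0. Qed.
Let N0 : 0 < N. Proof. by rewrite ltr0n. Qed.

Lemma grid_floor (u : R) : -2 <= u -> exists k, gridpt h k <= u < gridpt h k + h.
Proof.
move=> u2; have u0 : 0 <= (u + 2) / h by rewrite divr_ge0 ?(ltW h0)//; lra.
have /andP[t1 t2] := truncn_itv u0.
exists (Num.truncn ((u + 2) / h)); rewrite -gridptS /gridpt.
move: t1 t2; rewrite ler_pdivlMr// ltr_pdivrMr// => t1 t2; apply/andP; split; lra.
Qed.

Lemma gridpt_le (k k' : nat) : (k <= k')%N -> gridpt h k <= gridpt h k'.
Proof. by move=> kk; rewrite /gridpt lerD2l ler_pM2l// ler_nat. Qed.

Lemma gridpt_lt (k k' : nat) : gridpt h k < gridpt h k' -> (k < k')%N.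
Proof. by rewrite /gridpt ltrD2l ltr_pM2l// ltr_nat. Qed.

Lemma gridpt_ge (k : nat) : -2 <= gridpt h k.
Proof. by rewrite /gridpt lerDl mulr_ge0 ?(ltW h0). Qed.

Lemma sum_h (p q : nat) : (p <= q)%N ->
  \sum_(p <= k < q) h = gridpt h q - gridpt h p.
Proof.
move=> pq; rewrite -telescope_sumr//; apply: eq_bigr => k _.
by rewrite gridptS addrAC subrr add0r.
Qed.

(** A cell has length at most dl^2, so by its Hoelder modulus the density varies by at
most [dl] on it. *)
Lemma cell_primitive (k : nat) : gridpt h k + h <= 2 ->
  `|h * Num.sqrt (1 - gridpt h k ^+ 2 / 4)
    - pi * (sc_primitive (gridpt h k.+1) - sc_primitive (gridpt h k))| <= h * dl.
Proof.
move=> k2; rewrite gridptS; have := gridpt_ge k.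
move: (gridpt h k) k2 (h0) => x k2 hp x2.
have nx : `|x| <= 2 by rewrite ler_norml; apply/andP; split; lra.
have [||||t /andP[t1 t2] ->] := @sc_primitive_incr R x (x + h).
- lra.
- by rewrite ltrDl.
- exact: nx.
- by rewrite ler_norml; apply/andP; split; lra.
rewrite [x + h - x]addrAC subrr add0r -mulrBr normrM gtr0_norm// ler_pM2l//.
have nt : `|t| <= 2 by rewrite ler_norml; apply/andP; split; lra.
have := semicircle_modulus nx nt; set D := `|_| => D1.
rewrite -(ler_pXn2r (n := 2)) ?nnegrE ?normr_ge0 ?(ltW dl0)//.
apply: (le_trans D1); apply: le_trans hdl.
by rewrite distrC ger0_norm; lra.
Qed.

Definition grid_sum (y : R) (p q : nat) : R :=
  \sum_(p <= k < q) h * avg_pk (gridpt h k) y.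

Ltac hyps := move: (h0) (hep) (ep0) (dl0) => ? ? ? ?.

Lemma grid_sum_close (p q : nat) : (p <= q)%N -> -2 + ep <= gridpt h p ->
  gridpt h q <= 2 - ep + h -> gridpt h q <= 2 ->
  `|grid_sum eta p q - pi * (sc_primitive (gridpt h q) - sc_primitive (gridpt h p))|
    <= 2 * dl * (gridpt h q - gridpt h p).
Proof.
move=> pq hp hq q2; hyps.
rewrite -(@telescope_sumr R p q (fun k => sc_primitive (gridpt h k)) pq) mulr_sumr.
rewrite -sum_h// mulr_sumr /grid_sum -sumrB.
apply: (le_trans (ler_norm_sum _ _ _)); rewrite big_nat [leRHS]big_nat.
apply: ler_sum => k /andP[lek kq].
have kh : gridpt h k + h <= gridpt h q by rewrite -gridptS; exact: gridpt_le.
have kp := gridpt_le lek.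
have nk : `|gridpt h k| <= 2 - ep by rewrite ler_norml; apply/andP; split; lra.
have c1 := cell_primitive (le_trans kh q2).
have := grid_close nk; set G := Num.sqrt _ in c1 *; set s := avg_pk _ _ => sG.
rewrite -[h * s](subrK (h * G)) -addrA -mulrBr.
apply: (le_trans (ler_normD _ _)); rewrite normrM (gtr0_norm h0).
have := ler_wpM2l (ltW h0) sG; move: c1; lra.
Qed.

Lemma grid_sum_poisson (y : R) (p q : nat) :
  grid_sum y p q = N^-1 * \sum_j \sum_(p <= k < q) h * pk (gridpt h k) y (lam j).
Proof.
rewrite /grid_sum exchange_big /= mulr_sumr; apply: eq_bigr => k _.
by rewrite /avg_pk mulrCA mulr_sumr.
Qed.

Section OneInterval.
Variables (a b : R) (I : pred R).
Hypotheses (ab : a < b) (ha : -2 + 2 * ep <= a) (hb : b <= 2 - 2 * ep).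
Hypothesis hlen : 2 * (Y + h) <= dl * (b - a).
Hypothesis inI : forall x, x \in I -> a <= x <= b.
Hypothesis notinI : forall x, x \notin I -> x <= a \/ b <= x.
Local Notation nu := (N^-1 * #|[pred j | lam j \in I]|%:R).
Local Notation Phi := (pi * (sc_primitive b - sc_primitive a)).

Let Leta0 : 0 < Y.
Proof. by rewrite mulr_gt0// (lt_le_trans ltr01 L1). Qed.

Let dlba : dl * (b - a) <= b - a.
Proof. by rewrite ler_piMl// subr_ge0 ltW. Qed.

Let card_sum (c : R) : #|[pred j | lam j \in I]|%:R * c =
  \sum_j (if lam j \in I then c else 0).
Proof. by rewrite -big_mkcond /= sumr_const mulr_natl. Qed.

Ltac hyps2 := hyps; move: (ab) (ha) (hb) (hlen) (dlba) (Leta0) (al0) (L1) => ? ? ? ? ? ? ? ?.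

(** Sum the averages over a grid covering the interval with a margin of L eta.  Every
eigenvalue of the interval contributes at least 2 atan L, and the margins are short
compared with the interval. *)
Lemma count_upper : nu * (2 * atan L) <= (1 + 2 * al) * (Phi + 5 * dl * (b - a)).
Proof.
hyps2.
have [|p /andP[p1 p2]] := @grid_floor (a - Y); first by lra.
have [|q' /andP[q1 q2]] := @grid_floor (b + Y); first by lra.
rewrite -gridptS in q2; set q := q'.+1 in q2.
have qE : gridpt h q = gridpt h q' + h by rewrite gridptS.
have pq : (p <= q)%N by apply: ltnW; apply: gridpt_lt; lra.
have q22 : gridpt h q <= 2 by lra.
have /andP[_ S1] : - (2 * dl * (gridpt h q - gridpt h p)) <=
   grid_sum eta p q - pi * (sc_primitive (gridpt h q) - sc_primitive (gridpt h p))
   <= 2 * dl * (gridpt h q - gridpt h p).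
  by rewrite -ler_norml; apply: grid_sum_close => //; lra.
have Fp : pi * (sc_primitive a - sc_primitive (gridpt h p)) <= a - gridpt h p.
  by have /andP[_] := @sc_primitive_le R (gridpt h p) a (gridpt_ge p) ltac:(lra) ltac:(lra).
have Fq : pi * (sc_primitive (gridpt h q) - sc_primitive b) <= gridpt h q - b.
  by have /andP[_] := @sc_primitive_le R b (gridpt h q) ltac:(lra) ltac:(lra) q22.
have S2 : grid_sum eta p q <= Phi + 5 * dl * (b - a).
  have l1 : gridpt h q - gridpt h p <= 2 * (b - a) by lra.
  have := ler_wpM2l (ltW dl0) l1.
  move: S1 Fp Fq; rewrite !mulrBr; lra.
have al20 : 0 < 1 + 2 * al by lra.
apply: le_trans (ler_wpM2l (ltW al20) S2).
rewrite -mulrA card_sum grid_sum_poisson mulrCA ler_pM2l ?invr_gt0// mulr_sumr.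
apply: ler_sum => j _; have := poisson_sum (lam j) eta0 al0 al1 pq => -[S3 S4].
case: ifP => jI; last first.
  rewrite mulr_ge0 ?(ltW al20)//; apply: sumr_ge0 => k _.
  by rewrite mulr_ge0 ?(ltW h0)// pk_ge0.
apply: le_trans S4; have /andP[ja jb] := inI jI.
by apply: angle_diff_ge => //; lra.
Qed.

(** Sum over a grid that stays L eta inside the interval.  An eigenvalue of the interval
contributes at most pi up to the Riemann sum error, and one outside is at distance
L eta from the grid, where the wider kernel dominates. *)
Lemma count_lower : Phi - 3 * dl * (b - a) <= (1 + 2 * al) * pi * nu + 8 / L * (b - a).
Proof.
hyps2.
have [|p' /andP[p1 p2]] := @grid_floor (a + Y); first by lra.
have [|q /andP[q1 q2]] := @grid_floor (b - Y); first by lra.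
rewrite -gridptS in p2; set p := p'.+1 in p2.
have pE : gridpt h p = gridpt h p' + h by rewrite gridptS.
have [qp|pq] := ltnP q p.
  have : gridpt h q + h <= gridpt h p by rewrite -gridptS; exact: gridpt_le.
  lra.
have q22 : gridpt h q <= 2 by lra.
have /andP[S1 _] : - (2 * dl * (gridpt h q - gridpt h p)) <=
   grid_sum eta p q - pi * (sc_primitive (gridpt h q) - sc_primitive (gridpt h p))
   <= 2 * dl * (gridpt h q - gridpt h p).
  by rewrite -ler_norml; apply: grid_sum_close => //; lra.
have Fp : pi * (sc_primitive (gridpt h p) - sc_primitive a) <= gridpt h p - a.
  by have /andP[_] := @sc_primitive_le R a (gridpt h p) ltac:(lra) ltac:(lra)
    ltac:(have := gridpt_le pq; lra).
have Fq : pi * (sc_primitive b - sc_primitive (gridpt h q)) <= b - gridpt h q.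
  by have /andP[_] := @sc_primitive_le R (gridpt h q) b (gridpt_ge q) ltac:(lra) ltac:(lra).
have S2 : Phi - 3 * dl * (b - a) <= grid_sum eta p q.
  have l1 : gridpt h q - gridpt h p <= b - a by lra.
  have := ler_wpM2l (ltW dl0) l1.
  move: S1 Fp Fq; rewrite !mulrBr; lra.
apply: (le_trans S2).
have al20 : 0 < 1 + 2 * al by lra.
have far : grid_sum Y p q <= 4 * (b - a).
  apply: (@le_trans _ _ (4 * (gridpt h q - gridpt h p))); last by lra.
  rewrite -sum_h// mulr_sumr /grid_sum big_nat [leRHS]big_nat.
  apply: ler_sum => k /andP[lek kq]; rewrite [4 * h]mulrC ler_pM2l//.
  have kp := gridpt_le lek; have kq' := gridpt_le (ltnW kq).
  by apply: grid_le4; rewrite ler_norml; apply/andP; split; lra.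
have L0 : 0 < L by lra.
have {}far : 2 / L * grid_sum Y p q <= 8 / L * (b - a).
  have -> : 8 / L * (b - a) = 2 / L * (4 * (b - a)) by field; rewrite gt_eqF.
  by rewrite ler_pM2l// divr_gt0.
apply: le_trans (lerD (lexx _) far).
rewrite !grid_sum_poisson mulrCA [X in _ <= _ + X]mulrCA -mulrDr ler_pM2l ?invr_gt0//.
rewrite [_ * #|_|%:R]mulrC card_sum mulr_sumr -big_split /=.
apply: ler_sum => j _; have := poisson_sum (lam j) eta0 al0 al1 pq => -[S3 _].
case: ifP => jI.
  apply: (le_trans S3); apply: ler_wpDr; last first.
    by rewrite ler_pM2l//; exact: angle_diff_le.
  rewrite mulr_ge0 ?divr_ge0 ?(ltW L0)//; apply: sumr_ge0 => k _.
  by rewrite mulr_ge0 ?(ltW h0)// pk_ge0.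
rewrite add0r mulr_sumr big_nat [leRHS]big_nat; apply: ler_sum => k /andP[lek kq].
rewrite [leRHS]mulrCA ler_pM2l//; apply: pk_far => //.
have kp := gridpt_le lek; have kq' := gridpt_le (ltnW kq).
have [ja|jb] := notinI (negbT jI).
  by rewrite distrC; apply: le_trans (ler_norm _); lra.
by apply: le_trans (ler_norm _); lra.
Qed.

End OneInterval.
End Counting.

(** Here T plays the role of 2 atan L, p that of pi; both bounds are solved for the proportion nu. *)
Lemma count_combine (R : realType) (be nu Phi l p T : R) :
  0 < be -> be <= 1 / 6 -> 0 <= nu -> 0 < l -> 0 <= Phi -> Phi <= l -> 1 <= p ->
  p * (1 - be) <= T ->
  nu * T <= (1 + 2 * be) * (Phi + 5 * be * l) ->
  Phi - 4 * be * l <= (1 + 2 * be) * (p * nu) ->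
  `|nu - Phi / p| <= 16 * be * l.
Proof.
move=> b0 b6 n0 l0 P0 Pl p1 hT U Lo.
have p0 : 0 < p by lra.
have bl : 0 < be * l by rewrite mulr_gt0.
have bbl : be * (be * l) <= 1 / 6 * (be * l) by rewrite ler_pM2r.
have bP : be * Phi <= be * l by rewrite ler_pM2l.
have bP0 : 0 <= be * Phi by rewrite mulr_ge0 ?(ltW b0).
have U1 : (p * nu) * (1 - be) <= (1 + 2 * be) * (Phi + 5 * be * l).
  by apply: le_trans U; rewrite mulrC mulrA [_ * p]mulrC [leLHS]mulrC ler_wpM2l.
have U2 : p * nu <= Phi + 16 * be * l.
  have k : (1 + 2 * be) * (Phi + 5 * be * l) <= (1 - be) * (Phi + 16 * be * l).
    have := ler_wpM2l (ltW b0) bbl; have := ler_wpM2l (ltW b0) bP.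
    lra.
  have b1 : 0 < 1 - be by lra.
  by rewrite -(ler_pM2l b1) mulrC; apply: le_trans k.
have L2 : Phi - 6 * be * l <= p * nu.
  have b1 : 0 < 1 + 2 * be by lra.
  rewrite -(ler_pM2l b1); apply: le_trans Lo.
  have : 0 <= be * (be * l) by rewrite mulr_ge0 ?(ltW b0) ?(ltW bl).
  lra.
have : `|p * nu - Phi| <= 16 * be * l by rewrite ler_norml; apply/andP; split; lra.
have -> : nu - Phi / p = p^-1 * (p * nu - Phi) by field; rewrite gt_eqF.
rewrite normrM gtr0_norm ?invr_gt0// => h; apply: le_trans h.
by rewrite ler_piMl// invf_le1.
Qed.

(** * Conditioning on a block of independent entries *)

Section Conditioning.
Context (d : measure_display) (T : measurableType d) (R : realType).
Variables (P : probability T R) (I : finType) (X : I -> T -> R[i]) (D : {set I}).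
Hypothesis mX : forall p, complex_rv (X p).
Hypothesis indepX : mutually_independent P D X.

(** The intersection-stable family that generates the sigma-algebra of the entries
indexed by [D1]. *)
Definition cylinder (D1 : {set I}) : set (set T) :=
  [set S | exists (J : {set I}) (B : I -> set (R * R)),
    [/\ J \subset D1, forall i, measurable (B i) &
        S = \bigcap_(i in [set` J]) [set w | B i (cpair (X i w))]]].

Lemma measurable_entry i (B : set (R * R)) : measurable B ->
  measurable [set w | B (cpair (X i w))].
Proof. by move=> mB; rewrite -[X in measurable X]setTI; exact: mX. Qed.

Lemma cylinder_measurable D1 : cylinder D1 `<=` measurable.
Proof.
move=> S [J [B [_ mB ->]]]; apply: fin_bigcap_measurable => // i _.
exact: measurable_entry.
Qed.

Lemma cylinder_setT D1 : cylinder D1 setT.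
Proof.
exists finset.set0, (fun=> setT); split; rewrite ?finset.sub0set//.
by apply/seteqP; split=> // w _ i /=; rewrite inE.
Qed.

Lemma cylinder_setI D1 : setI_closed (cylinder D1).
Proof.
move=> _ _ [J1 [B1 [s1 m1 ->]]] [J2 [B2 [s2 m2 ->]]].
exists (J1 :|: J2), (fun i => (if i \in J1 then B1 i else setT) `&`
                    (if i \in J2 then B2 i else setT)); split.
- by rewrite finset.subUset s1.
- by move=> i; apply: measurableI; case: ifP.
- apply/seteqP; split=> [w [w1 w2] i /=|w wI].
    rewrite inE => _; split; case: ifP => // iJ; [exact: w1|exact: w2].
  by split=> i /= iJ; have := wI i; rewrite /= inE iJ ?orbT => /(_ isT) [].
Qed.

Lemma cylinder_indep (D1 D2 : {set I}) S1 S2 : (forall i, i \in D1 -> i \notin D2) -> D1 \subset D -> D2 \subset D ->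
  cylinder D1 S1 -> cylinder D2 S2 -> P (S1 `&` S2) = (P S1 * P S2)%E.
Proof.
move=> dis sD1 sD2 [J1 [B1 [s1 m1 ->]]] [J2 [B2 [s2 m2 ->]]].
have disJ i : i \in J2 -> i \in J1 = false.
  move=> /(fintype.subsetP s2) i2; apply/negbTE/negP => /(fintype.subsetP s1) /dis.
  by rewrite i2.
pose B i := if i \in J1 then B1 i else B2 i.
have mB i : measurable (B i) by rewrite /B; case: ifP.
have JD1 := fintype.subset_trans s1 sD1; have JD2 := fintype.subset_trans s2 sD2.
have -> : (\bigcap_(i in [set` J1]) [set w | B1 i (cpair (X i w))]) `&`
   (\bigcap_(i in [set` J2]) [set w | B2 i (cpair (X i w))]) =
   \bigcap_(i in [set` J1 :|: J2]) [set w | B i (cpair (X i w))].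
  apply/seteqP; split=> [w [w1 w2] i /=|w wI].
    rewrite inE /B; case: ifP => [iJ1 _|_ /= iJ2]; [exact: w1|exact: w2].
  split=> i /= iJ; have := wI i; rewrite /= /B inE iJ ?orbT => /(_ isT) //.
  by rewrite disJ.
rewrite (indepX (J := J1 :|: J2) _ mB); last by rewrite finset.subUset JD1.
rewrite (indepX JD1 m1) (indepX JD2 m2).
rewrite (big_setID J1) /=; congr (_ * _)%E.
  rewrite (_ : (J1 :|: J2) :&: J1 = J1); last first.
    by apply/setP => i; rewrite !inE; case: (i \in J1); rewrite ?andbF.
  apply: eq_bigr => i iJ.
  by rewrite /B iJ.
have -> : (J1 :|: J2) :\: J1 = J2.
  apply/setP => i; rewrite !inE; case: (boolP (i \in J1)) => //= i1.
  by apply/esym/negbTE/negP => /disJ; rewrite i1.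
by apply: eq_bigr => i iJ; rewrite /B disJ.
Qed.

(** Independence on cylinders extends to the generated sigma-algebras by uniqueness of
measures that agree on an intersection-stable family, one block at a time. *)
Lemma sigma_indep (D1 D2 : {set I}) S1 S2 : (forall i, i \in D1 -> i \notin D2) -> D1 \subset D -> D2 \subset D ->
  <<s cylinder D1 >> S1 -> <<s cylinder D2 >> S2 -> P (S1 `&` S2) = (P S1 * P S2)%E.
Proof.
move=> dis sD1 sD2 hS1 hS2.
have sm D0 S : <<s cylinder D0 >> S -> measurable S.
  apply: smallest_sub; [exact: sigma_algebra_measurable | exact: cylinder_measurable].
have step D0 S S' : measurable S' ->
    (forall A, cylinder D0 A -> P (A `&` S') = (P A * P S')%E) ->
    <<s cylinder D0 >> S -> P (S `&` S') = (P S * P S')%E.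
  move=> mS' h hS.
  pose c : {nonneg R} := NngNum (fine_ge0 (measure_ge0 P S')).
  have := @g_sigma_algebra_measure_unique _ R T (cylinder D0) (@cylinder_measurable D0)
    (fun=> setT) (fun=> cylinder_setT D0) _ (mrestr P mS') (mscale c P) (@cylinder_setI D0).
  have E A : (mscale c P) A = (P A * P S')%E.
    by rewrite /mscale /= fineK ?fin_num_measure// muleC.
  have cov : \bigcup_(k : nat) [set: T] = [set: T].
    by apply/seteqP; split=> // w _; exists 0%N.
  move=> /(_ cov) H; rewrite -E; apply: H hS.
    by move=> A cA; transitivity (P A * P S')%E; [exact: h | exact/esym/E].
  by move=> _; rewrite /= /mrestr setTI ltey_eq fin_num_measure.
apply: (step D1) => //; first exact: sm hS2.
move=> A cA; rewrite setIC muleC; apply: (step D2) => //.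
  exact: cylinder_measurable cA.
by move=> A' cA'; rewrite setIC muleC; exact: cylinder_indep dis _ _ cA cA'.
Qed.

Local Notation sub D1 := (g_sigma_algebraType (cylinder D1)).

Lemma measurable_sub_id D1 : measurable_fun [set: T] (fun w => w : sub D1).
Proof.
move=> _ S mS; rewrite setTI preimage_id.
exact: (smallest_sub (@sigma_algebra_measurable _ T) (@cylinder_measurable D1)) mS.
Qed.

Lemma entry_sub_measurable (D1 : {set I}) i : i \in D1 ->
  measurable_fun [set: sub D1] (fun w : sub D1 => cpair (X i w)).
Proof.
move=> iD _ B mB; rewrite setTI; apply: sub_sigma_algebra.
exists (finset.set1 i), (fun=> B); split=> //; first by rewrite finset.sub1set.
apply/seteqP; split=> [w wB j /=|w wB]; first by rewrite inE => /eqP ->.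
by apply: (wB i); rewrite /= inE.
Qed.

Section Pair.
Variables D1 D2 : {set I}.
Hypotheses (dis : forall i, i \in D1 -> i \notin D2) (sD1 : D1 \subset D) (sD2 : D2 \subset D).

(** The same sample space seen through two sub-sigma-algebras.  Independence of the blocks
means that the diagonal map sends [P] to a product measure, so that Fubini applies
without any product structure of the original space. *)
Definition diag (w : T) : sub D1 * sub D2 := (w, w).

Lemma measurable_diag : measurable_fun [set: T] diag.
Proof. by apply: measurable_fun_pair; exact: measurable_sub_id. Qed.

Let id1 : {mfun T >-> sub D1} := mfun_Sub (mem_set (@measurable_sub_id D1)).
Let id2 : {mfun T >-> sub D2} := mfun_Sub (mem_set (@measurable_sub_id D2)).
Let dg : {mfun T >-> (sub D1 * sub D2)%type} := mfun_Sub (mem_set measurable_diag).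

Lemma diag_product (S : set (sub D1 * sub D2)) : measurable S ->
  (distribution P id1 \x distribution P id2)%E S = distribution P dg S.
Proof.
apply: product_measure_unique => A B mA mB.
exact: (sigma_indep dis sD1 sD2 mA mB).
Qed.

(** A bound valid for every frozen value of the first block is a bound for the joint
event, by Fubini. *)
Lemma conditioning (S : set (sub D1 * sub D2)) (c : \bar R) : measurable S ->
  (forall w, P [set w' | S (w, w')] <= c)%E -> (P [set w | S (w, w)] <= c)%E.
Proof.
move=> mS h.
have -> : P [set w | S (w, w)] = distribution P dg S by [].
rewrite -diag_product// /product_measure1.
have c0 : (0 <= c)%E.
  by apply: le_trans (h point); exact: measure_ge0.
apply: (@le_trans _ _ (\int[distribution P id1]_x c)%E).
  apply: ge0_le_integral => //.
  - exact: measurable_fun_xsection.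
  - move=> w _ /=; apply: le_trans (h w).
    by rewrite le_eqVlt; apply/orP; left; apply/eqP; congr (P _);
       apply/seteqP; split=> w' /=; rewrite xsectionE.
by rewrite integral_cst//= probability_setT mule1.
Qed.

Lemma integral_indep_mul (a : sub D1 -> R) (b : sub D2 -> R) :
  measurable_fun [set: sub D1] a -> measurable_fun [set: sub D2] b ->
  P.-integrable [set: T] (fun w => (a w)%:E) ->
  P.-integrable [set: T] (fun w => (b w)%:E) ->
  P.-integrable [set: T] (fun w => (a w * b w)%:E) ->
  (\int[P]_w (a w * b w)%:E = (\int[P]_w (a w)%:E) * (\int[P]_w (b w)%:E))%E.
Proof.
move=> ma mb ia ib iab.
pose F (z : sub D1 * sub D2) : \bar R := (a z.1 * b z.2)%:E.
have mF : measurable_fun [set: sub D1 * sub D2] F.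
  apply/measurable_EFinP; apply: measurable_funM.
    by apply: measurableT_comp => //; exact: measurable_fst.
  by apply: measurableT_comp => //; exact: measurable_snd.
have iF : (distribution P dg).-integrable setT F.
  by apply: integrable_pushforward.
have iF' : (distribution P id1 \x distribution P id2)%E.-integrable setT F.
  apply/integrableP; split=> //.
  rewrite (eq_measure_integral (distribution P dg)); last first.
    by move=> A mA _; exact: diag_product.
  by have /integrableP[] := iF.
have -> : (\int[P]_w (a w * b w)%:E = \int[distribution P dg]_z F z)%E.
  by rewrite integral_pushforward.
have -> : (\int[distribution P dg]_z F z =
    \int[distribution P id1 \x distribution P id2]_z F z)%E.
  by apply: eq_measure_integral => A mA _; exact/esym/diag_product.
rewrite -fubini1// /fubini_F /F /=.
have ib' : (distribution P id2).-integrable setT (fun w => (b w)%:E).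
  by apply: integrable_pushforward => //; exact/measurable_EFinP.
have ia' : (distribution P id1).-integrable setT (fun w => (a w)%:E).
  by apply: integrable_pushforward => //; exact/measurable_EFinP.
have Eb : (\int[P]_w (b w)%:E = \int[distribution P id2]_w (b w)%:E)%E.
  by rewrite integral_pushforward//; exact/measurable_EFinP.
have Ea : (\int[P]_w (a w)%:E = \int[distribution P id1]_w (a w)%:E)%E.
  by rewrite integral_pushforward//; exact/measurable_EFinP.
rewrite Ea Eb.
under eq_integral do (under eq_integral do rewrite EFinM; rewrite integralZl//).
have fb : (\int[distribution P id2]_w (b w)%:E)%E \is a fin_num.
  exact: integrable_fin_num.
rewrite -(fineK fb) integralZr//.
Qed.

End Pair.

End Conditioning.

(** * Measurability of matrix expressions *)

Section ComplexMeasurable.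
Context (d : measure_display) (T : measurableType d) (R : realType).
Implicit Types f g : T -> R[i].

Definition cmeasurable f : Prop :=
  measurable_fun [set: T] (fun w => ReC (f w)) /\
  measurable_fun [set: T] (fun w => ImC (f w)).

Lemma complex_rvP f : complex_rv f -> cmeasurable f.
Proof.
move=> mf; split.
  exact: (measurableT_comp measurable_fst mf).
exact: (measurableT_comp measurable_snd mf).
Qed.

Lemma cmeasurable_cst (c : R[i]) : cmeasurable (fun=> c).
Proof. by split; exact: measurable_cst. Qed.

Lemma cmeasurableD f g : cmeasurable f -> cmeasurable g ->
  cmeasurable (fun w => f w + g w).
Proof.
move=> [f1 f2] [g1 g2]; split.
  by rewrite (_ : (fun w => _) = (fun w => ReC (f w) + ReC (g w)));
    [exact: measurable_funD | apply/funext => w; rewrite ReD].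
by rewrite (_ : (fun w => _) = (fun w => ImC (f w) + ImC (g w)));
  [exact: measurable_funD | apply/funext => w; rewrite ImD].
Qed.

Lemma cmeasurableM f g : cmeasurable f -> cmeasurable g ->
  cmeasurable (fun w => f w * g w).
Proof.
move=> [f1 f2] [g1 g2]; split.
  rewrite (_ : (fun w => _) = (fun w => ReC (f w) * ReC (g w) - ImC (f w) * ImC (g w))).
    by apply: measurable_funB; exact: measurable_funM.
  by apply/funext => w; rewrite ReC_M.
rewrite (_ : (fun w => _) = (fun w => ReC (f w) * ImC (g w) + ImC (f w) * ReC (g w))).
  by apply: measurable_funD; exact: measurable_funM.
by apply/funext => w; rewrite ImC_M.
Qed.

Lemma cmeasurable_conj f : cmeasurable f -> cmeasurable (fun w => Num.conj (f w)).
Proof.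
move=> [f1 f2]; split; first by under eq_fun do rewrite ReC_conj.
by under eq_fun do rewrite ImC_conj; exact: measurable_funN.
Qed.

Lemma measurable_normc_sqr f : cmeasurable f ->
  measurable_fun [set: T] (fun w => normc (f w) ^+ 2).
Proof.
move=> [f1 f2]; under eq_fun do rewrite normc_sqr.
by apply: measurable_funD; exact: measurable_funX.
Qed.

Lemma measurable_invr (f : T -> R) : measurable_fun [set: T] f ->
  measurable_fun [set: T] (fun w => (f w)^-1).
Proof.
move=> mf; apply: (measurableT_comp _ mf).
have -> : [set: R] = [set 0] `|` ~` [set 0] by rewrite setUv.
apply/measurable_funU => //; first exact: measurableC.
split; first exact: measurable_fun_set1.
apply: open_continuous_measurable_fun.
  exact/closed_openC/closed_eq.
move=> x; rewrite inE /= => /eqP x0; exact: inv_continuous.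
Qed.

Lemma cmeasurableV f : cmeasurable f -> cmeasurable (fun w => (f w)^-1).
Proof.
move=> mf; have mn := measurable_invr (measurable_normc_sqr mf).
case: mf => f1 f2; split.
  by under eq_fun do rewrite Re_inv; exact: measurable_funM.
under eq_fun do rewrite Im_inv; apply: measurable_funM => //.
exact: measurable_funN.
Qed.

Lemma cmeasurable_sum (I : Type) (s : seq I) (F : I -> T -> R[i]) :
  (forall i, cmeasurable (F i)) -> cmeasurable (fun w => \sum_(i <- s) F i w).
Proof.
move=> mF; elim: s => [|i s IH].
  by under eq_fun do rewrite big_nil; exact: cmeasurable_cst.
by under eq_fun do rewrite big_cons; exact: cmeasurableD.
Qed.

Lemma cmeasurable_prod (I : Type) (s : seq I) (F : I -> T -> R[i]) :
  (forall i, cmeasurable (F i)) -> cmeasurable (fun w => \prod_(i <- s) F i w).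
Proof.
move=> mF; elim: s => [|i s IH].
  by under eq_fun do rewrite big_nil; exact: cmeasurable_cst.
by under eq_fun do rewrite big_cons; exact: cmeasurableM.
Qed.

Definition mx_measurable m n (A : T -> 'M[R[i]]_(m, n)) : Prop :=
  forall i j, cmeasurable (fun w => A w i j).

Lemma mx_measurableM m n p (A : T -> 'M[R[i]]_(m, n)) (B : T -> 'M[R[i]]_(n, p)) :
  mx_measurable A -> mx_measurable B -> mx_measurable (fun w => A w *m B w).
Proof.
move=> mA mB i j; under eq_fun do rewrite mxE.
by apply: cmeasurable_sum => k; exact: cmeasurableM.
Qed.

Lemma mx_measurable_adj m n (A : T -> 'M[R[i]]_(m, n)) :
  mx_measurable A -> mx_measurable (fun w => (A w)^t*).
Proof.
by move=> mA i j; under eq_fun do rewrite !mxE; exact: cmeasurable_conj.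
Qed.

Lemma cmeasurable_det n (A : T -> 'M[R[i]]_n) :
  mx_measurable A -> cmeasurable (fun w => \det (A w)).
Proof.
move=> mA; apply: cmeasurable_sum => s; apply: cmeasurableM; first exact: cmeasurable_cst.
exact: cmeasurable_prod.
Qed.

(** The entries of the inverse are cofactors over the determinant. *)
Lemma mx_measurable_invmx n (A : T -> 'M[R[i]]_n) :
  (forall w, A w \in unitmx) -> mx_measurable A -> mx_measurable (fun w => invmx (A w)).
Proof.
move=> uA mA i j; under eq_fun do rewrite /invmx uA !mxE /cofactor.
apply: cmeasurableM; first by apply: cmeasurableV; exact: cmeasurable_det.
apply: cmeasurableM; first exact: cmeasurable_cst.
apply: cmeasurable_det => k l; under eq_fun do rewrite !mxE.
exact: mA.
Qed.

Lemma cmeasurable_trace n (A : T -> 'M[R[i]]_n) :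
  mx_measurable A -> cmeasurable (fun w => \tr (A w)).
Proof. by move=> mA; exact: cmeasurable_sum. Qed.

Lemma cmeasurable_qform n (Q : T -> 'M[R[i]]_n) (v : T -> 'rV[R[i]]_n) :
  mx_measurable Q -> mx_measurable v -> cmeasurable (fun w => qform (Q w) (v w)).
Proof.
move=> mQ mv; apply: mx_measurableM; last exact: mx_measurable_adj.
exact: mx_measurableM.
Qed.

Lemma measurable_specform n (A : 'M[R[i]]_n) (phi : R -> R) (v : T -> 'rV[R[i]]_n) :
  mx_measurable v -> measurable_fun [set: T] (fun w => specform A phi (v w)).
Proof.
move=> mv; apply: measurable_sum => j; apply: measurable_funM; first exact: measurable_cst.
apply: measurable_normc_sqr; by apply: mx_measurableM => // k l; exact: cmeasurable_cst.
Qed.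

End ComplexMeasurable.

(** * Concentration of spectral seminorms *)

Section EuclideanNorms.
Variable R : realType.

Lemma sum_cauchy (I : finType) (a b : I -> R) :
  (forall i, 0 <= a i) -> (forall i, 0 <= b i) ->
  \sum_i a i * b i <= Num.sqrt (\sum_i a i ^+ 2) * Num.sqrt (\sum_i b i ^+ 2).
Proof.
move=> a0 b0; set A := Num.sqrt _; set B := Num.sqrt _.
have sA : A ^+ 2 = \sum_i a i ^+ 2 by rewrite sqr_sqrtr// sumr_ge0// => i _; exact: sqr_ge0.
have sB : B ^+ 2 = \sum_i b i ^+ 2 by rewrite sqr_sqrtr// sumr_ge0// => i _; exact: sqr_ge0.
have A0 : 0 <= A by exact: sqrtr_ge0.
have B0 : 0 <= B by exact: sqrtr_ge0.
have zero (c : I -> R) : \sum_i c i ^+ 2 = 0 -> forall i, c i = 0.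
  move=> /eqP; rewrite psumr_eq0 => [/allP h i|i _]; last exact: sqr_ge0.
  by have := h i; rewrite mem_index_enum sqrf_eq0 => /(_ isT) /eqP.
have [A00|A1] := eqVneq A 0.
  rewrite A00 mul0r big1// => i _; rewrite (zero a) ?mul0r//.
  by rewrite -sA A00 expr0n.
have [B00|B1] := eqVneq B 0.
  rewrite B00 mulr0 big1// => i _; rewrite (zero b) ?mulr0//.
  by rewrite -sB B00 expr0n.
have Ap : 0 < A by rewrite lt_neqAle eq_sym A1.
have Bp : 0 < B by rewrite lt_neqAle eq_sym B1.
apply: (@le_trans _ _ (\sum_i (B / A / 2 * a i ^+ 2 + A / B / 2 * b i ^+ 2))).
  apply: ler_sum => i _; rewrite -subr_ge0.
  have -> : B / A / 2 * a i ^+ 2 + A / B / 2 * b i ^+ 2 - a i * b i =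
    (2 * A * B)^-1 * (B * a i - A * b i) ^+ 2 by field; rewrite A1 B1.
  by rewrite mulr_ge0 ?sqr_ge0// invr_ge0 !mulr_ge0.
rewrite big_split /= -!mulr_sumr -sA -sB.
by rewrite le_eqVlt; apply/orP; left; apply/eqP; field; rewrite A1 B1.
Qed.

Lemma sum_minkowski (I : finType) (a b c : I -> R) :
  (forall i, 0 <= a i) -> (forall i, 0 <= b i) -> (forall i, 0 <= c i <= a i + b i) ->
  Num.sqrt (\sum_i c i ^+ 2) <=
  Num.sqrt (\sum_i a i ^+ 2) + Num.sqrt (\sum_i b i ^+ 2).
Proof.
move=> a0 b0 cab; have s0 (u : I -> R) : 0 <= \sum_i u i ^+ 2.
  by apply: sumr_ge0 => i _; exact: sqr_ge0.
rewrite -(ler_pXn2r (n := 2)) ?nnegrE ?addr_ge0 ?sqrtr_ge0// sqrrD !sqr_sqrtr//.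
have := sum_cauchy a0 b0; set AB := _ * _ => hAB.
apply: (@le_trans _ _ (\sum_i (a i ^+ 2 + 2 * (a i * b i) + b i ^+ 2))).
  apply: ler_sum => i _; rewrite mulr_natl -sqrrD; have /andP[c0 ci] := cab i.
  by rewrite ler_pXn2r ?nnegrE ?addr_ge0.
by rewrite !big_split /= lerD2r lerD2l -mulr_sumr -[AB *+ 2]mulr_natl ler_pM2l.
Qed.

Section SpecNorm.
Variables (m : nat) (A : 'M[R[i]]_m) (phi : R -> R).
Hypothesis phi01 : forall l, 0 <= phi l <= 1.
Implicit Types (x y : 'rV[R[i]]_m).

(** The Euclidean norm of sqrt (phi(A)) x: a seminorm, below the Euclidean norm because
[phi] is at most 1. *)
Definition specnorm x : R := Num.sqrt (specform A phi x).

Let coef x j := Num.sqrt (phi (eigv A j)) * normc ((x *m (spectralmx A)^t*) ord0 j).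

Let phi0 l : 0 <= phi l. Proof. by have /andP[] := phi01 l. Qed.

Let specnormE x : specnorm x = Num.sqrt (\sum_j coef x j ^+ 2).
Proof.
by congr Num.sqrt; apply: eq_bigr => j _; rewrite exprMn sqr_sqrtr.
Qed.

Let coef_ge0 x j : 0 <= coef x j.
Proof. by rewrite mulr_ge0 ?sqrtr_ge0 ?normc_ge0. Qed.

Lemma specnormD x y : specnorm (x + y) <= specnorm x + specnorm y.
Proof.
rewrite !specnormE; apply: sum_minkowski => [i|i|i]; rewrite ?coef_ge0//=.
rewrite /coef -mulrDr ler_wpM2l ?sqrtr_ge0// mulmxDl mxE.
exact: le_normcD.
Qed.

Lemma specnormZ (t : R) x : 0 <= t -> specnorm (real_complex R t *: x) = t * specnorm x.
Proof.
move=> t0; rewrite /specnorm specform_scale.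
by rewrite sqrtrM ?sqr_ge0// sqrtr_sqr ger0_norm.
Qed.

Lemma specnorm_le x : specnorm x <= enorm x.
Proof.
have e0 : 0 <= enorm x by exact: sqrtr_ge0.
rewrite /specnorm -[leRHS](ger0_norm e0) -sqrtr_sqr ler_wsqrtr// -(sum_sweight A).
apply: ler_sum => j _; have /andP[_ h] := phi01 (eigv A j).
by rewrite ler_piMl ?sweight_ge0.
Qed.

Lemma specnorm_convex : real_convex specnorm.
Proof.
move=> x y t /andP[t0 t1]; apply: (le_trans (specnormD _ _)).
by rewrite !specnormZ ?subr_ge0.
Qed.

Lemma specnorm_lipschitz : lipschitz1 specnorm.
Proof.
have half x y : specnorm x - specnorm y <= enorm (x - y).
  rewrite lerBlDr; apply: (@le_trans _ _ (specnorm (x - y) + specnorm y)).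
    by rewrite -{1}(subrK y x); exact: specnormD.
  by rewrite lerD2r specnorm_le.
move=> x y; rewrite ler_norml half andbT -lerN2 opprK opprB.
suff -> : enorm (x - y) = enorm (y - x) by [].
by congr Num.sqrt; apply: eq_bigr => j _; rewrite !mxE normcB.
Qed.

End SpecNorm.
End EuclideanNorms.

Section MedianMoment.
Context (d : measure_display) (T : measurableType d) (R : realType).
Variables (P : probability T R) (C0 C0' K : R).
Hypotheses (hC0 : 0 < C0) (hC0' : 0 < C0') (hK : 0 < K).

(** The second moment is the integral of the tail of the square, and the assumed tail is,
up to a constant, an exponential density. *)
Lemma second_moment_tail (Z : T -> R) : measurable_fun [set: T] Z ->
  (forall t : R, 0 < t ->
     (P [set w | (t <= `|Z w|)%R] <= (C0 * expR (- (C0' * t ^+ 2 / K ^+ 2)))%:E)%E) ->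
  (\int[P]_w (Z w ^+ 2)%:E <= (C0 * K ^+ 2 / C0')%:E)%E.
Proof.
move=> mZ tail.
have mZ2 : measurable_fun [set: T] (fun w => Z w ^+ 2) by exact: measurable_funX.
pose Z2 : {RV P >-> R} := mfun_Sub (mem_set mZ2).
have -> : (\int[P]_w (Z w ^+ 2)%:E = 'E_P[Z2])%E by rewrite unlock.
rewrite ge0_expectation_ccdf; last by move=> w; exact: sqr_ge0.
pose lam := C0' / K ^+ 2.
have K2 : 0 < K ^+ 2 by rewrite exprn_gt0.
have lam0 : 0 < lam by rewrite divr_gt0.
have mc : measurable_fun (`]0, +oo[%classic : set R) (ccdf Z2).
  by apply: measurable_funTS; exact: ccdf_measurable.
rewrite -integral_itv_obnd_cbnd//.
apply: (@le_trans _ _ (\int[lebesgue_measure]_(r in `]0%R, +oo[)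
    ((C0 / lam) * exponential_pdf lam r)%:E)%E).
  apply: ge0_le_integral => //.
  - apply/measurable_EFinP; apply: measurable_funTS; apply: measurable_funM => //.
    exact: measurable_exponential_pdf.
  - move=> r /=; rewrite in_itv /= andbT => r0.
    rewrite exponential_pdfE ?(ltW r0)//.
    have sr : 0 < Num.sqrt r by rewrite sqrtr_gt0.
    have -> : C0 / lam * (lam * expR (- lam * r)) =
        C0 * expR (- (C0' * Num.sqrt r ^+ 2 / K ^+ 2)).
      rewrite sqr_sqrtr ?(ltW r0)// /lam.
      have -> : - (C0' / K ^+ 2) * r = - (C0' * r / K ^+ 2) by ring.
      by field; rewrite !gt_eqF.
    apply: le_trans (tail _ sr); rewrite /ccdf /distribution /pushforward.
    apply: le_measure; rewrite ?inE.
    + by rewrite -[X in measurable X]setTI; exact: (mZ2).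
    + rewrite (_ : [set w | _] = (fun w => `|Z w|) @^-1` `[Num.sqrt r, +oo[).
        rewrite -[X in measurable X]setTI; apply: measurableT_comp => //.
      by apply/seteqP; split=> w /=; rewrite in_itv /= andbT.
    + move=> w /=; rewrite in_itv /= andbT => h.
      by rewrite -sqrtr_sqr ler_wsqrtr// ltW.
apply: (@le_trans _ _ (\int[lebesgue_measure]_r
    ((C0 / lam)%:E * (exponential_pdf lam r)%:E))%E).
  under eq_integral do rewrite EFinM.
  apply: ge0_subset_integral => //.
  - apply: measurable_funeM; apply/measurable_EFinP; exact: measurable_exponential_pdf.
  - move=> r _; rewrite -EFinM lee_fin mulr_ge0 ?exponential_pdf_ge0 ?(ltW lam0)//.
    by rewrite divr_ge0 ?(ltW hC0) ?(ltW lam0).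
rewrite ge0_integralZl//.
- rewrite integral_exponential_pdf// mule1 lee_fin /lam.
  by rewrite le_eqVlt; apply/orP; left; apply/eqP; field; rewrite !gt_eqF.
- by apply/measurable_EFinP; exact: measurable_exponential_pdf.
- by move=> r _; rewrite lee_fin exponential_pdf_ge0 ?(ltW lam0).
- by rewrite lee_fin divr_ge0 ?(ltW hC0) ?(ltW lam0).
Qed.

(** Expanding the second moment about the median brings in the first moment of [Y], which
is replaced by an upper bound linear in the square of [Y]. *)
Lemma median_close (Y : T -> R) (med S V : R) : measurable_fun [set: T] Y ->
  (forall w, 0 <= Y w) -> is_median P Y med -> 0 <= S ->
  (\int[P]_w (Y w ^+ 2)%:E = S%:E)%E ->
  (\int[P]_w ((Y w - med) ^+ 2)%:E <= V%:E)%E ->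
  `|med - Num.sqrt S| <= Num.sqrt V.
Proof.
move=> mY Y0 [hmed _] S0 hS hV.
have med0 : 0 <= med.
  rewrite leNgt; apply/negP => m0; move: hmed.
  rewrite (_ : [set w | _] = set0) ?measure0 ?lee_fin; first by rewrite leNgt invr_gt0 ltr0n.
  by apply/seteqP; split=> // w /= h; have := lt_le_trans (le_lt_trans h m0) (Y0 w); rewrite ltxx.
have mY2 : measurable_fun [set: T] (fun w => Y w ^+ 2) by exact: measurable_funX.
have iY2 : P.-integrable [set: T] (fun w => (Y w ^+ 2)%:E).
  apply/integrableP; split; first exact/measurable_EFinP.
  under eq_integral do rewrite gee0_abs ?lee_fin ?sqr_ge0//.
  by rewrite hS ltry.
(* Uses 2 Y <= Y^2 / c + c; the choice c = sqrt S gives (sqrt S - med)^2 <= V. *)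
have key (c : R) : 0 < c -> (1 - med / c) * S + (med ^+ 2 - med * c) <= V.
  move=> c0; rewrite -lee_fin; apply: le_trans (hV).
  have -> : (((1 - med / c) * S + (med ^+ 2 - med * c))%:E =
     \int[P]_w (((1 - med / c) * Y w ^+ 2)%:E + (med ^+ 2 - med * c)%:E))%E.
    rewrite integralD//=.
    - under [in X in (X + _)%E]eq_integral do rewrite EFinM.
      rewrite integralZl// hS integral_cst//= probability_setT mule1.
      by rewrite EFinD EFinM.
    - by under eq_fun do rewrite EFinM; exact: integrableZl.
    - exact: finite_measure_integrable_cst.
  apply: le_integral => //.
  - apply: integrableD => //; last exact: finite_measure_integrable_cst.
    by under eq_fun do rewrite EFinM; exact: integrableZl.
  - apply/integrableP; split.
      by apply/measurable_EFinP; apply: measurable_funX; exact: measurable_funB.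
    under eq_integral do rewrite gee0_abs ?lee_fin ?sqr_ge0//.
    by apply: (le_lt_trans hV); rewrite ltry.
  - move=> w _; rewrite -EFinD lee_fin -subr_ge0.
    have -> : (Y w - med) ^+ 2 - ((1 - med / c) * Y w ^+ 2 + (med ^+ 2 - med * c)) =
      med / c * (Y w - c) ^+ 2 by field; rewrite gt_eqF.
    by rewrite mulr_ge0 ?sqr_ge0// divr_ge0 ?(ltW c0).
rewrite -(sqrtr_sqr (med - _)) ler_wsqrtr//.
have sS := sqr_sqrtr S0; have := sqrtr_ge0 S; move: sS.
set s := Num.sqrt S => sS s0.
have [s00|s1] := eqVneq s 0.
  rewrite s00 subr0; have S00 : S = 0 by rewrite -sS s00 expr0n.
  rewrite leNgt; apply/negP => h.
  have V0 : 0 <= V by rewrite -lee_fin; apply: le_trans (hV); apply: integral_ge0 => w _; rewrite lee_fin sqr_ge0.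
  have mp : 0 < med.
    rewrite lt_neqAle med0 andbT; apply/eqP => m0; move: h.
    by rewrite -m0 expr0n /= ltNge V0.
  (* For S = 0 the choice c = sqrt S is degenerate; a small positive c already contradicts med^2 > V. *)
  pose c := (med ^+ 2 - V) / (2 * med).
  have c0 : 0 < c by rewrite divr_gt0 ?subr_gt0 ?mulr_gt0.
  have := key c c0; rewrite S00 mulr0 add0r.
  have -> : med * c = (med ^+ 2 - V) / 2 by rewrite /c; field; rewrite gt_eqF.
  by move: h; move: (med ^+ 2) => u; lra.
have sp : 0 < s by rewrite lt_neqAle eq_sym s1.
apply: le_trans (key s sp); rewrite -sS.
by rewrite le_eqVlt; apply/orP; left; apply/eqP; field.
Qed.

End MedianMoment.

(** * Quadratic forms of an isotropic concentrated vector *)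

Section QuadraticForms.
Context (d : measure_display) (T : measurableType d) (R : realType).
Variables (P : probability T R) (m : nat) (X : T -> 'rV[R[i]]_m).

Definition isotropic : Prop := forall j k : 'I_m,
  [/\ P.-integrable [set: T] (fun w => (ReC (X w ord0 j * Num.conj (X w ord0 k)))%:E),
      P.-integrable [set: T] (fun w => (ImC (X w ord0 j * Num.conj (X w ord0 k)))%:E),
      (\int[P]_w (ReC (X w ord0 j * Num.conj (X w ord0 k)))%:E = (j == k)%:R%:E)%E &
      (\int[P]_w (ImC (X w ord0 j * Num.conj (X w ord0 k)))%:E = 0)%E].

Hypothesis isoX : isotropic.

(** The form is linear in the products X_j conj(X_k), whose expectations are those of
the identity matrix. *)
Lemma expectation_specform (A : 'M[R[i]]_m) (phi : R -> R) :
  (\int[P]_w (specform A phi (X w))%:E = (spectr A phi)%:E)%E.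
Proof.
pose Q := spectral_fun A (fun j => real_complex R (phi (eigv A j))).
have E1 v : specform A phi v = ReC (qform Q v).
  rewrite qform_spectral Re_sum; apply: eq_bigr => j _.
  by rewrite Re_realM.
have E2 : spectr A phi = ReC (\tr Q) by rewrite trace_spectral Re_sum.
move: Q E1 E2 => Q E1 E2.
have E3 w : (specform A phi (X w))%:E = (\sum_(k < m) \sum_(j < m)
   ((ReC (Q j k))%:E * (ReC (X w ord0 j * Num.conj (X w ord0 k)))%:E
   + (- ImC (Q j k))%:E * (ImC (X w ord0 j * Num.conj (X w ord0 k)))%:E))%E.
  rewrite E1 /qform mxE Re_sum -sumEFin; apply: eq_bigr => k _.
  rewrite mxE mulr_suml Re_sum -sumEFin; apply: eq_bigr => j _.
  rewrite -!EFinM -EFinD !mxE; congr EFin.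
  by rewrite [X in ReC X]mulrAC [X in ReC X]mulrC [LHS]ReC_M mulNr.
have i1 j k : P.-integrable [set: T] (fun w =>
    ((ReC (Q j k))%:E * (ReC (X w ord0 j * Num.conj (X w ord0 k)))%:E)%E).
  by apply: integrableZl => //; have [] := isoX j k.
have i2 j k : P.-integrable [set: T] (fun w =>
    ((- ImC (Q j k))%:E * (ImC (X w ord0 j * Num.conj (X w ord0 k)))%:E)%E).
  by apply: integrableZl => //; have [] := isoX j k.
under eq_integral do rewrite E3.
rewrite integral_sum//; last first.
  by move=> k; apply: integrable_sum => // j _; exact: integrableD.
rewrite E2 /mxtrace Re_sum -sumEFin; apply: eq_bigr => k _.
rewrite integral_sum//; last by move=> j; exact: integrableD.
rewrite (bigD1 k)//= big1 ?adde0.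
  have [a b e1 e2] := isoX k k.
  by rewrite integralD// !integralZl// e1 e2 eqxx mule0 adde0 mule1.
move=> j jk; have [a b e1 e2] := isoX j k.
by rewrite integralD// !integralZl// e1 e2 (negPf jk) !mule0 adde0.
Qed.

Hypothesis mX : mx_measurable X.

Section Concentrated.
Variables (C0 C0' K : R).
Hypotheses (hC0 : 0 < C0) (hC0' : 0 < C0') (hK : 0 < K).
Hypothesis concX : concentrated P C0 C0' K X.
Local Notation V := (C0 * K ^+ 2 / C0').

(** The tail bound about the median holds because the form is the square of a convex
1-Lipschitz function; integrated, it bounds the second moment about the median by V,
and this places the median within sqrt V of the root of the trace. *)
Lemma quad_conc (A : 'M[R[i]]_m) (phi : R -> R) (t : R) :
  (forall l, 0 <= phi l <= 1) -> 0 < t ->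
  (P [set w | (t + Num.sqrt V <=
      `|Num.sqrt (specform A phi (X w)) - Num.sqrt (spectr A phi)|)%R]
    <= (C0 * expR (- (C0' * t ^+ 2 / K ^+ 2)))%:E)%E.
Proof.
move=> phi01 t0.
have phi0 l : 0 <= phi l by have /andP[] := phi01 l.
have [med hmed tail] := concX (specnorm_convex A phi01) (specnorm_lipschitz A phi01).
have mY : measurable_fun [set: T] (fun w => specnorm A phi (X w)).
  apply: (measurableT_comp (continuous_measurable_fun (@sqrt_continuous R))).
  exact: measurable_specform.
have mZ : measurable_fun [set: T] (fun w => specnorm A phi (X w) - med).
  exact: measurable_funB.
have h2 := second_moment_tail hC0 hC0' hK mZ tail.
have E2 : (\int[P]_w (specnorm A phi (X w) ^+ 2)%:E = (spectr A phi)%:E)%E.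
  rewrite -expectation_specform; apply: eq_integral => w _.
  by rewrite sqr_sqrtr// specform_ge0.
have close := median_close mY (fun w => sqrtr_ge0 _) hmed (spectr_ge0 A phi0) E2 h2.
apply: le_trans (tail _ t0); apply: le_measure; rewrite ?inE.
- rewrite (_ : [set w | _] = (fun w => `|specnorm A phi (X w) - Num.sqrt (spectr A phi)|)
     @^-1` `[t + Num.sqrt V, +oo[).
    rewrite -[X in measurable X]setTI; apply: measurableT_comp => //.
    exact: measurable_funB.
  by apply/seteqP; split=> w /=; rewrite in_itv /= andbT.
- rewrite (_ : [set w | _] = (fun w => `|specnorm A phi (X w) - med|) @^-1` `[t, +oo[).
    by rewrite -[X in measurable X]setTI; apply: measurableT_comp.
  by apply/seteqP; split=> w /=; rewrite in_itv /= andbT.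
- move=> w /= h; have := ler_distD med (specnorm A phi (X w)) (Num.sqrt (spectr A phi)).
  by move: h close; rewrite /specnorm; move: `|_| `|_| `|_| => a b c; lra.
Qed.

Lemma variance_le_moment (Z : T -> R) (med s : R) : measurable_fun [set: T] Z ->
  P.-integrable [set: T] (fun w => (Z w)%:E) -> (\int[P]_w (Z w)%:E = 0)%E ->
  (\int[P]_w (Z w ^+ 2)%:E = s%:E)%E ->
  (\int[P]_w ((Z w - med) ^+ 2)%:E <= V%:E)%E -> s <= V.
Proof.
move=> mZ iZ hZ hs hV; rewrite -lee_fin; apply: le_trans (hV).
have iZ2 : P.-integrable [set: T] (fun w => (Z w ^+ 2)%:E).
  apply/integrableP; split; first by apply/measurable_EFinP; exact: measurable_funX.
  under eq_integral do rewrite gee0_abs ?lee_fin ?sqr_ge0//.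
  by rewrite hs ltry.
have iZm : P.-integrable [set: T] (fun w => ((- 2 * med)%:E * (Z w)%:E)%E).
  exact: integrableZl.
have -> : (s%:E = \int[P]_w ((Z w ^+ 2)%:E + (- 2 * med)%:E * (Z w)%:E))%E.
  by rewrite integralD// integralZl// hZ mule0 adde0 hs.
apply: le_integral => //.
- exact: integrableD.
- apply/integrableP; split.
    by apply/measurable_EFinP; apply: measurable_funX; exact: measurable_funB.
  under eq_integral do rewrite gee0_abs ?lee_fin ?sqr_ge0//.
  by apply: (le_lt_trans hV); rewrite ltry.
- move=> w _; rewrite -EFinM -EFinD lee_fin -subr_ge0.
  have -> : (Z w - med) ^+ 2 - (Z w ^+ 2 + - 2 * med * Z w) = med ^+ 2 by ring.
  exact: sqr_ge0.
Qed.

(** The real and imaginary parts of one coordinate are affine and 1-Lipschitz, so each has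
variance at most V, while the two variances add up to 1. *)
Lemma concentration_lower (j : 'I_m) :
  P.-integrable [set: T] (fun w => (ReC (X w ord0 j))%:E) ->
  P.-integrable [set: T] (fun w => (ImC (X w ord0 j))%:E) ->
  (\int[P]_w (ReC (X w ord0 j))%:E = 0)%E -> (\int[P]_w (ImC (X w ord0 j))%:E = 0)%E ->
  1 <= 2 * V.
Proof.
move=> iRe iIm eRe eIm.
have [mRe mIm] := mX ord0 j.
have coord (u : 'rV[R[i]]_m) : normc (u ord0 j) <= enorm u.
  have e0 : 0 <= enorm u by exact: sqrtr_ge0.
  rewrite -(ler_pXn2r (n := 2)) ?nnegrE ?normc_ge0// sqr_sqrtr.
    by rewrite (bigD1 j)//= lerDl sumr_ge0// => k _; exact: sqr_ge0.
  by apply: sumr_ge0 => k _; exact: sqr_ge0.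
have moment (f : R[i] -> R) (Z := fun w => f (X w ord0 j)) :
    (forall z w, f (z + w) = f z + f w) ->
    (forall a z, f (real_complex R a * z) = a * f z) ->
    (forall z, `|f z| <= normc z) -> measurable_fun [set: T] Z ->
    P.-integrable [set: T] (fun w => (Z w)%:E) -> (\int[P]_w (Z w)%:E = 0)%E ->
    (forall s, (\int[P]_w (Z w ^+ 2)%:E = s%:E)%E -> s <= V) /\
    P.-integrable [set: T] (fun w => (Z w ^+ 2)%:E).
  move=> fD fZ fle mZ iZ eZ.
  have cvx : real_convex (fun u : 'rV[R[i]]_m => f (u ord0 j)).
    by move=> x y t _; rewrite !mxE fD !fZ.
  have lip : lipschitz1 (fun u : 'rV[R[i]]_m => f (u ord0 j)).
    move=> x y; apply: le_trans (coord (x - y)); apply: le_trans (fle _).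
    have fN z : f (- z) = - f z.
      by rewrite -mulN1r -[-1](rmorphN1 (real_complex R)) fZ mulN1r.
    by rewrite !mxE fD fN.
  have [med _ tail] := concX cvx lip.
  have mZm : measurable_fun [set: T] (fun w => Z w - med) by exact: measurable_funB.
  have h2 := second_moment_tail hC0 hC0' hK mZm tail.
  split=> [s hs|]; first exact: (variance_le_moment mZ iZ eZ hs h2).
  have [[i1 i2 e1 e2]] := isoX j j.
  apply: le_integrable i1 => //.
    by apply/measurable_EFinP; exact: measurable_funX.
  move=> w _; rewrite conjCM_normc /= lee_fin.
  rewrite !ger0_norm ?sqr_ge0// -(real_normK (num_real (Z w))).
  by rewrite ler_pXn2r ?nnegrE ?normc_ge0//; exact: fle.
have [mr ir] := moment _ (@ReD R) (@Re_realM R) (@Re_le_normc R) mRe iRe eRe.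
have [mi ii] := moment _ (@ImD R) (@Im_realM R) (@Im_le_normc R) mIm iIm eIm.
have [_ _ e1 _] := isoX j j; rewrite eqxx in e1.
have fr : (\int[P]_w (ReC (X w ord0 j) ^+ 2)%:E)%E \is a fin_num by exact: integrable_fin_num.
have fi : (\int[P]_w (ImC (X w ord0 j) ^+ 2)%:E)%E \is a fin_num by exact: integrable_fin_num.
have := mr _ (esym (fineK fr)); have := mi _ (esym (fineK fi)).
have : fine (\int[P]_w (ReC (X w ord0 j) ^+ 2)%:E)%E +
       fine (\int[P]_w (ImC (X w ord0 j) ^+ 2)%:E)%E = 1.
  apply: EFin_inj; rewrite EFinD !fineK// -integralD// -e1.
  apply: eq_integral => w _; rewrite conjCM_normc /= normc_sqr.
  by rewrite EFinD.
move: (fine _) (fine _) => a b; lra.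
Qed.

End Concentrated.
End QuadraticForms.

(** * The rows of the random matrix *)

Section WeightMeasurability.
Context (d : measure_display) (T : measurableType d) (R : realType) (m : nat).
Variables (A : T -> 'M[R[i]]_m) (v : T -> 'rV[R[i]]_m).
Hypotheses (hA : forall w, A w \is hermsymmx) (mA : mx_measurable A) (mv : mx_measurable v).

Lemma mx_measurable_resolvent (x y : R) : 0 < y ->
  mx_measurable (fun w => resolvent (A w) (Complex x y)).
Proof.
move=> y0; apply: mx_measurable_invmx => [w|]; first exact: resolvent_unit.
move=> i j; under eq_fun do rewrite !mxE.
by apply: cmeasurableD => //; exact: cmeasurable_cst.
Qed.

Lemma measurable_specform_kernel (x y : R) : 0 < y ->
  [/\ measurable_fun [set: T] (fun w => specform (A w) (pk x y) (v w)),
      measurable_fun [set: T] (fun w => specform (A w) (hk x y) (v w)),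
      measurable_fun [set: T] (fun w => spectr (A w) (pk x y)) &
      measurable_fun [set: T] (fun w => spectr (A w) (hk x y))].
Proof.
move=> y0; have mR := mx_measurable_resolvent x y0.
have [q1 q2] := cmeasurable_qform mR mv; have [t1 t2] := cmeasurable_trace mR.
split.
- by under eq_fun do rewrite -(Im_qform_resolvent (hA _) x y0).
- by under eq_fun do rewrite -(Re_qform_resolvent (hA _) x y0).
- by under eq_fun do rewrite -(Im_trace_resolvent (hA _) x y0).
- by under eq_fun do rewrite -(Re_trace_resolvent (hA _) x y0).
Qed.

Lemma measurable_wgt1 (x y : R) : 0 < y ->
  measurable_fun [set: T] (fun w => specform (A w) (wgt1 x y) (v w)) /\
  measurable_fun [set: T] (fun w => spectr (A w) (wgt1 x y)).
Proof.
move=> y0; have [f1 _ t1 _] := measurable_specform_kernel x y0; split.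
  by under eq_fun do rewrite specformZ; exact: measurable_funM.
by under eq_fun do rewrite spectrZ; exact: measurable_funM.
Qed.

Lemma measurable_wgt2 (x y : R) : 0 < y ->
  measurable_fun [set: T] (fun w => specform (A w) (wgt2 x y) (v w)) /\
  measurable_fun [set: T] (fun w => spectr (A w) (wgt2 x y)).
Proof.
move=> y0; have y4 : 0 < 4 * y by rewrite mulr_gt0.
have [f1 f2 t1 t2] := measurable_specform_kernel x y0.
have [_ g2 _ u2] := measurable_specform_kernel x y4.
have [f3 t3] := measurable_wgt1 x y0.
split.
  rewrite (_ : (fun w => _) = fun w => 4^-1 * (y * (specform (A w) (hk x y) (v w)
      - specform (A w) (hk x (4 * y)) (v w)) + 2 * specform (A w) (wgt1 x y) (v w))).
    apply: measurable_funM => //; apply: measurable_funD; apply: measurable_funM => //.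
    exact: measurable_funB.
  by apply/funext => w; rewrite specform_hk_diff; field.
rewrite (_ : (fun w => _) = fun w => 4^-1 * (y * (spectr (A w) (hk x y)
      - spectr (A w) (hk x (4 * y))) + 2 * spectr (A w) (wgt1 x y))).
  apply: measurable_funM => //; apply: measurable_funD; apply: measurable_funM => //.
  exact: measurable_funB.
by apply/funext => w; rewrite spectr_hk_diff; field.
Qed.

Lemma measurable_wgt0 :
  measurable_fun [set: T] (fun w => specform (A w) (fun=> 1) (v w)) /\
  measurable_fun [set: T] (fun w => spectr (A w) (fun=> 1)).
Proof.
split; last by under eq_fun do rewrite /spectr; exact: measurable_cst.
rewrite (_ : (fun w => _) = fun w => \sum_(j < m) normc (v w ord0 j) ^+ 2).
  apply: measurable_sum => j; exact: measurable_normc_sqr.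
apply/funext => w; transitivity (\sum_j sweight (A w) (v w) j).
  by apply: eq_bigr => j _; rewrite mul1r.
rewrite sum_sweight sqr_sqrtr//.
by apply: sumr_ge0 => j _; exact: sqr_ge0.
Qed.

End WeightMeasurability.

(** Eigenvectors are chosen without measurability; forms and traces of [phi] are measurable
for the weights that come from the resolvent, a rational function of the entries. *)
Definition measurable_weight (R : realType) (phi : R -> R) : Prop :=
  forall (d : measure_display) (T : measurableType d) (m : nat)
    (A : T -> 'M[R[i]]_m) (v : T -> 'rV[R[i]]_m),
  (forall w, A w \is hermsymmx) -> mx_measurable A -> mx_measurable v ->
  measurable_fun [set: T] (fun w => specform (A w) phi (v w)) /\
  measurable_fun [set: T] (fun w => spectr (A w) phi).

Section Rows.
Context (d : measure_display) (T : measurableType d) (R : realType).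
Variables (P : probability T R) (m : nat) (M : T -> 'M[R[i]]_m.+1).
Hypothesis hherm : forall w, M w \is hermsymmx.
Hypothesis hmeas : forall i j : 'I_m.+1, complex_rv (fun w => M w i j).
Local Notation U := [set p : 'I_m.+1 * 'I_m.+1 | (p.1 <= p.2)%N]%SET.
Local Notation X := (fun (p : 'I_m.+1 * 'I_m.+1) w => M w p.1 p.2).
Hypothesis hindep : mutually_independent P U X.
Hypothesis hint : forall i j : 'I_m.+1, (i <= j)%N ->
  complex_integrable P (fun w => M w i j).
Hypothesis hmean : forall i j : 'I_m.+1, (i <= j)%N ->
  complex_expectation P (fun w => M w i j) = 0.
Hypothesis hvar : forall i j : 'I_m.+1, (i <= j)%N ->
  complex_variance P (fun w => M w i j) = 1%:E.
Implicit Types i j k : 'I_m.+1.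

Lemma herm_entry w i j : M w i j = Num.conj (M w j i).
Proof. by rewrite -{1}(hermsymmxP (hherm w)) !mxE. Qed.

Lemma entry_cmeasurable i j : cmeasurable (fun w => M w i j).
Proof. exact/complex_rvP/hmeas. Qed.

Let cpt (s : bool) (z : R[i]) : R := if s then ReC z else ImC z.

Lemma entry_mean_le i j (s : bool) : (i <= j)%N ->
  P.-integrable [set: T] (fun w => (cpt s (M w i j))%:E) /\
  (\int[P]_w (cpt s (M w i j))%:E = 0)%E.
Proof.
move=> ij; have [iRe iIm] := hint ij; have := hmean ij.
rewrite /complex_expectation unlock => -[eR eI]; case: s; split=> //.
  by rewrite -[LHS]fineK ?eR// integrable_fin_num.
by rewrite -[LHS]fineK ?eI// integrable_fin_num.
Qed.

Lemma entry_moment i j : (\int[P]_w (normc (M w i j) ^+ 2)%:E = 1)%E.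
Proof.
wlog ij : i j / (i <= j)%N.
  move=> h; have [|/ltnW ji] := leqP i j; first exact: h.
  rewrite -(h _ _ ji); apply: eq_integral => w _.
  by rewrite (herm_entry w j i) normc_conj.
have := hvar ij; rewrite /complex_variance unlock hmean// => <-.
by apply: eq_integral => w _; rewrite subr0.
Qed.

Lemma entry_moment_integrable i j :
  P.-integrable [set: T] (fun w => (normc (M w i j) ^+ 2)%:E).
Proof.
apply/integrableP; split.
  by apply/measurable_EFinP; apply: measurable_normc_sqr; exact: entry_cmeasurable.
under eq_integral do rewrite gee0_abs ?lee_fin ?sqr_ge0//.
by rewrite entry_moment ltry.
Qed.

(** The position on or above the diagonal whose variable determines the entry (i, j). *)
Definition upper i j : 'I_m.+1 * 'I_m.+1 := if (i <= j)%N then (i, j) else (j, i).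

Lemma upper_in i j : upper i j \in U.
Proof.
rewrite inE /upper; case: ifP => //= /negbT; rewrite -ltnNge; exact: ltnW.
Qed.

Lemma cpt_upper i j s : exists e : R, e \in [:: 1; -1] /\
  forall w, cpt s (M w i j) = e * cpt s (X (upper i j) w).
Proof.
rewrite /upper; case: leqP => ij /=.
  by exists 1; split; [rewrite inE eqxx | move=> w; rewrite mul1r].
exists (if s then 1 else -1); split; first by case: s; rewrite !inE eqxx ?orbT.
by move=> w; rewrite (herm_entry w i j); case: s; rewrite /cpt ?ReC_conj ?ImC_conj ?mul1r ?mulN1r.
Qed.

Lemma cpt_integrable i j s :
  P.-integrable [set: T] (fun w => (cpt s (M w i j))%:E) /\
  (\int[P]_w (cpt s (M w i j))%:E = 0)%E.
Proof.
have [e [_ E]] := cpt_upper i j s.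
have [i1 e1] : P.-integrable [set: T] (fun w => (cpt s (X (upper i j) w))%:E) /\
  (\int[P]_w (cpt s (X (upper i j) w))%:E = 0)%E.
  by apply: entry_mean_le; have := upper_in i j; rewrite inE.
under eq_fun do rewrite E EFinM; split; first exact: integrableZl.
by rewrite integralZl// e1 mule0.
Qed.

Lemma measurable_cpt (f : T -> R[i]) s : cmeasurable f -> measurable_fun [set: T] (fun w => cpt s (f w)).
Proof. by case: s => -[]. Qed.

Lemma cpt_mul_integrable i j i' j' s s' :
  P.-integrable [set: T] (fun w => (cpt s (M w i j) * cpt s' (M w i' j'))%:E).
Proof.
have := integrableD measurableT (entry_moment_integrable i j) (entry_moment_integrable i' j').
apply: le_integrable => //.
  apply/measurable_EFinP; apply: measurable_funM; apply: measurable_cpt;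
  exact: entry_cmeasurable.
move=> w _ /=; rewrite lee_fin normrM.
have cl (b : bool) z : `|cpt b z| <= normc z by case: b; [exact: Re_le_normc|exact: Im_le_normc].
rewrite [leRHS]ger0_norm ?addr_ge0 ?sqr_ge0//.
apply: (le_trans (ler_pM (normr_ge0 _) (normr_ge0 _) (cl s _) (cl s' _))).
move: (normc_ge0 (M w i j)) (normc_ge0 (M w i' j')).
move: (normc _) (normc _) => a b a0 b0; have := sqr_ge0 (a - b); have := mulr_ge0 a0 b0.
rewrite !expr2; lra.
Qed.

Lemma cpt_indep i j i' j' s s' : upper i j != upper i' j' ->
  (\int[P]_w (cpt s (M w i j) * cpt s' (M w i' j'))%:E = 0)%E.
Proof.
move=> ne; set p := upper i j in ne *; set q := upper i' j' in ne *.
have [e [ee E]] := cpt_upper i j s; have [e' [_ E']] := cpt_upper i' j' s'.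
have pair0 : (\int[P]_w (cpt s (X p w) * cpt s' (X q w))%:E = 0)%E.
  have dis r : r \in finset.set1 p -> r \notin finset.set1 q.
    by rewrite !inE => /eqP ->.
  have sp : finset.set1 p \subset U by rewrite finset.sub1set upper_in.
  have sq : finset.set1 q \subset U by rewrite finset.sub1set upper_in.
  have mX r : complex_rv (X r) by exact: hmeas.
  have msub (r : 'I_m.+1 * 'I_m.+1) (b : bool) : measurable_fun
      [set: g_sigma_algebraType (cylinder X (finset.set1 r))] (fun w => cpt b (X r w)).
    have := @entry_sub_measurable _ _ _ _ X (finset.set1 r) r.
    rewrite inE eqxx => /(_ isT) mr; case: b.
      exact: (measurableT_comp measurable_fst mr).
    exact: (measurableT_comp measurable_snd mr).
  have [ip e1] := @cpt_integrable p.1 p.2 s.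
  have [iq _] := @cpt_integrable q.1 q.2 s'.
  have ipq := cpt_mul_integrable p.1 p.2 q.1 q.2 s s'.
  rewrite (integral_indep_mul mX hindep dis sp sq (msub p s) (msub q s') ip iq ipq).
  by rewrite e1 mul0e.
have ipq := cpt_mul_integrable p.1 p.2 q.1 q.2 s s'.
under eq_integral do rewrite E E' mulrACA EFinM.
by rewrite integralZl// pair0 mule0.
Qed.

Lemma upper_inj i : injective (upper i).
Proof.
move=> j k; rewrite /upper; case: leqP => ij; case: leqP => ik [] //.
- by move=> -> ->.
- by move=> -> ->.
Qed.

(** Distinct entries of a row sit at distinct positions on or above the diagonal, so their
products have mean zero; the diagonal terms are the unit variances. *)
Lemma row_isotropic i : isotropic P (fun w => minor_row (M w) i).
Proof.
move=> j k.
have E w l : minor_row (M w) i ord0 l = M w i (lift i l) by rewrite !mxE.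
have Ere w : ReC (minor_row (M w) i ord0 j * Num.conj (minor_row (M w) i ord0 k)) =
  cpt true (M w i (lift i j)) * cpt true (M w i (lift i k)) +
  cpt false (M w i (lift i j)) * cpt false (M w i (lift i k)).
  by rewrite !E ReC_M ReC_conj ImC_conj mulrN opprK.
have Eim w : ImC (minor_row (M w) i ord0 j * Num.conj (minor_row (M w) i ord0 k)) =
  cpt false (M w i (lift i j)) * cpt true (M w i (lift i k)) -
  cpt true (M w i (lift i j)) * cpt false (M w i (lift i k)).
  by rewrite !E ImC_M ReC_conj ImC_conj mulrN addrC.
have ii s s' := cpt_mul_integrable i (lift i j) i (lift i k) s s'.
split.
- by under eq_fun do rewrite Ere EFinD; exact: integrableD.
- by under eq_fun do rewrite Eim EFinB; exact: integrableB.
- have [<-|jk] := eqVneq j k.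
    rewrite -(entry_moment i (lift i j)); apply: eq_integral => w _.
    by rewrite conjCM_normc /= E.
  under eq_integral do rewrite Ere EFinD.
  have ne : upper i (lift i j) != upper i (lift i k).
    by rewrite (inj_eq (@upper_inj i)) (inj_eq lift_inj).
  by rewrite integralD// !cpt_indep// adde0.
- have [<-|jk] := eqVneq j k.
    by rewrite integral0_eq// => w _; rewrite conjCM_normc.
  under eq_integral do rewrite Eim EFinB.
  have ne : upper i (lift i j) != upper i (lift i k).
    by rewrite (inj_eq (@upper_inj i)) (inj_eq lift_inj).
  by rewrite integralB// !cpt_indep// sube0.
Qed.

Lemma minor_row_measurable i : mx_measurable (fun w => minor_row (M w) i).
Proof. by move=> j k; under eq_fun do rewrite !mxE; exact: entry_cmeasurable. Qed.

Section RowEvent.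
Variables (C0 C0' K : R).
Hypotheses (hC0 : 0 < C0) (hC0' : 0 < C0') (hK : 0 < K).
Hypothesis hconc : forall i, concentrated P C0 C0' K (fun w => col' i (row i (M w))).
Local Notation V := (C0 * K ^+ 2 / C0').

Lemma concentration_lower_bound : (0 < m)%N -> 1 <= 2 * V.
Proof.
move=> m0; have j : 'I_m by exact: (Ordinal m0).
have E w : minor_row (M w) ord0 ord0 j = M w ord0 (lift ord0 j) by rewrite !mxE.
have [i1 e1] := cpt_integrable ord0 (lift ord0 j) true.
have [i2 e2] := cpt_integrable ord0 (lift ord0 j) false.
apply: (concentration_lower (row_isotropic ord0) (minor_row_measurable ord0)
  hC0 hC0' hK (hconc ord0) (j := j)).
- by under eq_fun do rewrite E.
- by under eq_fun do rewrite E.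
- by under eq_integral do rewrite E.
- by under eq_integral do rewrite E.
Qed.

(** The failure of concentration; the row is not normalized here, so [tau] is of order K sqrt(log n). *)
Definition row_bad i (phi : R -> R) (tau : R) : set T :=
  [set w | tau <= `|Num.sqrt (specform (minor (normalized (M w)) i) phi (minor_row (M w) i))
                    - Num.sqrt (spectr (minor (normalized (M w)) i) phi)|].

Lemma normalized_herm w : normalized (M w) \is hermsymmx.
Proof.
apply/is_hermitianmxP; rewrite expr0 scale1r; apply/matrixP => j k.
rewrite !mxE rmorphM /= (herm_entry w j k); congr (_ * _).
by apply: complex_ext; rewrite ?ReC_conj ?ImC_conj//= oppr0.
Qed.

(** The minor depends on the entries off the row and column i, the row on the others;
freezing the former reduces the event to a fixed Hermitian matrix. *)
Lemma row_bad_prob i (phi : R -> R) (t : R) : measurable_weight phi ->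
  (forall l, 0 <= phi l <= 1) -> 0 < t ->
  measurable (row_bad i phi (t + Num.sqrt V)) /\
  (P (row_bad i phi (t + Num.sqrt V)) <=
     (C0 * expR (- (C0' * t ^+ 2 / K ^+ 2)))%:E)%E.
Proof.
move=> mphi phi01 t0; set tau := t + Num.sqrt V.
pose D1 : {set 'I_m.+1 * 'I_m.+1} := [set p : 'I_m.+1 * 'I_m.+1 | [&& (p.1 <= p.2)%N, p.1 != i & p.2 != i]]%SET.
pose D2 : {set 'I_m.+1 * 'I_m.+1} := [set p : 'I_m.+1 * 'I_m.+1 | (p.1 <= p.2)%N && ((p.1 == i) || (p.2 == i))]%SET.
have dis r : r \in D1 -> r \notin D2.
  by rewrite !inE => /and3P[-> /negPf -> /negPf ->].
have s1 : D1 \subset U by apply/fintype.subsetP => p; rewrite !inE => /and3P[].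
have s2 : D2 \subset U by apply/fintype.subsetP => p; rewrite !inE => /andP[].
have mX r : complex_rv (X r) by exact: hmeas.
have msub (D : {set 'I_m.+1 * 'I_m.+1}) j k : upper j k \in D ->
    cmeasurable (fun w : g_sigma_algebraType (cylinder X D) => M w j k).
  move=> jkD; have /complex_rvP := @entry_sub_measurable _ _ _ _ X D _ jkD.
  rewrite /upper; case: leqP => jk //= mc.
  have [c1 c2] := cmeasurable_conj mc; split.
    by apply: eq_measurable_fun c1 => w _; rewrite -herm_entry.
  by apply: eq_measurable_fun c2 => w _; rewrite -herm_entry.
pose T1 := g_sigma_algebraType (cylinder X D1); pose T2 := g_sigma_algebraType (cylinder X D2).
pose A (z : T1 * T2) := minor (normalized (M z.1)) i.
pose v (z : T1 * T2) := minor_row (M z.2) i.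
have hA z : A z \is hermsymmx by exact/minor_herm/normalized_herm.
have cfst (f : T1 -> R[i]) : cmeasurable f -> cmeasurable (fun z : T1 * T2 => f z.1).
  by move=> [f1 f2]; split; [exact: (measurableT_comp f1 measurable_fst) | exact: (measurableT_comp f2 measurable_fst)].
have csnd (f : T2 -> R[i]) : cmeasurable f -> cmeasurable (fun z : T1 * T2 => f z.2).
  by move=> [f1 f2]; split; [exact: (measurableT_comp f1 measurable_snd) | exact: (measurableT_comp f2 measurable_snd)].
have mA : mx_measurable A.
  move=> j k; rewrite (_ : (fun z => A z j k) = fun z : T1 * T2 =>
    real_complex R (Num.sqrt m.+1%:R)^-1 * M z.1 (lift i j) (lift i k)); last first.
    by apply/funext => z; rewrite !mxE.
  apply: cmeasurableM; first exact: cmeasurable_cst.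
  apply: (cfst (fun w => M w (lift i j) (lift i k))); apply: msub.
  have := upper_in (lift i j) (lift i k); rewrite !inE => ->.
  by rewrite /upper; case: leqP => _ /=; rewrite ![lift i _ == i]eq_sym !neq_lift.
have mv : mx_measurable v.
  move=> j k; rewrite (_ : (fun z => v z j k) = fun z : T1 * T2 => M z.2 i (lift i k)); last first.
    by apply/funext => z; rewrite !mxE.
  apply: (csnd (fun w => M w i (lift i k))); apply: msub.
  have := upper_in i (lift i k); rewrite !inE => ->.
  by rewrite /upper; case: leqP => _ /=; rewrite eqxx ?orbT.
have [m1 m2] := mphi _ _ _ A v hA mA mv.
pose S : set (T1 * T2) := [set z | tau <= `|Num.sqrt (specform (A z) phi (v z))
  - Num.sqrt (spectr (A z) phi)|].
have mS : measurable S.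
  rewrite (_ : S = (fun z => `|Num.sqrt (specform (A z) phi (v z))
     - Num.sqrt (spectr (A z) phi)|) @^-1` `[tau, +oo[); last first.
    by apply/seteqP; split=> w /=; rewrite in_itv /= andbT.
  rewrite -[X in measurable X]setTI; apply: measurableT_comp => //.
  by apply: measurable_funB;
    apply: (measurableT_comp (continuous_measurable_fun (@sqrt_continuous R))).
have -> : row_bad i phi tau = [set w | S (w, w)] by [].
split.
  have -> : [set w | S (w, w)] = (diag X D1 D2) @^-1` S by [].
  rewrite -[X in measurable X]setTI.
  have mdg := @measurable_diag _ T R _ X mX D1 D2.
  exact: (mdg measurableT S mS).
apply: (conditioning mX hindep dis s1 s2 mS) => w.
have q := quad_conc (row_isotropic i) (minor_row_measurable i) hC0 hC0' hK (hconc i)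
  (minor (normalized (M w)) i) phi01 t0.
exact: q.
Qed.

End RowEvent.
End Rows.

(** * The law on a deterministic event *)

Section DeterministicLaw.
Variable R : realType.

Lemma atan_near_pi2 (be : R) : 0 < be -> exists l0 : nat,
  8 / 4 ^+ l0 <= be /\ pi * (1 - be) <= 2 * atan (4 ^+ l0).
Proof.
move=> b0; have p0 : 0 < pi :> R by exact: pi_gt0.
have e0 : 0 < pi * be / 2 by rewrite divr_gt0 ?mulr_gt0.
have pw (l : nat) : l%:R <= (4 : R) ^+ l.
  by rewrite -natrX ler_nat ltnW// ltn_expl.
have /cvgrPdist_le/(_ _ e0) := @cvgy_atan R.
move=> [A [_ hA]]; pose l0 := (Num.truncn (Num.max A (8 / be))).+1.
have /andP[_ h] : (Num.truncn (Num.max A (8 / be)))%:R <= Num.max A (8 / be) < l0%:R.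
  by apply: truncn_itv; rewrite le_max divr_ge0 ?orbT// ltW.
have hl : Num.max A (8 / be) < 4 ^+ l0 by exact: lt_le_trans (pw _).
move: hl; rewrite gt_max => /andP[h1 h2]; exists l0; split.
  by rewrite ler_pdivrMr ?exprn_gt0// mulrC -ler_pdivrMr// ltW.
have := hA _ h1; have := atan_ltpi2 ((4 : R) ^+ l0).
move: (atan _) => a ha; rewrite ger0_norm ?subr_ge0 ?(ltW ha)//; lra.
Qed.

Lemma bulk_lower (x ep : R) : 0 < ep -> ep <= 1 -> `|x| <= 2 - ep ->
  ep / 2 <= 1 - x ^+ 2 / 4.
Proof.
move=> e0 e1 hx; have : x ^+ 2 <= (2 - ep) ^+ 2.
  rewrite -[leLHS]real_normK ?num_real// ler_pXn2r ?nnegrE//; lra.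
rewrite !expr2; have : ep * ep <= ep by rewrite ger_pMr.
lra.
Qed.

(** The constants depend only on the bulk parameter and the precision.  Given
concentration at all scales and grid points, the local law holds at every grid point in
the bulk, and the two counting bounds apply to every interval longer than Bc eta at
once, since the grid is common to all intervals. *)
Lemma lscl_deterministic (eps delta : R) : 0 < eps -> 0 < delta ->
  exists (kap om al Bc : R) (l0 : nat),
  [/\ 0 < kap, 0 < om, 0 < al & 0 < Bc] /\
  forall (m : nat) (W : 'M[R[i]]_m.+1) (eta : R) (L : nat), W \is hermsymmx ->
  0 < eta -> eta <= om -> (m.+1%:R * eta)^-1 <= kap ^+ 2 ->
  (eta * 4 ^+ L)^-1 <= kap -> (l0 <= L)%N ->
  (forall i k l, (l <= L)%N -> `|gridpt (al * eta) k| <= 2 ->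
     row_conc W i (wgt1 (gridpt (al * eta) k) (eta * 4 ^+ l)) (kap * Num.sqrt eta) /\
     row_conc W i (wgt2 (gridpt (al * eta) k) (eta * 4 ^+ l)) (kap * Num.sqrt eta)) ->
  (forall i, row_conc W i (fun=> 1) (kap * Num.sqrt eta)) ->
  #|[pred i | kap < normc (W i i)]|%:R <= kap * (m.+1%:R * eta) ->
  forall I : interval R, [set` I] `<=` `](-2 + eps), (2 - eps)[%classic ->
    Bc * eta <= itv_length I ->
    `|(eig_count W I)%:R - m.+1%:R * Rintegral lebesgue_measure [set` I] (@rho_sc R)|
      <= delta * m.+1%:R * itv_length I.
Proof.
move=> eps0 delta0.
(* be is at once the precision of the local law, the grid spacing over eta and the relative error at the ends. *)
pose be := Num.min (delta / 16) (1 / 6).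
have be0 : 0 < be by rewrite lt_min !divr_gt0.
have be6 : be <= 1 / 6 by rewrite ge_min lexx orbT.
have bed : 16 * be <= delta.
  have : be <= delta / 16 by rewrite ge_min lexx.
  by rewrite ler_pdivlMr// mulrC.
have be1 : be <= 1 by lra.
have [l0 [hL8 hLat]] := atan_near_pi2 be0.
set Lc : R := 4 ^+ l0 in hL8 hLat.
have Lc1 : 1 <= Lc by rewrite exprn_ege1// ler1n.
pose ep := Num.min eps 1 / 2.
have ep0 : 0 < ep by rewrite divr_gt0// lt_min eps0 ltr01.
have epe : 2 * ep <= eps.
  by rewrite mulrC divfK// ge_min lexx.
have ep1 : ep <= 1 / 2 by rewrite ler_pM2r// ge_min lexx orbT.
have ep1' : ep <= 1 by move: ep1; clear; lra.
pose c := ep / 2.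
have c0 : 0 < c by rewrite divr_gt0.
have c1 : c <= 1 by rewrite /c; lra.
(* om0 is the precision needed in the quadratic equation, kap the concentration error that achieves it. *)
pose om0 := Num.min (c / 2) (be * c ^+ 3 / 6000).
have om00 : 0 < om0.
  rewrite lt_min; apply/andP; split; first exact: divr_gt0.
  by apply: divr_gt0; [apply: mulr_gt0 => //; exact: exprn_gt0 | rewrite ltr0n].
have om0c : om0 <= c / 2 by rewrite ge_min lexx.
have om0d : 6000 / c ^+ 3 * om0 <= be.
  have : om0 <= be * c ^+ 3 / 6000 by rewrite ge_min lexx orbT.
  rewrite ler_pdivlMr ?ltr0n// => h.
  by rewrite mulrAC ler_pdivrMr ?exprn_gt0// mulrC.
pose kap := Num.min (1 / 100) ((c / 64) ^+ 3 * om0 / 1350).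
have kap0 : 0 < kap.
  have c64 : 0 < c / 64 by rewrite divr_gt0 ?ltr0n.
  rewrite lt_min; apply/andP; split; first by apply: divr_gt0; rewrite ?ltr01 ?ltr0n.
  by apply: divr_gt0; [apply: mulr_gt0 => //; exact: exprn_gt0 | rewrite ltr0n].
have kap100 : kap <= 1 / 100 by rewrite ge_min lexx.
have kapc : 1350 * kap <= (c / 64) ^+ 3 * om0.
  have : kap <= (c / 64) ^+ 3 * om0 / 1350 by rewrite ge_min lexx orbT.
  by rewrite ler_pdivlMr ?ltr0n// mulrC.
have be20 : 0 < be ^+ 2 by rewrite exprn_gt0.
have Lcb : 0 < Lc + be by rewrite addr_gt0 ?(lt_le_trans ltr01 Lc1).
pose om := Num.min om0 (Num.min (be ^+ 2) (ep / (Lc + be))).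
have omP : 0 < om by rewrite lt_min om00 lt_min be20 divr_gt0.
pose Bc := 2 * (Lc + be) / be.
have Bc0 : 0 < Bc by rewrite divr_gt0 ?mulr_gt0.
have [om_om0 om_be om_ep] : [/\ om <= om0, om <= be ^+ 2 & om <= ep / (Lc + be)].
  split; first by rewrite ge_min lexx.
    by rewrite ge_min; apply/orP; right; rewrite ge_min lexx.
  by rewrite ge_min; apply/orP; right; rewrite ge_min lexx orbT.
have cE : c = ep / 2 by [].
have LcE : Lc = 4 ^+ l0 by [].
have BcE : Bc = 2 * (Lc + be) / be by [].
clearbody Bc om kap om0 c ep Lc be.
exists kap, om, be, Bc, l0; split=> // m W eta L hW eta0 etao hNy hL lL conc conc0 hdiag.
move=> I subI lenI.
have eta_om0 := le_trans etao om_om0.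
have eta_be := le_trans etao om_be.
have eta_ep : eta * (Lc + be) <= ep.
  by rewrite -ler_pdivlMr//; exact: le_trans om_ep.
have eta1 : eta <= 1 by apply: (le_trans eta_om0); apply: (le_trans om0c); apply: (le_trans _ c1); rewrite ler_pdivrMr// ler_peMr ?(ltW c0)// ler1n.
have hdl : be * eta <= be ^+ 2.
  by apply: le_trans eta_be; rewrite ger_pMl.
have hep : Lc * eta + be * eta <= ep by rewrite -mulrDl mulrC.
pose lam j := eigv W j.
have avgE x y : avg_pk lam x y = stieltjes_im W x y by [].
have in2 k : `|gridpt (be * eta) k| <= 2 - ep -> `|gridpt (be * eta) k| <= 2.
  by move=> h; apply: (le_trans h); rewrite gerBl ltW.
have close k : `|gridpt (be * eta) k| <= 2 - ep ->
    `|avg_pk lam (gridpt (be * eta) k) eta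
      - Num.sqrt (1 - gridpt (be * eta) k ^+ 2 / 4)| <= be.
  move=> hk; have k2 := in2 _ hk; rewrite avgE; apply: le_trans om0d.
  apply: (local_law hW eta0 eta1 kap0 kap100 hNy hL) => //.
  - by move=> i l ll; have [] := conc i k l ll k2.
  - by move=> i l ll; have [] := conc i k l ll k2.
  - by rewrite cE; apply: bulk_lower.
have le4 k : `|gridpt (be * eta) k| <= 2 - ep ->
    avg_pk lam (gridpt (be * eta) k) (Lc * eta) <= 4.
  move=> hk; have k2 := in2 _ hk; rewrite avgE [Lc * eta]mulrC LcE.
  apply: (stieltjes_scale_le4 hW eta0 kap0 kap100 hNy _ lL) => i l ll.
  by have [] := conc i k l ll k2.
have subI' : [set` I] `<=` `](- (2 - eps)), (2 - eps)[%classic.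
  by rewrite opprB addrC.
have len0 : 0 < itv_length I by apply: lt_le_trans lenI; rewrite mulr_gt0.
have [a [b [[ab lenE] [ha hb] inI notinI intE]]] := interval_endpoints len0 subI'.
rewrite lenE in lenI *.
have ha' : -2 + 2 * ep <= a by clear -epe ha; lra.
have hb' : b <= 2 - 2 * ep by clear -epe hb; lra.
have a4 : -4 < a by clear -ep0 ha'; lra.
have hlen : 2 * (Lc * eta + be * eta) <= be * (b - a).
  move: lenI; rewrite BcE mulrAC ler_pdivrMr// [_ * be]mulrC.
  by rewrite -mulrDl mulrA.
have m0 : (0 < m.+1)%N by [].
have U := count_upper (I := [pred x | x \in I]) m0 eta0 be0 be1 Lc1 ep0 be0 be1 hdl hep close ab ha' hb' hlen inI.
have Lo := count_lower (I := [pred x | x \in I]) m0 eta0 be0 be1 Lc1 ep0 be0 be1 hdl hep close le4 ab ha' hb' hlen notinI.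
rewrite (intE a4).
have cardE : eig_count W I = #|[pred j | lam j \in [pred x | x \in I]]|.
  by apply: eq_card => j; rewrite !inE; apply/asboolP/idP.
rewrite cardE; set cnt := #|_|%:R in U Lo *.
have N0 : 0 < m.+1%:R :> R by rewrite ltr0n.
set nu := (m.+1%:R)^-1 * cnt in U Lo.
have l0' : 0 < b - a by rewrite subr_gt0.
have a2 : -2 <= a by clear -ep0 ha'; lra.
have b2 : b <= 2 by clear -ep0 hb'; lra.
have /andP[P0 Pl] := @sc_primitive_le R a b a2 (ltW ab) b2.
have nu0 : 0 <= nu by rewrite mulr_ge0 ?invr_ge0.
have p1 : 1 <= pi :> R by apply: le_trans (pi_ge2 R); rewrite ler1n.
have Lo' : pi * (sc_primitive b - sc_primitive a) - 4 * be * (b - a)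
    <= (1 + 2 * be) * (pi * nu).
  have := ler_wpM2r (ltW l0') hL8; move: Lo; rewrite -!(mulrA (1 + _)).
  by move: ((1 + 2 * be) * (pi * nu)) => u; clear -P0; lra.
have := count_combine be0 be6 nu0 l0' P0 Pl p1 hLat U Lo'.
rewrite [pi * _]mulrC mulfK ?gt_eqF ?pi_gt0//.
have -> : cnt - m.+1%:R * (sc_primitive b - sc_primitive a) =
    m.+1%:R * (nu - (sc_primitive b - sc_primitive a)).
  by rewrite [RHS]mulrBr [in RHS]/nu [in RHS]mulrA mulfV ?mul1r// gt_eqF.
move=> h; rewrite normrM (gtr0_norm N0) [leRHS]mulrAC [leRHS]mulrC.
rewrite ler_pM2l//; apply: (le_trans h).
by rewrite ler_wpM2r// ltW.
Qed.

End DeterministicLaw.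

(** * Normalization, union bound and Markov bound *)

Section Scaling.
Variable R : realType.

Lemma normalized_row_conc m (A : 'M[R[i]]_m.+1) i (phi : R -> R) e :
  `|Num.sqrt (specform (minor (normalized A) i) phi (minor_row A i))
    - Num.sqrt (spectr (minor (normalized A) i) phi)| <= Num.sqrt m.+1%:R * e ->
  row_conc (normalized A) i phi e.
Proof.
have N0 : 0 < m.+1%:R :> R by rewrite ltr0n.
rewrite /row_conc.
have -> : minor_row (normalized A) i =
    real_complex R (Num.sqrt m.+1%:R)^-1 *: minor_row A i.
  by apply/rowP => j; rewrite !mxE.
move: (minor _ _) (minor_row _ _) => B v.
rewrite specform_scale exprVn sqr_sqrtr ?(ltW N0)//.
have i0 : 0 <= m.+1%:R^-1 :> R by rewrite invr_ge0 ltW.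
rewrite !sqrtrM// -mulrBr normrM ger0_norm ?sqrtr_ge0// => h.
by rewrite sqrtrV ?(ltW N0)// ler_pdivrMl// sqrtr_gt0.
Qed.

(** Chebyshev's inequality over the rows, with the normalization of the diagonal
absorbed in [q]. *)
Lemma card_large_diag m (A : 'M[R[i]]_m.+1) (kap q : R) : 0 < kap ->
  \sum_i normc (A i i) ^+ 2 <= q * m.+1%:R ->
  #|[pred i | kap < normc (normalized A i i)]|%:R <= q / kap ^+ 2.
Proof.
move=> k0 hq; have N0 : 0 < m.+1%:R :> R by rewrite ltr0n.
have E i : normc (normalized A i i) ^+ 2 = normc (A i i) ^+ 2 / m.+1%:R.
  rewrite mxE ComplexField.Normc.normcM exprMn mulrC; congr (_ * _).
  by rewrite normc_real real_normK ?num_real// exprVn sqr_sqrtr// ltW.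
rewrite ler_pdivlMr ?exprn_gt0// mulr_natl -sumr_const.
apply: (@le_trans _ _ (\sum_i normc (normalized A i i) ^+ 2)).
  rewrite [leRHS](bigID [pred i | kap < normc (normalized A i i)]) /=.
  apply: ler_wpDr; first by apply: sumr_ge0 => i _; exact: sqr_ge0.
  by apply: ler_sum => i; rewrite inE => hi; rewrite ler_pXn2r ?nnegrE ?normc_ge0// ltW.
under eq_bigr do rewrite E.
by rewrite -mulr_suml ler_pdivrMr.
Qed.

End Scaling.

Section GoodEvent.
Context (d : measure_display) (T : measurableType d) (R : realType).
Variable P : probability T R.

Lemma union_bound (I : finType) (B : I -> set T) (c : R) :
  (forall i, measurable (B i) /\ (P (B i) <= c%:E)%E) ->
  exists E : set T, [/\ measurable E, (P E <= (#|I|%:R * c)%:E)%E &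
    forall i, B i `<=` E].
Proof.
move=> hB.
suff [E [mE pE sE]] : exists E : set T, [/\ measurable E,
    (P E <= ((size (enum I))%:R * c)%:E)%E & forall i, i \in enum I -> B i `<=` E].
  exists E; rewrite cardT; split=> // i; apply: sE; exact: mem_enum.
elim: (enum I) => [|i r [E [mE pE sE]]].
  by exists set0; rewrite measure0 mul0r; split.
have [mi pi] := hB i; exists (B i `|` E); split.
- exact: measurableU.
- apply: le_trans (measureU2 P mi mE) _.
  by rewrite /= -natr1 mulrDl mul1r addrC EFinD leeD.
- move=> j; rewrite inE => /orP[/eqP ->|/sE s] w; first by left.
  by move/s; right.
Qed.

Lemma markov_ge0 (Z : T -> R) (a b : R) : measurable_fun [set: T] Z ->
  (forall w, 0 <= Z w) -> 0 < b -> (\int[P]_w (Z w)%:E <= a%:E)%E ->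
  measurable [set w | b <= Z w] /\ (P [set w | (b <= Z w)%R] <= (a / b)%:E)%E.
Proof.
move=> mZ Z0 b0 hi.
have mE : measurable [set w | b <= Z w].
  rewrite (_ : [set w | _] = Z @^-1` `[b, +oo[).
    by rewrite -[X in measurable X]setTI; exact: mZ.
  by apply/seteqP; split=> w /=; rewrite in_itv /= andbT.
split=> //.
pose X : {RV P >-> R} := mfun_Sub (mem_set mZ).
have := @markov _ _ _ P X id b b0 (@measurable_id _ _ _) (fun r h => h) (fun x y _ _ h => h).
have -> : [set x | (b%:E <= `|(X x)%:E|)%E] = [set w | b <= Z w].
  by apply/seteqP; split=> w /=; rewrite lee_fin ger0_norm// Z0.
rewrite unlock (_ : (fun w => _) = fun w => (Z w)%:E); last first.
  by apply/funext => w /=; rewrite ger0_norm ?Z0.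
move=> h; have := le_trans h hi.
have fP : P [set w | b <= Z w] \is a fin_num by exact: fin_num_measure.
by rewrite -(fineK fP) -EFinM !lee_fin ler_pdivlMr// mulrC.
Qed.

End GoodEvent.

(** * The good events and the choice of scale *)

Section GoodRows.
Context (d : measure_display) (T : measurableType d) (R : realType).
Variables (P : probability T R) (m : nat) (M : T -> 'M[R[i]]_m.+1).
Hypothesis hherm : forall w, M w \is hermsymmx.
Hypothesis hmeas : forall i j : 'I_m.+1, complex_rv (fun w => M w i j).
Hypothesis hindep : mutually_independent P [set p : 'I_m.+1 * 'I_m.+1 | (p.1 <= p.2)%N]%SET
  (fun p w => M w p.1 p.2).
Hypothesis hint : forall i j : 'I_m.+1, (i <= j)%N ->
  complex_integrable P (fun w => M w i j).
Hypothesis hmean : forall i j : 'I_m.+1, (i <= j)%N ->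
  complex_expectation P (fun w => M w i j) = 0.
Hypothesis hvar : forall i j : 'I_m.+1, (i <= j)%N ->
  complex_variance P (fun w => M w i j) = 1%:E.

Lemma good_diag (q : R) : 0 < q ->
  exists E : set T, [/\ measurable E, (P E <= (q^-1)%:E)%E &
    forall w, ~ E w -> \sum_i normc (M w i i) ^+ 2 <= q * m.+1%:R].
Proof.
move=> q0; have N0 : 0 < m.+1%:R :> R by rewrite ltr0n.
pose Z w := \sum_i normc (M w i i) ^+ 2.
have mii (i : 'I_m.+1) : measurable_fun [set: T] (fun w => normc (M w i i) ^+ 2).
  exact/measurable_normc_sqr/(entry_cmeasurable hmeas).
have mZ : measurable_fun [set: T] Z by apply: measurable_sum => i; exact: mii.
have Z0 w : 0 <= Z w by apply: sumr_ge0 => i _; exact: sqr_ge0.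
have hi : (\int[P]_w (Z w)%:E <= (m.+1%:R : R)%:E)%E.
  under eq_integral do rewrite /Z -sumEFin.
  rewrite ge0_integral_sum//; last 2 first.
  - by move=> i; exact/measurable_EFinP.
  - by move=> i w _; rewrite lee_fin sqr_ge0.
  under eq_bigr => i _ do rewrite (entry_moment hherm hmean hvar).
  by rewrite sumEFin sumr_const card_ord.
have [mE pE] := markov_ge0 mZ Z0 (mulr_gt0 q0 N0) hi.
exists [set w | q * m.+1%:R <= Z w]; split=> //.
  by move: pE; rewrite invfM mulrCA mulfV ?gt_eqF// mulr1.
by move=> w /negP; rewrite -ltNge => /ltW.
Qed.

Variables (C0 C0' K : R).
Hypotheses (hC0 : 0 < C0) (hC0' : 0 < C0') (hK : 0 < K).
Hypothesis hconc : forall i, concentrated P C0 C0' K (fun w => col' i (row i (M w))).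

Lemma good_rows (J : finType) (phi : J -> R -> R) (t : R) :
  (forall j, measurable_weight (phi j)) -> (forall j l, 0 <= phi j l <= 1) -> 0 < t ->
  exists E : set T, [/\ measurable E,
    (P E <= ((m.+1 * #|J|)%:R * (C0 * expR (- (C0' * t ^+ 2 / K ^+ 2))))%:E)%E &
    forall w, ~ E w -> forall i j,
    `|Num.sqrt (specform (minor (normalized (M w)) i) (phi j) (minor_row (M w) i))
      - Num.sqrt (spectr (minor (normalized (M w)) i) (phi j))|
       <= t + Num.sqrt (C0 * K ^+ 2 / C0')].
Proof.
move=> mphi phi01 t0.
have hB (p : 'I_m.+1 * J) := row_bad_prob hherm hmeas hindep hint hmean hvar
  hC0 hC0' hK hconc p.1 (mphi p.2) (phi01 p.2) t0.
have [E [mE pE sE]] := union_bound hB.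
exists E; split=> //; first by move: pE; rewrite card_prod card_ord.
move=> w nE i j; rewrite leNgt; apply/negP => h; apply: nE.
exact: (sE (i, j) w (ltW h)).
Qed.

End GoodRows.

Section Scales.
Variable R : realType.

(** For eta = r^2 f the product N eta is r^2 K^2 l, at least a constant times r, while the
deviation is K sqrt(l) times a constant; all requirements become lower bounds on r. *)
Lemma scale_choice (C0 C0' kap om al Bc : R) : 0 < C0 -> 0 < C0' -> 0 < kap ->
  0 < om -> 0 < al -> 0 < Bc ->
  exists2 G : R, 1 <= G & forall N K r l : R, 0 < N -> 0 < K ->
  1 <= 2 * (C0 * K ^+ 2 / C0') -> 1 <= l -> G <= r ->
  let f := K ^+ 2 * l / N in let eta := r ^+ 2 * f in
  [/\ 0 < eta, (N * eta)^-1 <= kap ^+ 2, (eta * N)^-1 <= kap &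
      r / kap ^+ 2 <= kap * (N * eta)] /\
  [/\ K * Num.sqrt (4 / C0' * l) + Num.sqrt (C0 * K ^+ 2 / C0')
        <= Num.sqrt N * (kap * Num.sqrt eta),
      Bc * eta <= r ^+ 4 * f, r ^+ 4 * f <= 4 -> eta <= om & 4 <= N * (al * eta)].
Proof.
move=> hC0 hC0' k0 o0 a0 B0; pose k := C0' / (2 * C0).
have kk0 : 0 < k by rewrite divr_gt0 ?mulr_gt0.
pose c1 := Num.sqrt (4 / C0') + Num.sqrt (C0 / C0').
have c10 : 0 <= c1 by rewrite addr_ge0 ?sqrtr_ge0.
(* One threshold for each requirement; any r above their sum is good. *)
pose s := [:: c1 / kap; (kap ^+ 2 * k)^-1; (kap * k)^-1; (kap ^+ 3 * k)^-1; Bc; 4 / om;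
   4 / (al * k)].
have s0 x : x \in s -> 0 <= x.
  have inv a : 0 < a -> 0 <= (a * k)^-1.
    by move=> h; rewrite invr_ge0 mulr_ge0 ?ltW.
  move=> xs; have : all (>= 0) s; last by move/allP; apply.
  rewrite /= !inv ?exprn_gt0// !divr_ge0 ?(ltW B0) ?(ltW k0) ?(ltW o0)//.
  by rewrite mulr_ge0 ?ltW.
have sle x : x \in s -> x <= 1 + \sum_(y <- s) y.
  move=> xs; rewrite (perm_big _ (perm_to_rem xs)) big_cons addrCA lerDl.
  rewrite addr_ge0// big_seq; apply: sumr_ge0 => y /mem_rem; exact: s0.
exists (1 + \sum_(y <- s) y).
  by rewrite lerDl big_seq; apply: sumr_ge0 => y; exact: s0.
move=> N K r l N0 K0 hV l1 Gr f eta.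
have rs x : x \in s -> x <= r by move=> /sle h; exact: le_trans Gr.
have r1 : 1 <= r.
  by apply: (le_trans _ Gr); rewrite lerDl big_seq; apply: sumr_ge0 => y; exact: s0.
have r0 : 0 < r by exact: lt_le_trans r1.
have rr : r <= r ^+ 2 by rewrite expr2 ler_peMr// ltW.
have l0 : 0 < l by exact: lt_le_trans l1.
have K2 : 0 < K ^+ 2 by rewrite exprn_gt0.
have f0 : 0 < f by rewrite divr_gt0 ?mulr_gt0.
have e0 : 0 < eta by rewrite mulr_gt0 ?exprn_gt0.
have Ne : N * eta = r ^+ 2 * (K ^+ 2 * l).
  by rewrite /eta /f mulrCA; congr (_ * _); rewrite mulrCA mulfV ?mulr1// gt_eqF.
have kKl : k <= K ^+ 2 * l.
  apply: (@le_trans _ _ (K ^+ 2)); last by rewrite ler_peMr ?(ltW K2).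
  by move: hV; rewrite mulrA ler_pdivlMr// mul1r /k ler_pdivrMr ?mulr_gt0// mulrA [leRHS]mulrC.
have Nk : r * k <= N * eta.
  by rewrite Ne; apply: ler_pM => //; exact: ltW.
have Ne0 : 0 < N * eta by rewrite mulr_gt0.
have small a : 0 < a -> (a * k)^-1 <= r -> a^-1 <= N * eta.
  move=> ha; rewrite invfM -ler_pdivlMr ?invr_gt0// invrK => h; exact: le_trans Nk.
split; split=> //.
- rewrite -[leRHS]invrK lef_pV2 ?posrE ?invr_gt0 ?exprn_gt0//.
  by apply: small; rewrite ?exprn_gt0// rs// /s !inE eqxx !orbT.
- rewrite mulrC -[leRHS]invrK lef_pV2 ?posrE ?invr_gt0//.
  by apply: small => //; rewrite rs// /s !inE eqxx !orbT.
- rewrite ler_pdivrMr ?exprn_gt0// mulrAC -exprS Ne.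
  apply: (@le_trans _ _ (kap ^+ 3 * (r ^+ 2 * k))); last first.
    by rewrite ler_pM2l ?exprn_gt0// ler_pM2l ?exprn_gt0.
  have h : (kap ^+ 3 * k)^-1 <= r by rewrite rs// /s !inE eqxx !orbT.
  rewrite mulrCA expr2 -mulrA ler_peMr ?(ltW r0)// [r * _]mulrC.
  have k30 : 0 < kap ^+ 3 * k by rewrite mulr_gt0 ?exprn_gt0.
  by rewrite -(ler_pdivrMl _ _ k30) mulr1.
- have h : c1 <= r * kap by rewrite -ler_pdivrMr// rs// /s !inE eqxx.
  rewrite [leRHS]mulrCA -(sqrtrM _ (ltW N0)) Ne.
  have -> : Num.sqrt (r ^+ 2 * (K ^+ 2 * l)) = r * (K * Num.sqrt l).
    by rewrite (sqrtrM _ (sqr_ge0 r)) (sqrtrM _ (sqr_ge0 K)) !sqrtr_sqr !gtr0_norm.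
  have -> : Num.sqrt (C0 * K ^+ 2 / C0') = K * Num.sqrt (C0 / C0').
    by rewrite mulrAC mulrC (sqrtrM _ (sqr_ge0 K)) sqrtr_sqr gtr0_norm.
  rewrite sqrtrM ?divr_ge0 ?(ltW hC0')// -mulrDr [r * _]mulrCA [leRHS]mulrCA ler_pM2l//.
  have sl : 1 <= Num.sqrt l by rewrite -sqrtr1 ler_wsqrtr.
  apply: (@le_trans _ _ (c1 * Num.sqrt l)).
    by rewrite [leRHS]mulrDl lerD2l ler_peMr ?sqrtr_ge0.
  by rewrite mulrA ler_wpM2r ?sqrtr_ge0// mulrC.
- rewrite /eta mulrA ler_pM2r// (exprD r 2 2) ler_pM2r ?exprn_gt0//.
  by apply: (le_trans _ rr); rewrite rs// /s !inE eqxx !orbT.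
- rewrite (exprD r 2 2) -mulrA => gf.
  have h : 4 / om <= r by rewrite rs// /s !inE eqxx !orbT.
  rewrite -(ler_pM2l (x := r ^+ 2)) ?exprn_gt0//; apply: (le_trans gf).
  by rewrite -ler_pdivrMr//; exact: le_trans rr.
- have h : 4 / (al * k) <= r by rewrite rs// /s !inE eqxx !orbT.
  rewrite mulrCA; apply: le_trans (ler_wpM2l (ltW a0) Nk).
  have ak : 0 < al * k by exact: mulr_gt0.
  by rewrite [leRHS]mulrCA -(ler_pdivrMr _ _ ak).
Qed.

End Scales.

(** * The law at finite size *)

Section Step.
Variable R : realType.

(** One weight for each grid point, scale and kernel, plus the constant one, for each row;
the probability of one event is of order n^-4. *)
Lemma event_count (m : nat) (C0 : R) : 0 < C0 ->
  (m.+1 * ((m.+2 * m.+2 * 2).+1))%:R * (C0 * expR (- (4 * ln m.+1%:R)))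
   <= 9 * C0 / m.+1%:R.
Proof.
move=> c0; have N0 : 0 < m.+1%:R :> R by rewrite ltr0n.
have -> : expR (- (4 * ln m.+1%:R)) = (m.+1%:R : R) ^- 4.
  by rewrite expRN (expRM_natl 4) lnK// posrE.
have h : ((m.+2 * m.+2 * 2).+1 <= 9 * m.+1 ^ 2)%N by rewrite expnS expn1; lia.
rewrite natrM mulrA mulrAC [leRHS]mulrAC.
apply: ler_wpM2r; first exact: ltW.
rewrite ler_pdivrMr ?exprn_gt0// mulrAC ler_pdivlMr//.
rewrite -[leLHS]mulrA [leLHS]mulrCA -expr2.
apply: (@le_trans _ _ ((9 * m.+1 ^ 2)%:R * m.+1%:R ^+ 2)).
  by rewrite ler_wpM2r ?exprn_ge0 ?(ltW N0)// ler_nat.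
by rewrite natrM natrX -mulrA -exprD.
Qed.

(** Union bound over the exceptional events at the scale of [scale_choice]; n scales
suffice as eta 4^n is at least eta n, which is large, and n + 1 grid points as the spacing is at least 4 / n. *)
Lemma lscl_step (C0 C0' eps delta : R) : 0 < C0 -> 0 < C0' -> 0 < eps -> 0 < delta ->
  exists (G : R) (n0 : nat), 1 <= G /\
  forall (d : measure_display) (T : measurableType d) (P : probability T R) (m : nat)
    (M : T -> 'M[R[i]]_m.+1) (K : R),
  0 < K -> (forall w, M w \is hermsymmx) ->
  (forall i j, complex_rv (fun w => M w i j)) ->
  mutually_independent P [set p : 'I_m.+1 * 'I_m.+1 | (p.1 <= p.2)%N]%SET
     (fun p w => M w p.1 p.2) ->
  (forall i j : 'I_m.+1, (i <= j)%N -> complex_integrable P (fun w => M w i j)) ->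
  (forall i j : 'I_m.+1, (i <= j)%N -> complex_expectation P (fun w => M w i j) = 0) ->
  (forall i j : 'I_m.+1, (i <= j)%N -> complex_variance P (fun w => M w i j) = 1%:E) ->
  (forall i, concentrated P C0 C0' K (fun w => col' i (row i (M w)))) ->
  (n0 <= m.+1)%N -> forall r : R, G <= r ->
  exists A : set T, [/\ measurable A,
    A `<=` [set w | forall I : interval R,
      [set` I] `<=` `](-2 + eps), (2 - eps)[%classic ->
      r ^+ 4 * (K ^+ 2 * ln m.+1%:R / m.+1%:R) <= itv_length I ->
      `|(eig_count (normalized (M w)) I)%:R
          - m.+1%:R * Rintegral lebesgue_measure [set` I] (@rho_sc R)|
        <= delta * m.+1%:R * itv_length I] &
    ((1 - (9 * C0 / m.+1%:R + r^-1))%:E <= P A)%E].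
Proof.
move=> hC0 hC0' eps0 delta0.
have [kap [om [al [Bc [l0 [[kap0 om0 al0 Bc0] det]]]]]] := lscl_deterministic eps0 delta0.
have [G G1 sc] := scale_choice hC0 hC0' kap0 om0 al0 Bc0.
exists G, (maxn l0 (maxn 2 (Num.truncn (expR 1 : R)).+1)); split=> //.
move=> d T P m M K hK hherm hmeas hindep hint hmean hvar hconc hn r Gr.
have N0 : 0 < m.+1%:R :> R by rewrite ltr0n.
have r0 : 0 < r by apply: lt_le_trans Gr; exact: lt_le_trans G1.
move: hn; rewrite !geq_max => /andP[l0n /andP[m0 en]].
have ln1 : 1 <= ln m.+1%:R :> R.
  rewrite -[leLHS](@expRK R) ler_ln ?posrE ?expR_gt0//.
  apply: ltW; apply: (@lt_le_trans _ _ ((Num.truncn (expR 1 : R)).+1)%:R); last by rewrite ler_nat.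
  by have /andP[] := truncn_itv (expR_ge0 (1 : R)).
have hV := concentration_lower_bound hherm hmeas hindep hint hmean hvar hC0 hC0' hK hconc m0.
have [[]] := sc _ _ r _ N0 hK hV ln1 Gr.
set f := K ^+ 2 * ln m.+1%:R / m.+1%:R; set eta := r ^+ 2 * f => e0 h1 h2 h3 [h4 h5 h6 h7].
(* Intervals in the bulk are shorter than 4. *)
have [gf|gf] := leP (r ^+ 4 * f) 4; last first.
  exists setT; split => //; last first.
    by rewrite probability_setT lee_fin gerBl addr_ge0 ?divr_ge0 ?mulr_ge0 ?invr_ge0 ?(ltW r0) ?(ltW hC0).
  move=> w _ I subI lenI.
  have len0 : 0 < itv_length I by apply: lt_le_trans lenI; apply: lt_trans gf.
  have subI' : [set` I] `<=` `](- (2 - eps)), (2 - eps)[%classic by rewrite opprB addrC.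
  have [a [b [[_ lenE] [ha hb] _ _ _]]] := interval_endpoints len0 subI'.
  by exfalso; move: lenI gf; rewrite lenE; move: ha hb eps0; clear; lra.
pose L := m.+1; pose x k := gridpt (al * eta) k; pose y l := eta * 4 ^+ l.
have y0 l : 0 < y l by rewrite mulr_gt0 ?exprn_gt0.
pose J := option ('I_m.+2 * 'I_m.+2 * bool).
pose phi (j : J) : R -> R := match j with
  | Some (k, l, b) => if b then wgt1 (x k) (y l) else wgt2 (x k) (y l)
  | None => fun=> 1 end.
(* Chosen so that C0' t^2 / K^2 = 4 ln n. *)
pose t := K * Num.sqrt (4 / C0' * ln m.+1%:R).
have t0 : 0 < t.
  by rewrite mulr_gt0// sqrtr_gt0 mulr_gt0 ?divr_gt0// (lt_le_trans _ ln1).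
have mphi j : measurable_weight (phi j).
  move=> d' T' m' A v hA mA mv; case: j => [[[k l] []]|] /=.
  - exact: measurable_wgt1.
  - exact: measurable_wgt2.
  - exact: measurable_wgt0.
have phi01 j u : 0 <= phi j u <= 1.
  case: j => [[[k l] []]|] /=; last by rewrite ler01 lexx.
    by rewrite wgt1_ge0 ?wgt1_le1.
  have /andP[-> h] := wgt2_bound (x k) u (y0 l).
  by rewrite (le_trans h)// wgt1_le1.
have [E1 [mE1 pE1 sE1]] := good_rows hherm hmeas hindep hint hmean hvar hC0 hC0' hK hconc
  mphi phi01 t0.
have [E2 [mE2 pE2 sE2]] := good_diag hherm hmeas hmean hvar r0.
exists (~` (E1 `|` E2)); split.
- by apply: measurableC; exact: measurableU.
- move=> w /= nE I subI lenI.
  have n1 : ~ E1 w by move=> h; apply: nE; left.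
  have n2 : ~ E2 w by move=> h; apply: nE; right.
  have rc i j : row_conc (normalized (M w)) i (phi j) (kap * Num.sqrt eta).
    by apply: normalized_row_conc; apply: le_trans h4; exact: sE1.
  apply: (det m _ eta L (normalized_herm hherm w) e0 (h6 gf) h1) => //.
  + apply: le_trans h2; rewrite lef_pV2 ?posrE; [|exact: (y0 L)|exact: mulr_gt0].
    by rewrite ler_pM2l// -natrX ler_nat ltnW// ltn_expl.
  + move=> i k l lL xk.
    have kK : (k < m.+2)%N.
      rewrite ltnS -(ler_nat R) -(ler_pM2r (mulr_gt0 al0 e0)); apply: le_trans h7.
      move: xk; rewrite /gridpt ler_norml mulrC => /andP[_]; clear; lra.
    have lL' : (l < m.+2)%N by [].
    by split; [exact: (rc i (Some (Ordinal kK, Ordinal lL', true)))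
      | exact: (rc i (Some (Ordinal kK, Ordinal lL', false)))].
  + by move=> i; exact: (rc i None).
  + by apply: le_trans h3; apply: card_large_diag => //; exact: sE2.
  + exact: le_trans lenI.
rewrite probability_setC; last exact: measurableU.
rewrite EFinB leeB//; apply: le_trans (measureU2 P mE1 mE2) _.
rewrite EFinD; apply: leeD => //; apply: le_trans pE1 _; rewrite lee_fin.
have -> : C0' * t ^+ 2 / K ^+ 2 = 4 * ln m.+1%:R.
  rewrite exprMn sqr_sqrtr; last by rewrite mulr_ge0 ?divr_ge0 ?(ltW hC0')// (le_trans _ ln1).
  by field; rewrite !gt_eqF.
apply: le_trans (event_count m hC0).
by rewrite card_option !card_prod !card_ord card_bool.
Qed.

End Step.

(** * The law with high probability *)

Theorem theorem1p10 (R : realType) (d : nat -> measure_display)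
    (T : forall n, measurableType (d n)) (P : forall n, probability (T n) R)
    (M : forall n, T n -> 'M[R[i]]_n) (C0 C0' : R) (K : nat -> R)
    (hC0 : 0 < C0) (hC0' : 0 < C0') (hK : forall n, 0 < K n)
    (hherm : forall n w, M n w \is hermsymmx)
    (hmeas : forall n (i j : 'I_n), complex_rv (fun w => M n w i j))
    (hindep : forall n, mutually_independent (P n)
       [set p : 'I_n * 'I_n | (p.1 <= p.2)%N] (fun p w => M n w p.1 p.2))
    (hint : forall n (i j : 'I_n), (i <= j)%N ->
       complex_integrable (P n) (fun w => M n w i j))
    (hmean : forall n (i j : 'I_n), (i <= j)%N ->
       complex_expectation (P n) (fun w => M n w i j) = 0)
    (hvar : forall n (i j : 'I_n), (i <= j)%N ->
       complex_variance (P n) (fun w => M n w i j) = 1%:E)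
    (hconc : forall n (i : 'I_n),
       concentrated (P n) C0 C0' (K n) (fun w => col' i (row i (M n w)))) :
  LSCL_at_scale P M (fun n => K n ^+ 2 * ln n%:R / n%:R).
Proof.
move=> eps delta g eps0 delta0 ginf.
have [G [n0 [G1 step]]] := lscl_step hC0 hC0' eps0 delta0.
(* The fourth root of g: intervals have length at least r^4 f, and eta = r^2 f. *)
pose r n := Num.sqrt (Num.sqrt (g n)).
have r4 n : 0 <= g n -> r n ^+ 4 = g n.
  by move=> gn; rewrite (exprM _ 2 2) sqr_sqrtr ?sqrtr_ge0// sqr_sqrtr.
have rge n c : 0 <= c -> c ^+ 4 <= g n -> c <= r n.
  move=> c0 h; have gn : 0 <= g n by apply: le_trans h; exact: exprn_ge0.
  by rewrite -(ler_pXn2r (n := 4)) ?nnegrE ?sqrtr_ge0// r4.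
pose good n := [set w | forall I : interval R,
  [set` I] `<=` `](-2 + eps), (2 - eps)[%classic ->
  g n * (K n ^+ 2 * ln n%:R / n%:R) <= itv_length I ->
  `|(eig_count (normalized (M n w)) I)%:R
      - n%:R * Rintegral lebesgue_measure [set` I] (@rho_sc R)|
    <= delta * n%:R * itv_length I].
have hA n : exists A : set (T n), [/\ measurable A, A `<=` good n &
    (n0 <= n)%N -> (0 < n)%N -> G ^+ 4 <= g n ->
    ((1 - (9 * C0 / n%:R + (r n)^-1))%:E <= P n A)%E].
  have [/and3P[hn n_gt0 hg]|/negP h] := boolP [&& (n0 <= n)%N, (0 < n)%N & G ^+ 4 <= g n]; last first.
    by exists set0; split => // *; exfalso; apply: h; apply/and3P.
  have G0 : 0 <= G by exact: le_trans G1.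
  have gn : 0 <= g n by apply: le_trans hg; exact: exprn_ge0.
  have Gr : G <= r n by exact: rge.
  rewrite /good -(r4 _ gn); move: (r n) Gr => rn Gr.
  case: n hn n_gt0 {hg gn} => // m hn _.
  have [A [mA sA pA]] := step _ _ (P m.+1) m (M m.+1) (K m.+1) (hK _) (@hherm _)
    (@hmeas _) (@hindep _) (@hint _) (@hmean _) (@hvar _) (@hconc _) hn rn Gr.
  by exists A; split.
pose A n := sval (cid (hA n)).
have [mA sA pA] : [/\ forall n, measurable (A n), forall n, A n `<=` good n &
    forall n, (n0 <= n)%N -> (0 < n)%N -> G ^+ 4 <= g n ->
    ((1 - (9 * C0 / n%:R + (r n)^-1))%:E <= P n (A n))%E].
  by split=> n; rewrite /A; case: (cid (hA n)) => B [].
exists A; split=> //.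
have fP n : P n (A n) \is a fin_num by exact: fin_num_measure.
apply/fine_cvgP; split; first by near=> n.
apply/cvgrPdist_le => e e0; near=> n => /=.
have n_gt0 : (0 < n)%N by near: n; exact: nbhs_infty_gt.
have n_ge : (n0 <= n)%N by near: n; exact: nbhs_infty_ge.
have g_ge : G ^+ 4 <= g n by near: n; move/cvgryPge: ginf; apply.
have := probability_le1 (P n) (mA n); move: (pA n n_ge n_gt0 g_ge); rewrite -(fineK (fP n)) !lee_fin.
rewrite /=; move: (fine _) => p pl p1; rewrite ger0_norm ?subr_ge0//.
have h1 : 9 * C0 / n%:R <= e / 2.
  rewrite ler_pdivrMr ?ltr0n// -ler_pdivrMl ?divr_gt0//.
  by near: n; exact: nbhs_infty_ger.
have h2 : (r n)^-1 <= e / 2.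
  have h : (2 / e) <= r n.
    by apply: rge; rewrite ?divr_ge0 ?(ltW e0)//; near: n; move/cvgryPge: ginf; apply.
  rewrite -[leRHS]invrK invf_div lef_pV2 ?posrE ?divr_gt0//.
  by apply: lt_le_trans h; rewrite divr_gt0.
by move: pl h1 h2; clear; lra.
Unshelve. all: by end_near.
Qed.
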